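(* Let $q$ be a power of a prime $p$, let $e=\gcd(2,q-1)$, let $x\in\mathbb{F}_q^\times$, and let $\mathcal{O}_{1,x}$ be the conjugacy class of $\begin{bmatrix}1&x\\0&1\end{bmatrix}$ in $\mathrm{PSL}(2,q)$. The subracks of $\mathcal{O}_{1,x}$ are the following; that is, every subrack of $\mathcal{O}_{1,x}$ is of one of the types (1)–(8), and conversely each of the listed types (for all admissible values of its parameters) occurs as a subrack of $\mathcal{O}_{1,x}$: (1) abelian subracks of size at most $\frac{q-1}{e}$: the conjugates in $\mathrm{PSL}(2,q)$ of non-empty subsets of $\left\{\begin{bmatrix}1&bx\\0&1\end{bmatrix}\,\Big|\,b\in\mathbb{F}_q^{\times 2}\right\}$; (2) subracks isomorphic to a unipotent class of $\mathrm{PSL}(2,q_0)$, where $q$ is a power of $q_0$; (3) subracks isomorphic to the unipotent class of $\mathrm{PGL}(2,q_0)$ (the conjugacy class of $\begin{bmatrix}1&1\\0&1\end{bmatrix}$ in $\mathrm{PGL}(2,q_0)$), where $q$ is odd and a power of $q_0^2$; (4) if $p=2$, subracks isomorphic to the class of involutions of the dihedral group $D_{2n}$ of order $2n$, where $n$ divides $q-1$ or $q+1$; (5) if $p=2$ and $q$ is a power of $4$, subracks isomorphic to the class of involutions in the alternating group $\mathbb{A}_5$; (6) if $p=3$, subracks isomorphic to a conjugacy class of $3$-cycles in $\mathbb{A}_4$; (7) if $p=3$ and $q$ is a power of $p^2$, subracks isomorphic to the union of the two conjugacy classes of $3$-cycles in $\mathbb{A}_4$; (8) if $p=3$ and $q$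 is a power of $p^2$, subracks isomorphic to the class of $3$-cycles in $\mathbb{A}_5$.
   Context: $\mathbb{F}_q^{\times2}$ is the group of squares of $\mathbb{F}_q^\times$. $\mathrm{PGL}(2,q)$ is the group of invertible $2\times2$ matrices over $\mathbb{F}_q$ modulo nonzero scalars (linear fractional transformations of the projective line $\mathbb{P}(1,q)$ over $\mathbb{F}_q$); $\begin{bmatrix}a&b\\c&d\end{bmatrix}$ denotes the class of a matrix. $\mathrm{PSL}(2,q)$ is the subgroup of classes with $ad-bc\in\mathbb{F}_q^{\times2}$. A conjugacy class of $\mathrm{PSL}(2,q)$ or $\mathrm{PGL}(2,q)$ is unipotent if its elements have exactly one fixed point in $\mathbb{P}(1,q)$. A rack is a non-empty set $X$ with a binary operation $\triangleright$ such that every map $y\mapsto x\triangleright y$ is bijective and $x\triangleright(y\triangleright z)=(x\triangleright y)\triangleright(x\triangleright z)$. A group is a rack via $g\triangleright h=ghg^{-1}$, and unions of conjugacy classes are racks under this operation. A subrack is a non-empty subset closed under $\triangleright$. A rack is abelian if $x\triangleright y=y$ for all $x,y$. Isomorphic means isomorphic as racks. In the list, $q_0$ denotes a prime power. *)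

(* Defs.v *)
From mathcomp Require Import all_boot all_order all_algebra.
From mathcomp Require Import all_fingroup all_solvable.

Set Implicit Arguments.
Unset Strict Implicit.
Unset Printing Implicit Defensive.

Import GroupScope GRing.Theory.

(* The exponent is positive. *)
Definition power_of (n q : nat) : Prop := exists2 k, (0 < k)%N & q = (n ^ k)%N.

Section Racks.
Variables (T : finType) (op : T -> T -> T).
Implicit Types X Y : {set T}.

Definition is_rack X : Prop :=
  [/\ X != set0,
      {in X, forall x, {in X &, injective (op x)} /\ op x @: X = X}
    & {in X & &, forall x y z, op x (op y z) = op (op x y) (op x z)}].

(* [Y] is a subrack of the rack [X]. *)
Definition is_subrack Y X : Prop :=
  [/\ Y != set0, Y \subset X & {in Y &, forall x y, op x y \in Y}].

Definition abelian_rack X : Prop := {in X &, forall x y, op x y = y}.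

Lemma subrack_is_rack X Y : is_rack X -> is_subrack Y X -> is_rack Y.
Proof.
case=> _ bijX distrX [Yn0 /subsetP sYX clY]; split=> //; last first.
  by move=> x y z /sYX Xx /sYX Xy /sYX Xz; apply: distrX.
move=> x Yx; have [injx _] := bijX x (sYX x Yx).
have injY: {in Y &, injective (op x)} by move=> y z /sYX Xy /sYX; apply: injx.
split=> //; apply/eqP; rewrite eqEcard (card_in_imset injY) leqnn andbT.
by apply/subsetP=> _ /imsetP[y Yy ->]; apply: clY.
Qed.

End Racks.

(* [X] and [Y] are isomorphic as racks. *)
Definition rack_isom (T U : finType) (opT : T -> T -> T) (opU : U -> U -> U)
    (X : {set T}) (Y : {set U}) : Prop :=
  exists f : T -> U,
    [/\ {in X &, injective f}, f @: X = Y
      & {in X &, forall x y, f (opT x y) = opU (f x) (f y)}].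

(* MathComp's conjugation [h ^ g] is [g^-1 * h * g]; racks use the other side. *)
Definition conj_op (gT : finGroupType) (g h : gT) : gT := g * h * g^-1.

Lemma class_union_is_rack (gT : finGroupType) (G : {group gT}) (X : {set gT}) :
  X != set0 -> X \subset G -> G \subset 'N(X) -> is_rack (@conj_op gT) X.
Proof.
move=> Xn0 /subsetP sXG /subsetP nXG.
have injop (x : gT) : injective (conj_op x).
  by move=> y z /mulIg /mulgI.
split=> //; last by move=> x y z _ _ _; rewrite /conj_op !invMg invgK !mulgA !mulgKV.
move=> x Xx; split; first by move=> y z _ _; apply: injop.
apply/eqP; rewrite eqEcard (card_imset _ (injop x)) leqnn andbT.
apply/subsetP=> _ /imsetP[y Xy ->].
have ->: conj_op x y = y ^ x^-1 by rewrite /conj_op conjgE invgK mulgA.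
by rewrite memJ_norm // nXG // groupV sXG.
Qed.

Section ProjectiveGroups.
Variable F : finFieldType.

(* The group of squares of F^*. *)
Definition unit_squares : {set F} := [set (c ^+ 2)%R | c : F & (c != 0)%R].

Definition scalars : {set {'GL_2[F]}} := [set g | is_scalar_mx (GLval g)].

Lemma scalars_group_set : group_set scalars.
Proof.
apply/group_setP; split; first by rewrite inE; apply: scalar_mx_is_scalar.
move=> g h; rewrite !inE => /is_scalar_mxP[a ga] /is_scalar_mxP[b hb].
by rewrite GL_ME ga hb -[(_ * _)%R]scalar_mxM scalar_mx_is_scalar.
Qed.
Canonical scalars_group := Group scalars_group_set.

Definition PGL : finGroupType := coset_of scalars.

(* Makes the quotient below, [coset scalars : {'GL_2[F]} -> PGL], the full
   quotient by the scalars. *)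
Lemma scalars_normal : scalars <| 'GL_2[F].
Proof.
rewrite /normal subsetT; apply/subsetP=> g _; rewrite inE.
apply/subsetP=> _ /imsetP[h Sh ->].
suff ->: h ^ g = h by [].
have /is_scalar_mxP[a ha] : is_scalar_mx (GLval h) by rewrite inE in Sh.
apply: (mulgI g); rewrite -conjgC; apply: val_inj.
suff: GLval (h * g) = GLval (g * h) by [].
by rewrite !GL_ME ha; apply: esym; apply: scalar_mxC.
Qed.

Definition PSL : {set PGL} :=
  [set coset scalars g | g : {'GL_2[F]} & (\det (GLval g))%R \in unit_squares].

Lemma PSL_group_set : group_set PSL.
Proof.
have nS (g : {'GL_2[F]}) : g \in 'N(scalars).
  by case/andP: scalars_normal => _ /subsetP; apply; rewrite inE.
apply/group_setP; split.
  apply/imsetP; exists 1; last by rewrite coset_id // group1.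
  rewrite inE GL_1E det1; apply/imsetP; exists 1%R; last by rewrite expr1n.
  by rewrite inE oner_neq0.
move=> u v /imsetP[g /[!inE] /imsetP[a /[!inE] an0 da] ->].
case/imsetP=> [h /[!inE] /imsetP[b /[!inE] bn0 db] ->].
apply/imsetP; exists (g * h); last by rewrite morphM.
rewrite inE GL_ME [(\det (_ * _))%R]det_mulmx da db -exprMn.
by apply/imsetP; exists (a * b)%R; rewrite // inE mulf_neq0.
Qed.
Canonical PSL_group := Group PSL_group_set.

(* The projective line: [Some z] is the point [z : 1], [None] is [1 : 0]. *)
Definition lin_frac (A : 'M[F]_2) (P : option F) : option F :=
  let: (a, b, c, d) :=
    (A ord0 ord0, A ord0 ord_max, A ord_max ord0, A ord_max ord_max) in
  (if P is Some z then
     if c * z + d == 0 then None else Some ((a * z + b) / (c * z + d))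
   else if c == 0 then None else Some (a / c))%R.

Definition pgl_act (h : PGL) (P : option F) : option F :=
  lin_frac (GLval (repr (set_of_coset h))) P.

Lemma pgl_actE (g : {'GL_2[F]}) P :
  pgl_act (coset scalars g) P = lin_frac (GLval g) P.
Proof.
rewrite /pgl_act.
have nSg: g \in 'N(scalars).
  by case/andP: scalars_normal => _ /subsetP; apply; rewrite inE.
have := mem_repr_coset (coset scalars g).
set r := repr _; rewrite val_coset // => /rcosetP[s].
rewrite inE => /is_scalar_mxP[k sk] ->; rewrite GL_ME sk.
have kn0: (k != 0)%R.
  apply/negP=> /eqP k0; have := GL_det s.
  by rewrite sk k0 -scalemx1 scale0r det0 eqxx.
have E i j : ((k%:M * GLval g) i j = k * GLval g i j)%R.
  by rewrite [(_ * _)%R]mul_scalar_mx mxE.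
rewrite /lin_frac !E; case: P => [z|].
  rewrite -!mulrA -!mulrDr mulf_eq0 (negPf kn0) /=.
  by case: ifP => // _; rewrite -mulf_div divff // mul1r.
rewrite mulf_eq0 (negPf kn0) /=.
by case: ifP => // _; rewrite -mulf_div divff // mul1r.
Qed.

(* [C] is a unipotent class of [G], where [G] is PSL(2,q) or PGL(2,q). *)
Definition unipotent_class (G C : {set PGL}) : Prop :=
  C \in classes G /\
  {in C, forall h, #|[set P : option F | pgl_act h P == P]| = 1%N}.

Definition unip_mx (x : F) : 'M[F]_2 :=
  (\matrix_(i, j) if i == j then 1 else if i == ord0 then x else 0)%R.

Lemma unip_mx_unit (x : F) : unip_mx x \is a GRing.unit.
Proof.
rewrite -[_ \is a _]/(unip_mx x \in unitmx) unitmxE -det_tr det_trig.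
  by rewrite big1 ?unitr1 // => i _; rewrite !mxE eqxx.
apply/is_trig_mxP=> i j ij; rewrite !mxE.
by rewrite -!(inj_eq val_inj) /= !gtn_eqF // (leq_ltn_trans _ ij).
Qed.

(* The class of the matrix with rows (1, x) and (0, 1). *)
Definition unip (x : F) : PGL :=
  coset scalars (FinRing.Unit (unip_mx_unit x) : {'GL_2[F]}).

Definition unip_orbit (x : F) : {set PGL} := unip x ^: PSL.

(* Conjugates in PSL(2,q) of non-empty subsets of {unip (b x) | b a square}. *)
Definition unip_subset_conjugate (x : F) (X : {set PGL}) : Prop :=
  exists (S : {set PGL}) (g : PGL),
    [/\ S != set0, S \subset [set unip (b * x)%R | b in unit_squares],
        g \in PSL & X = S :^ g].

End ProjectiveGroups.

(* The dihedral group of order 2n, for all n > 0; MathComp's ['D_(2 * n)]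
   requires n > 1. *)
Definition is_dihedral (n : nat) (gT : finGroupType) (G : {group gT}) : Prop :=
  G \isog Grp (x : y : x ^+ n, y ^+ 2, x ^ y = x^-1).

Definition involutions (gT : finGroupType) (G : {set gT}) : {set gT} :=
  [set g in G | #[g] == 2].

Definition is_3cycle (T : finType) (s : {perm T}) : bool :=
  [exists a, exists b, exists c,
    [&& uniq [:: a; b; c], s a == b, s b == c, s c == a
      & perm_on [set a; b; c] s]].

Definition three_cycles (T : finType) : {set {perm T}} :=
  [set s in 'Alt_T | is_3cycle s].

(* The model racks for subracks of the class O_{1,x} that need not be abelian,
   each a set of elements of a finite group, closed under conjugation. *)
Inductive listed_rack (p q : nat) : forall gT : finGroupType, {set gT} -> Prop :=
| listed_PSL (q0 : nat) (F0 : finFieldType) (C : {set PGL F0}) of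
    #|F0| = q0 & power_of q0 q & unipotent_class (PSL F0) C :
    listed_rack p q C
| listed_PGL (q0 : nat) (F0 : finFieldType) of
    #|F0| = q0 & odd q & power_of (q0 ^ 2) q :
    listed_rack p q (unip (1 : F0)%R ^: [set: PGL F0])
| listed_dihedral (n : nat) (gT : finGroupType) (G : {group gT}) of
    p = 2 & (n %| q - 1) || (n %| q + 1) & is_dihedral n G :
    listed_rack p q (involutions G)
| listed_A5_involutions of p = 2 & power_of 4 q :
    listed_rack p q (involutions 'Alt_('I_5))
| listed_A4_class (C : {set {perm 'I_4}}) of
    p = 3 & C \in classes 'Alt_('I_4) & C \subset three_cycles 'I_4 :
    listed_rack p q C
| listed_A4_3cycles of p = 3 & power_of (p ^ 2) q :
    listed_rack p q (three_cycles 'I_4)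
| listed_A5_3cycles of p = 3 & power_of (p ^ 2) q :
    listed_rack p q (three_cycles 'I_5).

(* Main.v *)
Require Import Defs.
From mathcomp Require Import all_boot all_order all_algebra.
From mathcomp Require Import all_fingroup all_solvable all_field.
From mathcomp Require Import zify ring.
From HB Require Import structures.
From Stdlib Require Classical_Prop Classical_Pred_Type.

(** The class of [unip x] consists of unipotent elements, each fixing a single
    point of the projective line.  A subrack [X] is normalised by the group
    [G = <<X>>] it generates, so the classification of subracks comes down to the
    subgroups of [PGL F] generated by unipotents.

    The unipotents of [G] are the nontrivial elements of its Sylow [p]-subgroups,
    and these are the subgroups [G :&: trans z], one for each point [z] fixed by
    some unipotent of [G] (the [centers] of [G]); all of them are conjugate.  Let
    [N] be their number and [s] their order.  If [N = 1], then [X] lies in one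
    [trans z]: these are the abelian subracks.  Otherwise the fixed points
    of the nontrivial elements of [G] are counted over a quadratic extension, where
    every element has a fixed point ([orbit_count], [order_dichotomy]): besides the
    orbit of centers, a single orbit has nontrivial stabilisers, and these are
    cyclic.  The resulting equation for the order of [G], with the congruences
    satisfied by [N] and [s], leaves three cases ([order_trichotomy]).

    - [s = 2]: [G] is dihedral and [X] is the set of its involutions
      ([dihedral_case]); its order is read off the action of the rotations on the
      projective line.
    - [N = s + 1]: after moving three centers to infinity, 0 and 1, the finite
      centers form a set closed under subtraction and under [z |-> r / z] for some
      [r]; Hua's identity makes it a subfield [F0] ([hua_mul], [subfield_image]).
      Then [X] comes from [PGL F0] and is normalised by [PSL F0], so consists of
      one or both classes of unipotents, the second possibility requiring the
      degree of [F] over [F0] to be even ([unipotent_listed]).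
    - [s = 3], [N = 10]: [G] has order 60, and acts as the alternating group on its
      five Sylow 2-subgroups ([order60_isom_Alt5]); [X] consists of all elements of
      order 3, and an element of order 5 forces the order of [F] to be a power of 9
      ([icosahedral_case]).

    Conversely every listed rack embeds.  Classes over a subfield do by base
    change, the involutions of a dihedral group or of the alternating group on 5
    letters through subgroups of [PGL F] isomorphic to them, and the 3-cycles on 4
    letters because [PGL(2,3)] is the symmetric group of its 4 points.  For the
    3-cycles on 5 letters, twenty explicit transvections are checked to be closed
    under conjugation; the forward classification then identifies them, as no other
    listed rack in characteristic 3 has between 9 and 20 elements. *)

Set Implicit Arguments.
Unset Strict Implicit.
Unset Printing Implicit Defensive.

Import GroupScope GRing.Theory.

(** * Linear fractional maps and their action *)

Section Moebius.
Variable F : finFieldType.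
Implicit Types (g h : PGL F) (P Q : option F) (a b c d k x y : F).

Definition mx2 (a b c d : F) : 'M[F]_2 :=
  (\matrix_(i, j) if i == ord0 then if j == ord0 then a else b
                  else if j == ord0 then c else d)%R.

Arguments mx2 (a b c d)%_R.

(** The value at a singular matrix is irrelevant and set to 1, so that no proof of
    invertibility has to be carried by the entries. *)
Definition gl2 (a b c d : F) : {'GL_2[F]} :=
  insubd (1 : {'GL_2[F]}) (mx2 a b c d).

Definition mob (a b c d : F) : PGL F := coset (scalars F) (gl2 a b c d).
Arguments mob (a b c d)%_R.

Lemma mx2_eta (A : 'M[F]_2) :
  A = mx2 (A ord0 ord0) (A ord0 ord_max) (A ord_max ord0) (A ord_max ord_max).
Proof.
apply/matrixP=> i j; rewrite !mxE.
case: i j => [[|[|i]] Hi] [[|[|j]] Hj] //=; congr (A _ _); exact: val_inj.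
Qed.

Lemma det_mx2 a b c d : (\det (mx2 a b c d) = a * d - b * c)%R.
Proof.
rewrite (expand_det_row _ ord0) !big_ord_recl big_ord0 addr0 /cofactor !det_mx11.
by rewrite !mxE /= expr0 expr1 mul1r mulN1r mulrN.
Qed.

Lemma mul_mx2 a b c d a' b' c' d' :
  (mx2 a b c d *m mx2 a' b' c' d' =
   mx2 (a * a' + b * c') (a * b' + b * d') (c * a' + d * c') (c * b' + d * d'))%R.
Proof.
apply/matrixP=> i j; rewrite !mxE !big_ord_recl big_ord0 !mxE addr0.
by case: (i == ord0); case: (j == ord0).
Qed.

Lemma gl2E a b c d : (a * d - b * c != 0)%R -> GLval (gl2 a b c d) = mx2 a b c d.
Proof.
move=> nz; apply: (@insubdK _ _ {'GL_2[F]}).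
by rewrite -[_ \in _]/(mx2 a b c d \in unitmx) unitmxE det_mx2 unitfE.
Qed.

Lemma norm_scalars (g : {'GL_2[F]}) : g \in 'N(scalars F).
Proof. by case/andP: (scalars_normal F) => _ /subsetP; apply; rewrite inE. Qed.

Lemma mob_eq a b c d a' b' c' d' :
  a = a' -> b = b' -> c = c' -> d = d' -> mob a b c d = mob a' b' c' d'.
Proof. by move=> -> -> -> ->. Qed.

Lemma coset_scalarsM (g h : {'GL_2[F]}) :
  coset (scalars F) (g * h) = coset (scalars F) g * coset (scalars F) h.
Proof. exact: (coset_morphM (norm_scalars g) (norm_scalars h)). Qed.

Lemma mob_surj g : exists a b c d, (a * d - b * c != 0)%R /\ g = mob a b c d.
Proof.
have [u _ ->] := cosetP g.
pose A := GLval u.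
exists (A ord0 ord0), (A ord0 ord_max), (A ord_max ord0), (A ord_max ord_max).
have nz : (A ord0 ord0 * A ord_max ord_max - A ord0 ord_max * A ord_max ord0 != 0)%R.
  by have := GL_det u; rewrite -/A {1}(mx2_eta A) det_mx2.
split=> //; congr coset; apply: val_inj.
by rewrite -[val (gl2 _ _ _ _)]/(GLval (gl2 _ _ _ _)) gl2E // -mx2_eta.
Qed.

Lemma mobM a b c d a' b' c' d' :
  (a * d - b * c != 0)%R -> (a' * d' - b' * c' != 0)%R ->
  mob a b c d * mob a' b' c' d' =
  mob (a * a' + b * c')%R (a * b' + b * d')%R (c * a' + d * c')%R (c * b' + d * d')%R.
Proof.
move=> nz nz'; rewrite /mob -coset_scalarsM; congr coset.
have mulE : GLval (gl2 a b c d * gl2 a' b' c' d') =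
    mx2 (a * a' + b * c') (a * b' + b * d') (c * a' + d * c') (c * b' + d * d').
  by rewrite GL_ME !gl2E // -mul_mx2.
apply: val_inj; rewrite -[val _]/(GLval _) mulE -[RHS]/(GLval _) gl2E //.
rewrite (_ : (_ - _ = (a * d - b * c) * (a' * d' - b' * c'))%R) ?mulf_neq0 //.
by ring.
Qed.

Lemma mob1 : mob 1 0 0 1 = 1.
Proof.
apply: coset_id; rewrite (_ : gl2 _ _ _ _ = 1) ?group1 //.
apply: val_inj; rewrite -[LHS]/(GLval _) gl2E ?mulr1 ?mul0r ?subr0 ?oner_neq0 //.
rewrite -[RHS]/(1%:M)%R; apply/matrixP=> i j; rewrite !mxE.
by case: i j => [[|[|i]] Hi] [[|[|j]] Hj].
Qed.

Lemma mobZ k a b c d : (k != 0)%R -> (a * d - b * c != 0)%R ->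
  mob (k * a)%R (k * b)%R (k * c)%R (k * d)%R = mob a b c d.
Proof.
move=> kn0 nz.
have nk : (k * k - 0 * 0 != 0)%R by rewrite mul0r subr0 mulf_neq0.
have mk : mob k 0 0 k = 1.
  rewrite /mob coset_id // inE gl2E //.
  apply/is_scalar_mxP; exists k; apply/matrixP=> i j; rewrite !mxE.
  by case: i j => [[|[|i]] Hi] [[|[|j]] Hj].
have := mobM nk nz; rewrite mk mul1g => ->.
by apply: mob_eq; ring.
Qed.

Lemma mobV a b c d : (a * d - b * c != 0)%R ->
  (mob a b c d)^-1 = mob d (- b)%R (- c)%R a.
Proof.
move=> nz; have nz' : (d * a - - b * - c != 0)%R by rewrite mulrNN mulrC.
apply/eqP; rewrite eq_sym eq_mulgV1 invgK mobM //; apply/eqP; rewrite -mob1.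
rewrite -(mobZ (k := (a * d - b * c)%R) (a := 1%R)) ?mul1r ?mulr1 ?mulr0 ?subr0 ?oner_neq0 //.
by apply: mob_eq; ring.
Qed.

Lemma unipE x : unip x = mob 1 x 0 1.
Proof.
rewrite /unip /mob; congr coset; apply: val_inj.
rewrite -[RHS]/(GLval _) gl2E ?mulr1 ?mulr0 ?subr0 ?oner_neq0 //=.
by apply/matrixP=> i j; rewrite !mxE; case: i j => [[|[|i]] Hi] [[|[|j]] Hj].
Qed.

Lemma mob_PSL a b c d : (a * d - b * c != 0)%R ->
  (mob a b c d \in PSL F) = ((a * d - b * c)%R \in unit_squares F).
Proof.
move=> nz; apply/imsetP/idP=> [[u /[!inE] /imsetP[e /[!inE] en0 De] Eu]|sq].
  have : coset (scalars F) (gl2 a b c d * u^-1) = 1.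
    apply: (mulIg (coset (scalars F) u)).
    by rewrite -coset_scalarsM mulgKV mul1g -Eu.
  move/(coset_idr (norm_scalars _)); rewrite inE => /is_scalar_mxP[k Dk].
  have Dg : gl2 a b c d = gl2 a b c d * u^-1 * u by rewrite mulgKV.
  have : (\det (GLval (gl2 a b c d)) = k ^+ 2 * e ^+ 2)%R.
    by rewrite Dg GL_ME Dk [(\det (_ * _))%R]det_mulmx det_scalar De.
  rewrite gl2E // det_mx2 => E; rewrite E -exprMn.
  apply/imsetP; exists (k * e)%R => //; rewrite inE mulf_neq0 //.
  by apply: contra nz => /eqP k0; rewrite E k0 expr2 !mul0r.
by exists (gl2 a b c d) => //; rewrite inE gl2E // det_mx2.
Qed.

(** Points of the projective line are handled through homogeneous coordinates:
    [pt] sends a nonzero vector to its point, [hx P] and [hy P] are the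
    coordinates of a chosen vector above [P].  Composition of linear fractional
    maps then needs no case analysis on denominators. *)
Definition pt (x y : F) : option F := if (y == 0)%R then None else Some (x / y)%R.
Definition hx (P : option F) : F := if P is Some z then z else 1%R.
Definition hy (P : option F) : F := if P is Some _ then 1%R else 0%R.

Lemma ptK P : pt (hx P) (hy P) = P.
Proof. by case: P => [z|] /=; rewrite /pt ?oner_eq0 ?divr1 ?eqxx. Qed.

Lemma ptZ k x y : (k != 0)%R -> pt (k * x)%R (k * y)%R = pt x y.
Proof.
move=> kn0; rewrite /pt mulf_eq0 (negPf kn0) /=.
by case: ifP => // _; rewrite -mulf_div divff // mul1r.
Qed.

Lemma h_pt x y : (x != 0)%R || (y != 0)%R ->
  exists2 k, (k != 0)%R & hx (pt x y) = (k * x)%R /\ hy (pt x y) = (k * y)%R.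
Proof.
rewrite /pt; have [-> | yn0] := eqVneq y 0%R => /= [|_].
  by rewrite orbF => xn0; exists x^-1%R; rewrite ?invr_eq0 ?mulVf ?mulr0.
by exists y^-1%R; rewrite ?invr_eq0 // mulrC mulVf.
Qed.

Lemma h_nz P : (hx P != 0)%R || (hy P != 0)%R.
Proof. by case: P => [z|] /=; rewrite oner_neq0 ?orbT. Qed.

Lemma mob_act a b c d P : (a * d - b * c != 0)%R ->
  pgl_act (mob a b c d) P =
  pt (a * hx P + b * hy P)%R (c * hx P + d * hy P)%R.
Proof.
move=> nz; rewrite pgl_actE gl2E // /lin_frac !mxE /= /pt.
by case: P => [z|] /=; rewrite ?mulr1 ?mulr0 ?addr0.
Qed.

Lemma mob_vec_nz a b c d P : (a * d - b * c != 0)%R ->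
  (a * hx P + b * hy P != 0)%R || (c * hx P + d * hy P != 0)%R.
Proof.
move=> nz; rewrite -negb_and; apply: contraL (h_nz P).
case/andP=> /eqP E1 /eqP E2.
suff: ((a * d - b * c) * hx P == 0)%R && ((a * d - b * c) * hy P == 0)%R.
  by rewrite !mulf_eq0 (negPf nz) /= negb_or !negbK.
have -> : ((a * d - b * c) * hx P =
   d * (a * hx P + b * hy P) - b * (c * hx P + d * hy P))%R by ring.
have -> : ((a * d - b * c) * hy P =
   a * (c * hx P + d * hy P) - c * (a * hx P + b * hy P))%R by ring.
by rewrite E1 E2 !mulr0 subr0 eqxx.
Qed.

Lemma pgl_actM g h P : pgl_act (g * h) P = pgl_act g (pgl_act h P).
Proof.
have [a [b [c [d [nz ->]]]]] := mob_surj g.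
have [a' [b' [c' [d' [nz' ->]]]]] := mob_surj h.
rewrite (mob_act P nz') (mob_act _ nz) mobM // mob_act; last first.
  rewrite (_ : (_ - _ = (a * d - b * c) * (a' * d' - b' * c'))%R) ?mulf_neq0 //.
  by ring.
have [k kn0 [-> ->]] := h_pt (mob_vec_nz P nz').
set u := (a' * _ + _)%R; set v := (c' * _ + _)%R.
rewrite (_ : (a * (k * u) + b * (k * v) = k * (a * u + b * v))%R); last by ring.
rewrite (_ : (c * (k * u) + d * (k * v) = k * (c * u + d * v))%R); last by ring.
by rewrite ptZ // /u /v; congr pt; ring.
Qed.

Lemma pgl_act1 P : pgl_act (1 : PGL F) P = P.
Proof.
rewrite -mob1 mob_act ?mulr1 ?mulr0 ?subr0 ?oner_neq0 //.
by rewrite !mul1r !mul0r add0r addr0 ptK.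
Qed.

(** Group actions are right actions here, whereas [pgl_act] is a left action. *)
Definition pgl_to P g : option F := pgl_act g^-1 P.

Lemma pgl_to_is_action : is_action [set: PGL F] pgl_to.
Proof.
split=> [g P Q E|P g h _ _]; last by rewrite /pgl_to invMg pgl_actM.
have : pgl_act g (pgl_act g^-1 P) = pgl_act g (pgl_act g^-1 Q) by congr pgl_act.
by rewrite -!pgl_actM mulgV !pgl_act1.
Qed.
Canonical pgl_to_action := Action pgl_to_is_action.

Lemma pgl_fix g P : (pgl_to P g == P) = (pgl_act g P == P).
Proof.
apply/eqP/eqP; rewrite /pgl_to => E; first by rewrite -{1}E -pgl_actM mulgV pgl_act1.
by rewrite -{1}E -pgl_actM mulVg pgl_act1.
Qed.

End Moebius.

Arguments mob {F} (a b c d)%_R.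
Arguments pt {F} (x y)%_R.

(** * Fixed points and unipotent elements *)

Section Geometry.
Variable F : finFieldType.
Implicit Types (g h : PGL F) (P Q R : option F) (a b c d k x y z : F).
Local Notation "'to" := (pgl_to_action F).

Definition fixes g : {set option F} := [set P | pgl_act g P == P].
Definition unipotent g := #|fixes g| == 1%N.

Lemma pgl_actK g P : pgl_act g^-1 (pgl_act g P) = P.
Proof. by rewrite -pgl_actM mulVg pgl_act1. Qed.

Lemma pgl_actKV g P : pgl_act g (pgl_act g^-1 P) = P.
Proof. by rewrite -pgl_actM mulgV pgl_act1. Qed.

Lemma pgl_act_inj g : injective (pgl_act g).
Proof. exact: can_inj (pgl_actK g). Qed.

Lemma det_aff a b : (a != 0)%R -> (a * 1 - b * 0 != 0)%R.
Proof. by rewrite mulr1 mulr0 subr0. Qed.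

Lemma det_unip b : (1 * 1 - b * 0 != 0 :> F)%R.
Proof. exact/det_aff/oner_neq0. Qed.

Lemma act_inf a b c d : (a * d - b * c != 0)%R ->
  pgl_act (mob a b c d) None = pt a c.
Proof. by move=> nz; rewrite mob_act //= !mulr0 !mulr1 !addr0. Qed.

Lemma act_aff a b z : (a != 0)%R ->
  pgl_act (mob a b 0 1) (Some z) = Some (a * z + b)%R.
Proof.
move=> an0; rewrite mob_act ?det_aff //= !mulr1 mul0r add0r.
by rewrite /pt oner_eq0 divr1.
Qed.

Lemma act_aff_inf a b : (a != 0)%R -> pgl_act (mob a b 0 1) None = None.
Proof. by move=> an0; rewrite act_inf ?det_aff // /pt eqxx. Qed.

Lemma pt_inf x y : (pt x y == None) = (y == 0)%R.
Proof. by rewrite /pt; case: ifP. Qed.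

Lemma stab_inf g : pgl_act g None = None ->
  exists a b, (a != 0)%R /\ g = mob a b 0 1.
Proof.
have [a [b [c [d [nz ->]]]]] := mob_surj g; rewrite act_inf //.
move/eqP; rewrite pt_inf => /eqP c0; move: nz; rewrite c0 mulr0 subr0 mulf_eq0 negb_or.
case/andP=> an0 dn0; exists (a / d)%R, (b / d)%R; rewrite mulf_neq0 ?invr_eq0 //.
split=> //; rewrite -(@mobZ _ d (a / d) (b / d) 0 1)%R ?det_aff ?mulf_neq0 ?invr_eq0 //.
by apply: mob_eq; rewrite ?mulr0 ?mulr1 // mulrC divfK.
Qed.

Lemma aff_eq1 a b : (a != 0)%R -> (mob a b 0 1 == 1) = (a == 1)%R && (b == 0)%R.
Proof.
move=> an0; apply/eqP/andP=> [E|[/eqP-> /eqP->]]; last by rewrite mob1.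
have := act_aff b 0%R an0; have := act_aff b 1%R an0.
rewrite E !pgl_act1 mulr0 mulr1 add0r => -[E1] [b0]; rewrite -b0 eqxx E1 -b0 addr0.
by rewrite eqxx.
Qed.

Lemma stab_inf0 g : pgl_act g None = None -> pgl_act g (Some 0%R) = Some 0%R ->
  exists2 a, (a != 0)%R & g = mob a 0 0 1.
Proof.
case/stab_inf=> a [b [an0 ->]]; rewrite act_aff // mulr0 add0r => -[->].
by exists a.
Qed.

Lemma fix_std g : pgl_act g None = None -> pgl_act g (Some 0%R) = Some 0%R ->
  pgl_act g (Some 1%R) = Some 1%R -> g = 1.
Proof.
move=> /stab_inf0 /[apply] -[a an0 ->]; rewrite act_aff // mulr1 addr0 => -[->].
exact: mob1.
Qed.

Lemma pgl_trans1 P : exists2 g, g \in PSL F & pgl_act g None = P.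
Proof.
have sq1 : (1 : F)%R \in unit_squares F.
  by apply/imsetP; exists 1%R; rewrite ?expr1n // inE oner_neq0.
case: P => [z|]; last by exists 1; rewrite ?group1 ?pgl_act1.
have D : (z * 0 - -1 * 1 = 1 :> F)%R by ring.
have nz : (z * 0 - -1 * 1 != 0 :> F)%R by rewrite D oner_neq0.
exists (mob z (-1) 1 0); first by rewrite mob_PSL // D.
by rewrite act_inf // /pt oner_eq0 divr1.
Qed.

Lemma pgl_trans3 P Q R : P != Q -> P != R -> Q != R ->
  exists g, [/\ pgl_act g None = P, pgl_act g (Some 0%R) = Q & pgl_act g (Some 1%R) = R].
Proof.
move=> PQ PR QR; have [g _ gP] := pgl_trans1 P.
case DQ: (pgl_act g^-1 Q) => [u|]; last first.
  by rewrite -gP -DQ pgl_actKV eqxx in PQ.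
case DR: (pgl_act g^-1 R) => [v|]; last first.
  by rewrite -gP -DR pgl_actKV eqxx in PR.
have vu : (v - u != 0)%R.
  rewrite subr_eq0; apply: contra QR => /eqP vu.
  by rewrite -(pgl_actKV g Q) -(pgl_actKV g R) DQ DR vu.
exists (g * mob (v - u) u 0 1); rewrite !pgl_actM act_aff_inf // !act_aff //.
by rewrite mulr0 add0r mulr1 subrK -DQ -DR !pgl_actKV.
Qed.

Lemma pgl_fix3 g P Q R : P != Q -> P != R -> Q != R ->
  pgl_act g P = P -> pgl_act g Q = Q -> pgl_act g R = R -> g = 1.
Proof.
move=> PQ PR QR; have [h [<- <- <-]] := pgl_trans3 PQ PR QR => gP gQ gR.
have E : h^-1 * g * h = 1.
  by apply: fix_std; rewrite !pgl_actM ?gP ?gQ ?gR pgl_actK.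
by apply: (mulIg h); apply: (mulgI h^-1); rewrite mulgA E mul1g mulVg.
Qed.

Lemma pgl_eq3 g h P Q R : P != Q -> P != R -> Q != R ->
  pgl_act g P = pgl_act h P -> pgl_act g Q = pgl_act h Q ->
  pgl_act g R = pgl_act h R -> g = h.
Proof.
move=> PQ PR QR gP gQ gR; apply: (mulgI h^-1); rewrite mulVg.
by apply: (pgl_fix3 PQ PR QR); rewrite pgl_actM ?gP ?gQ ?gR pgl_actK.
Qed.

Lemma card_fixes_le2 g : g != 1 -> #|fixes g| <= 2.
Proof.
apply: contraR; rewrite -ltnNge => /card_gt2P[P [Q [R [[]]]]].
rewrite !inE => /eqP gP /eqP gQ /eqP gR [PQ QR RP]; apply/eqP.
by apply: (@pgl_fix3 g P Q R) => //; rewrite eq_sym.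
Qed.

Lemma fixesJ g h : fixes (h ^ g) = pgl_act g^-1 @: fixes h.
Proof.
apply/setP=> P; rewrite inE conjgE !pgl_actM.
apply/eqP/imsetP=> [E|[Q /[!inE] /eqP hQ ->]]; last by rewrite pgl_actKV hQ.
exists (pgl_act g P); rewrite ?pgl_actK // inE.
by rewrite -{2}E pgl_actKV.
Qed.

Lemma unipotentJ g h : unipotent (h ^ g) = unipotent h.
Proof. by rewrite /unipotent fixesJ card_imset //; apply: pgl_act_inj. Qed.

Lemma unipotentP g : reflect (exists P, fixes g = [set P]) (unipotent g).
Proof. exact: cards1P. Qed.

Lemma fixes_unip b : (b != 0)%R -> fixes (unip b) = [set None].
Proof.
move=> bn0; apply/setP=> P; rewrite !inE unipE; case: P => [z|].
  rewrite act_aff ?oner_neq0 // mul1r; apply/eqP=> -[/eqP].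
  by rewrite -subr_eq0 addrAC subrr add0r (negPf bn0).
by rewrite act_aff_inf ?oner_neq0 // eqxx.
Qed.

Lemma unipotent_unip b : (b != 0)%R -> unipotent (unip b).
Proof. by move=> bn0; rewrite /unipotent fixes_unip // cards1. Qed.

(** An affine map with linear part [a] other than 1 has the second fixed point
    [b / (1 - a)]. *)
Lemma fixes1_unip g : fixes g = [set None] -> exists2 b, (b != 0)%R & g = unip b.
Proof.
move=> fg; have : None \in fixes g by rewrite fg set11.
rewrite inE => /eqP/stab_inf[a [b [an0 Dg]]].
have [a1 | an1] := eqVneq a 1%R.
  exists b; last by rewrite Dg a1 unipE.
  apply/eqP=> b0; have : Some 0%R \in fixes g.
    by rewrite Dg a1 b0 mob1 inE pgl_act1.
  by rewrite fg inE.
have nz : (1 - a != 0)%R by rewrite subr_eq0 eq_sym.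
suff: Some (b / (1 - a))%R \in fixes g by rewrite fg inE.
rewrite inE Dg act_aff //; apply/eqP; congr Some.
by apply: (mulIf nz); rewrite mulrDl -mulrA divfK //; ring.
Qed.

Lemma unipD x y : unip (x + y)%R = unip x * unip y.
Proof. by rewrite !unipE mobM ?det_unip //; apply: mob_eq; ring. Qed.

Lemma unip0 : unip (0 : F)%R = 1.
Proof. by rewrite unipE mob1. Qed.

Lemma unipX x n : unip x ^+ n = unip (x *+ n)%R.
Proof. by elim: n => [|n IH]; rewrite ?mulr0n ?unip0 // expgS IH mulrS unipD. Qed.

Lemma unipV x : (unip x)^-1 = unip (- x)%R.
Proof. by apply/eqP; rewrite eq_sym eq_mulgV1 invgK -unipD addNr unip0. Qed.

Lemma unip_inj : injective (@unip F).
Proof.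
move=> x y; rewrite !unipE => E; have := act_aff x 0%R (oner_neq0 F).
by rewrite E act_aff ?oner_neq0 // !mulr0 !add0r => -[].
Qed.

Lemma unipJ_aff a b x : (a != 0)%R -> unip x ^ mob a b 0 1 = unip (x / a)%R.
Proof.
move=> an0; apply: (mulgI (mob a b 0 1)); rewrite -conjgC !unipE.
by rewrite !mobM ?det_aff ?oner_neq0 //; apply: mob_eq; field.
Qed.

Lemma unipotent_conj g : unipotent g ->
  exists h b, [/\ h \in PSL F, (b != 0)%R & g = unip b ^ h].
Proof.
case/unipotentP=> P fg; have [h hPSL hP] := pgl_trans1 P.
have : fixes (g ^ h) = [set None] by rewrite fixesJ fg imset_set1 -hP pgl_actK.
case/fixes1_unip=> b bn0 E; exists h^-1, b; split; rewrite ?groupV //.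
by rewrite -E conjgK.
Qed.

Lemma unit_squares_neq0 x : x \in unit_squares F -> (x != 0)%R.
Proof. by case/imsetP=> c /[!inE] cn0 ->; rewrite expf_neq0. Qed.

Lemma unit_squaresM x y :
  x \in unit_squares F -> y \in unit_squares F -> (x * y)%R \in unit_squares F.
Proof.
case/imsetP=> c /[!inE] cn0 -> /imsetP[d /[!inE] dn0 ->].
by apply/imsetP; exists (c * d)%R; rewrite ?exprMn // inE mulf_neq0.
Qed.

Lemma unit_squaresV x : x \in unit_squares F -> x^-1%R \in unit_squares F.
Proof.
case/imsetP=> c /[!inE] cn0 ->.
by apply/imsetP; exists c^-1%R; rewrite ?exprVn // inE invr_eq0.
Qed.

Lemma unit_squares_sq x : (x != 0)%R -> (x ^+ 2)%R \in unit_squares F.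
Proof. by move=> xn0; apply/imsetP; exists x; rewrite ?inE. Qed.

(** [PSL F] is normal in [PGL F], because conjugation does not change the
    determinant modulo squares. *)
Lemma norm_PSL g : g \in 'N(PSL F).
Proof.
rewrite inE; apply/subsetP=> _ /imsetP[h hPSL ->].
have [a [b [c [d [nz ->]]]]] := mob_surj g.
move: hPSL; have [a' [b' [c' [d' [nz' ->]]]]] := mob_surj h.
rewrite mob_PSL // => sq; rewrite conjgE mobV //.
have nzi : (d * a - - b * - c != 0)%R by rewrite mulrNN mulrC.
have nz2 : ((a' * a + b' * c) * (c' * b + d' * d) - (a' * b + b' * d) * (c' * a + d' * c)
   != 0)%R.
  rewrite (_ : (_ - _ = (a * d - b * c) * (a' * d' - b' * c'))%R) ?mulf_neq0 //.
  by ring.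
rewrite (mobM nz' nz) (mobM nzi nz2) mob_PSL; last first.
  set D := (X in (X != _)%R).
  rewrite (_ : D = (a' * d' - b' * c') * (a * d - b * c) ^+ 2)%R /D; last by ring.
  by rewrite mulf_neq0 ?expf_neq0.
set D := (X in X \in _).
rewrite (_ : D = (a' * d' - b' * c') * (a * d - b * c) ^+ 2)%R /D; last by ring.
by rewrite unit_squaresM // unit_squares_sq.
Qed.

Lemma aff_PSL a b : (a != 0)%R -> (mob a b 0 1 \in PSL F) = (a \in unit_squares F).
Proof. by move=> an0; rewrite mob_PSL ?det_aff // mulr1 mulr0 subr0. Qed.

(** The conjugating element fixes infinity, hence is affine, and its linear part
    is a square. *)
Lemma unip_orbitP x y : (x != 0)%R -> (y != 0)%R ->
  (unip y \in unip_orbit x) = ((y / x)%R \in unit_squares F).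
Proof.
move=> xn0 yn0; apply/imsetP/idP=> [[g gPSL E]|sq]; last first.
  have nz : (x / y != 0)%R by rewrite mulf_neq0 ?invr_eq0.
  exists (mob (x / y)%R 0 0 1).
    by rewrite aff_PSL // -[(x / y)%R]invrK invf_div unit_squaresV.
  by rewrite unipJ_aff // invf_div mulrC divfK.
have : None \in fixes (unip x ^ g) by rewrite -E fixes_unip ?set11.
rewrite fixesJ fixes_unip // imset_set1 inE => /eqP gi.
have : pgl_act g None = None by rewrite [in LHS]gi pgl_actKV.
case/stab_inf=> a [b [an0 Dg]]; rewrite Dg in E gPSL.
rewrite unipJ_aff // in E; rewrite (unip_inj E) mulrAC divff // mul1r.
by rewrite unit_squaresV // -(aff_PSL b).
Qed.

Lemma unip_orbit_unipotent x g : (x != 0)%R -> g \in unip_orbit x -> unipotent g.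
Proof. by move=> xn0 /imsetP[h _ ->]; rewrite unipotentJ unipotent_unip. Qed.

Lemma unipotent_orbit u : unipotent u -> exists2 b, (b != 0)%R & u \in unip_orbit b.
Proof. by case/unipotent_conj=> h [b [hP bn0 ->]]; exists b => //; apply: memJ_class. Qed.

Lemma unip_orbit_sub x : unip_orbit x \subset PSL F.
Proof.
apply: class_subG; rewrite ?subxx // unipE aff_PSL ?oner_neq0 //.
by rewrite -[1%R](expr1n _ 2) unit_squares_sq ?oner_neq0.
Qed.

(** The classes of unipotents of [PSL F] are permuted by the dilations of
    [PGL F]. *)
Lemma unip_orbitJ x a b g : (a != 0)%R -> g = mob a b 0 1 ->
  unip_orbit x :^ g = unip_orbit (x / a)%R.
Proof.
move=> an0 ->; rewrite /unip_orbit -(unipJ_aff b x an0).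
apply/setP=> u; rewrite mem_conjg; set k := mob _ _ _ _.
apply/imsetP/imsetP=> -[h hP E].
  exists (h ^ k); first by rewrite memJ_norm ?norm_PSL.
  by rewrite -conjJg -E conjgKV.
exists (h ^ k^-1); first by rewrite memJ_norm // norm_PSL.
by rewrite E conjJg conjgK.
Qed.

End Geometry.

(** * Squares, subfields and extensions of finite fields *)

Section FiniteFields.
Implicit Types F : finFieldType.

Lemma card_pred_gt0 F : 0 < #|F|.-1.
Proof. by have := finNzRing_gt1 F; case: #|F| => [|[]]. Qed.

Lemma expf_card1 F (x : F) : (x != 0)%R -> (x ^+ #|F|.-1 = 1)%R.
Proof.
move=> xn0; apply: (mulfI xn0).
by rewrite mulr1 -exprS prednK ?expf_card // ltnW // finNzRing_gt1.
Qed.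

Lemma finField_prim_root F :
  exists g : F, [/\ (g != 0)%R, (#|F|.-1.-primitive_root g)%R
                  & forall x : F, (x != 0)%R -> exists i, x = (g ^+ i)%R].
Proof.
pose rs := [seq x <- enum F | x != 0%R].
have szrs : size rs = #|F|.-1.
  rewrite -(cardC1 (0%R : F)) cardE /rs /enum_mem; congr size.
  by rewrite -filter_predI; apply: eq_filter => x; rewrite !inE andbT.
have n0 := card_pred_gt0 F.
have : has (#|F|.-1.-primitive_root)%R rs.
  apply: has_prim_root => //; last by rewrite szrs.
    apply/allP=> x; rewrite mem_filter unity_rootE => /andP[xn0 _].
    by rewrite expf_card1.
  by rewrite filter_uniq // enum_uniq.
case/hasP=> g; rewrite mem_filter => /andP[gn0 _] pg.
exists g; split=> // x xn0; have [i ->] := prim_rootP pg (expf_card1 xn0).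
by exists i.
Qed.

Lemma even_unit_squares F (x : F) :
  ~~ odd #|F| -> (x != 0)%R -> x \in unit_squares F.
Proof.
move=> oddF xn0; apply/imsetP; exists (x ^+ #|F|./2)%R.
  by rewrite inE expf_neq0.
by rewrite -exprM mulnC mul2n -[LHS]expf_card -{1}(odd_double_half #|F|) (negPf oddF).
Qed.

Lemma odd_half_pred n : odd n -> (n.-1)./2.*2 = n.-1.
Proof. by case: n => // n /= on; rewrite -{2}(odd_double_half n) (negPf on). Qed.

(** Euler's criterion. *)
Lemma euler_square F (x : F) : odd #|F| -> (x != 0)%R ->
  (x \in unit_squares F) = (x ^+ (#|F|.-1)./2 == 1)%R.
Proof.
move=> oddF xn0; have [g [gn0 pg gP]] := finField_prim_root F.
have E2 := odd_half_pred oddF; have n0 := card_pred_gt0 F.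
apply/imsetP/eqP=> [[c /[!inE] cn0 ->]|].
  by rewrite -exprM mul2n E2 expf_card1.
have [i Dx] := gP x xn0; rewrite Dx -exprM => /eqP; rewrite -(prim_order_dvd pg).
rewrite -{1}E2 -muln2 mulnC dvdn_pmul2r; last by rewrite -double_gt0 E2.
case/dvdnP=> j ->; exists (g ^+ j)%R; rewrite ?inE ?expf_neq0 //.
by rewrite -exprM.
Qed.

Lemma nonsquare_exp F (x : F) : odd #|F| -> (x != 0)%R ->
  x \notin unit_squares F -> (x ^+ (#|F|.-1)./2 = -1)%R.
Proof.
move=> oddF xn0; rewrite euler_square // => nsq.
have : ((x ^+ (#|F|.-1)./2) ^+ 2 == 1)%R.
  by rewrite -exprM muln2 odd_half_pred // expf_card1.
by rewrite sqrf_eq1 (negPf nsq) /= => /eqP.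
Qed.

Lemma nonsquareM F (x y : F) : (x != 0)%R -> (y != 0)%R ->
  x \notin unit_squares F -> y \notin unit_squares F -> (x * y)%R \in unit_squares F.
Proof.
move=> xn0 yn0 nx ny; have [oddF | evF] := boolP (odd #|F|); last first.
  by rewrite even_unit_squares // mulf_neq0 in nx *.
by rewrite euler_square ?mulf_neq0 // exprMn !nonsquare_exp // mulrNN mulr1.
Qed.

Lemma card_unit_squares F :
  #|unit_squares F| = (#|F| - 1) %/ gcdn 2 (#|F| - 1).
Proof.
rewrite subn1; have n0 := card_pred_gt0 F.
have cardn0 : #|[set x : F | x != 0%R]| = #|F|.-1.
  by rewrite cardsE (cardC1 (0%R : F)).
have [oddF | evF] := boolP (odd #|F|); last first.
  have -> : gcdn 2 #|F|.-1 = 1%N.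
    apply/eqP; rewrite -[_ == _]/(coprime 2 _) coprime2n.
    by move: evF n0; case: #|F| => [|n] //=; rewrite negbK.
  rewrite divn1 -cardn0; congr #|pred_of_set _|; apply/setP=> x; rewrite inE.
  by apply/idP/idP=> [/unit_squares_neq0 // | /even_unit_squares ->].
have -> : gcdn 2 #|F|.-1 = 2.
  apply/gcdn_idPl; rewrite dvdn2.
  by move: oddF; case: #|F|.
have [g [gn0 pg gP]] := finField_prim_root F.
have E2 := odd_half_pred oddF.
have lt2 k : k < (#|F|.-1)./2 -> k.*2 < #|F|.-1 by rewrite -ltn_double E2.
suff -> : unit_squares F = [set (g ^+ (val i).*2)%R | i : 'I_(#|F|.-1)./2].
  rewrite card_imset ?card_ord ?divn2 // => i j /eqP.
  rewrite (eq_prim_root_expr pg) !modn_small => [/eqP/double_inj/val_inj // | |].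
    exact: lt2 (valP j).
  exact: lt2 (valP i).
apply/setP=> x; apply/imsetP/imsetP=> [[c /[!inE] cn0 ->]|[i _ ->]]; last first.
  by exists (g ^+ i)%R; rewrite ?inE ?expf_neq0 // -exprM muln2.
have [i ->] := gP c cn0; have h0 : 0 < (#|F|.-1)./2 by rewrite -double_gt0 E2.
exists (Ordinal (ltn_pmod i h0)) => //=.
rewrite -exprM muln2; apply/eqP; rewrite (eq_prim_root_expr pg).
by rewrite -!muln2 -{1 3}E2 -muln2 -!muln_modl modn_mod.
Qed.

(** Not assuming [L] to be finite-dimensional over [k], the minimal polynomial of
    [a] is obtained as a nonzero annihilating polynomial of least degree. *)
Lemma annihilator_poly (k L : fieldType) (f : {rmorphism k -> L}) (a : L)
    (P : {poly k}) :
  (P != 0)%R -> root (map_poly f P) a ->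
  exists Q : {poly k}, [/\ (Q != 0)%R, root (map_poly f Q) a
    & forall R : {poly k}, root (map_poly f R) a -> (Q %| R)%R].
Proof.
move: {2}_.+1 (ltnSn (size P)) => n; elim: n => // n IH in P * => szP Pn0 Pa.
have [allP|] := Classical_Prop.classic
    (forall R : {poly k}, root (map_poly f R) a -> (P %| R)%R).
  by exists P.
move/Classical_Pred_Type.not_all_ex_not=> [R nR].
have [Ra nPR] := Classical_Prop.imply_to_and _ _ nR.
apply: (IH (R %% P)%R); last 1 first.
- move: Ra; rewrite {1}(divp_eq R P) !rootE rmorphD rmorphM /= hornerD hornerM.
  by rewrite (eqP Pa) mulr0 add0r.
- by rewrite (leq_trans (ltn_modpN0 R Pn0)).
- by apply/negP=> /eqP E; apply: nPR; rewrite /dvdp E.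
Qed.

(** A generator [a] of the multiplicative group of [F0] is sent to a root [b] in
    [F] of its minimal polynomial over the common subfield [k]; such a root exists
    because the minimal polynomial divides [X ^ (#|F0| - 1) - 1], which divides
    [X ^ #|F| - X] and hence splits in [F]. *)
Lemma finField_embed_over (k : fieldType) F0 F (i0 : {rmorphism k -> F0})
    (i1 : {rmorphism k -> F}) m : 0 < m -> #|F| = (#|F0| ^ m)%N ->
  exists f : F0 -> F, zmod_morphism f /\ monoid_morphism f.
Proof.
move=> m0 cF.
have [a [an0 pa aP]] := finField_prim_root F0; have n0 := card_pred_gt0 F0.
pose P : {poly k} := ('X^(#|F0|.-1) - 1)%R.
have Pn0 : (P != 0)%R by rewrite -size_poly_gt0 size_XnsubC.
have Pa : root (map_poly i0 P) a.
  rewrite /P rmorphB /= map_polyXn rmorph1 rootE !hornerE.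
  by rewrite expf_card1 // subrr.
have [Q [Qn0 Qa minQ]] := annihilator_poly Pn0 Pa.
have [b Qb] : exists b : F, root (map_poly i1 Q) b.
  have : (map_poly i1 Q %| \prod_(x <- enum F) ('X - x%:P))%R.
    rewrite big_enum -finField_genPoly.
    apply: (@dvdp_trans _ (map_poly i1 P)); first by rewrite dvdp_map minQ.
    rewrite /P rmorphB /= map_polyXn rmorph1.
    have -> : ('X^#|F| - 'X = ('X^(#|F|.-1) - 1) * 'X :> {poly F})%R.
      by rewrite mulrBl mul1r -exprSr prednK // ltnW // finNzRing_gt1.
    apply: dvdp_mulr; rewrite cF.
    have /dvdnP[h ->] := dvdn_pred_predX #|F0| m.
    by rewrite mulnC exprM [X in (_ %| X)%R]subrX1 dvdp_mulIl.
  case/dvdp_prod_XsubC=> msk; case Em: (mask msk (enum F)) => [|b s].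
    rewrite big_nil => /eqp_size; rewrite size_map_poly size_poly1 => /eqP/size_poly1P[c cn0 Dc].
    by move: Qa; rewrite Dc map_polyC rootC fmorph_eq0 (negPf cn0).
  move/eqp_root=> rE; exists b; rewrite rE big_cons rootM root_XsubC eqxx //.
pose ev0 (R : {poly k}) := (map_poly i0 R).[a]%R.
pose ev (R : {poly k}) := (map_poly i1 R).[b]%R.
have evE R S : ev0 R = ev0 S -> ev R = ev S.
  move=> E; have /minQ /dvdpP[T DT] : root (map_poly i0 (R - S)%R) a.
    by rewrite rootE rmorphB hornerD hornerN -[(_).[a]%R]/(ev0 R) E subrr.
  apply/eqP; rewrite -subr_eq0 -hornerN -hornerD -rmorphB /= DT rmorphM hornerM.
  by rewrite (eqP Qb) mulr0.
have rep (y : F0) : exists R, ev0 R = y.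
  have [-> | yn0] := eqVneq y 0%R; first by exists 0%R; rewrite /ev0 rmorph0 horner0.
  by have [i ->] := aP y yn0; exists ('X^i)%R; rewrite /ev0 map_polyXn hornerXn.
have [R RP] := fin_all_exists rep.
pose f y := ev (R y).
have fD : zmod_morphism f.
  move=> x y; rewrite /f /ev -hornerN -hornerD -rmorphB /=; apply: evE.
  by rewrite /ev0 rmorphB hornerD hornerN -![(_).[a]%R]/(ev0 _) !RP.
have fM : monoid_morphism f.
  split=> [|x y]; rewrite /f.
    by rewrite (evE _ 1%R) ?RP /ev /ev0 rmorph1 hornerC.
  rewrite /ev -hornerM -rmorphM /=; apply: evE.
  by rewrite /ev0 rmorphM hornerM -![(_).[a]%R]/(ev0 _) !RP.
by exists f.
Qed.

Lemma finField_embed F0 F m : 0 < m -> #|F| = (#|F0| ^ m)%N ->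
  exists f : {rmorphism F0 -> F}, injective f.
Proof.
move=> m0 cF; have [p p_pr ch0] := finPcharP F0.
have ch : p \in [pchar F]%R.
  have := card_pprimeChar ch0; rewrite -[#|_ ch0|]/(#|F0|) => c0.
  by rewrite c0 -expnM in cF; apply: card_finPcharP cF p_pr.
have [f [fD fM]] := @finField_embed_over 'F_p (pPrimeCharType ch0)
  (pPrimeCharType ch) (in_alg _) (in_alg _) m m0 cF.
pose fa := GRing.isZmodMorphism.Build F0 F f fD.
pose fm := GRing.isMonoidMorphism.Build F0 F f fM.
by exists (HB.pack f fa fm : {rmorphism F0 -> F}); apply: fmorph_inj.
Qed.

(** The splitting field of the product of all monic quadratic polynomials. *)
Lemma quadratic_extension F : exists (K : finFieldType) (f : {rmorphism F -> K}),
  forall b c : F, exists z : K, (z ^+ 2 + f b * z + f c = 0)%R.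
Proof.
pose quad (u : F * F) : {poly F} := ('X^2 + u.1 *: 'X + u.2%:P)%R.
pose P : {poly F} := (\prod_u quad u)%R.
have szq u : size (quad u) = 3.
  rewrite /quad -addrA size_polyDl size_polyXn // ltnS.
  rewrite (leq_trans (size_polyD _ _)) // geq_max size_polyC.
  by rewrite (leq_trans (size_scale_leq _ _)) ?size_polyX // (leq_trans (leq_b1 _)).
have Pn0 : (P != 0)%R.
  by apply/prodf_neq0=> u _; rewrite -size_poly_gt0 szq.
have [L [zs DP _]] := FinSplittingFieldFor Pn0.
pose f : {rmorphism F -> FinFieldExtType L} := in_alg L.
exists (FinFieldExtType L), f => b c.
have : (map_poly (in_alg L) (quad (b, c)) %| \prod_(z <- zs) ('X - z%:P))%R.
  rewrite -(eqp_dvdr _ DP) dvdp_map /P (bigD1 (b, c)) //=; exact: dvdp_mulIl.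
case/dvdp_prod_XsubC=> msk; case: (mask msk zs) => [|z s].
  by rewrite big_nil => /eqp_size; rewrite size_map_poly szq size_poly1.
move/eqp_root=> rE; exists z.
have : root (map_poly (in_alg L) (quad (b, c))) z.
  by rewrite rE big_cons rootM root_XsubC eqxx.
rewrite rootE /quad !rmorphD /= map_polyXn map_polyZ map_polyX map_polyC.
by rewrite !hornerE => /eqP.
Qed.

End FiniteFields.

(** * Unipotents with a given fixed point *)

Section LocalStructure.
Variable F : finFieldType.
Implicit Types (g h u : PGL F) (P Q R z w : option F) (a b c : F).
Local Notation "'to" := (pgl_to_action F).

(** A Sylow [p]-subgroup of [PGL F], where [p] is the characteristic: the group of
    translations when [z] is infinity, and a conjugate of it in general. *)
Definition trans z : {set PGL F} := [set g | (g == 1) || (fixes g == [set z])].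

Lemma trans_inf : trans None = @unip F @: setT.
Proof.
apply/setP=> g; rewrite inE; apply/orP/imsetP=> [[/eqP->|/eqP]|[b _ ->]].
- by exists 0%R; rewrite ?unip0.
- by case/fixes1_unip=> b _ ->; exists b.
have [-> | bn0] := eqVneq b 0%R; first by rewrite unip0 eqxx; left.
by rewrite fixes_unip // eqxx; right.
Qed.

Lemma transJ z g : trans z :^ g = trans (pgl_act g^-1 z).
Proof.
apply/setP=> h; rewrite mem_conjg !inE conjg_eq1 fixesJ invgK.
rewrite -(inj_eq (imset_inj (@pgl_act_inj F g)) (fixes h)).
by rewrite imset_set1 pgl_actKV.
Qed.

Lemma trans_group_set z : group_set (trans z).
Proof.
have [g _ gz] := pgl_trans1 z.
have -> : trans z = trans None :^ g^-1 by rewrite transJ invgK gz.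
suff E : group_set (trans None).
  exact: (valP ((Group E) :^ g^-1)%G).
rewrite trans_inf; apply/group_setP; split.
  by apply/imsetP; exists 0%R; rewrite ?unip0.
move=> _ _ /imsetP[b _ ->] /imsetP[c _ ->].
by apply/imsetP; exists (b + c)%R; rewrite ?unipD.
Qed.
Canonical trans_group z := Group (trans_group_set z).

Lemma transP u z : u \in trans z -> u != 1 -> fixes u = [set z].
Proof. by rewrite inE => /orP[->//|/eqP]. Qed.

Lemma trans_eq u z w : u \in trans z -> u \in trans w -> u != 1 -> z = w.
Proof.
move=> uz uw un1; apply/set1P; rewrite -(transP uw un1) (transP uz un1).
exact: set11.
Qed.

Lemma trans_unipotent u z : u \in trans z -> u != 1 -> unipotent u.
Proof. by move=> uz /(transP uz) fu; rewrite /unipotent fu cards1. Qed.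

Lemma unipotent_neq1 u : unipotent u -> u != 1.
Proof.
apply: contraTneq => ->; rewrite /unipotent (_ : fixes 1 = setT).
  rewrite cardsT card_option eqSS -lt0n; apply/card_gt0P; by exists 0%R.
by apply/setP=> z; rewrite !inE pgl_act1 eqxx.
Qed.

Lemma card_trans z : #|trans z| = #|F|.
Proof.
have [g _ gz] := pgl_trans1 z.
have -> : trans z = trans None :^ g^-1 by rewrite transJ invgK gz.
by rewrite cardJg trans_inf card_imset ?cardsT //; apply: unip_inj.
Qed.

Lemma trans_abelian z : abelian (trans z).
Proof.
have [g _ gz] := pgl_trans1 z.
have -> : trans z = trans None :^ g^-1 by rewrite transJ invgK gz.
rewrite abelianJ trans_inf; apply/centsP=> _ /imsetP[b _ ->] _ /imsetP[c _ ->].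
by rewrite /commute -!unipD addrC.
Qed.

(** An element [g] commuting with [u] fixes the only fixed point [z] of [u]; were
    [w] a second fixed point of [g], then [u w] would be a third one. *)
Lemma cent_unipotent u g z : u \in trans z -> u != 1 -> commute u g -> g \in trans z.
Proof.
move=> uz un1 cug; have fu := transP uz un1.
have [-> | gn1] := eqVneq g 1; first exact: group1.
have fE w : (pgl_act u w == w) = (w == z).
  by have := erefl (w \in fixes u); rewrite {2}fu !inE.
have gz : pgl_act g z = z.
  have uzz : pgl_act u z = z by apply/eqP; rewrite fE.
  by apply/eqP; rewrite -fE -pgl_actM cug pgl_actM uzz.
rewrite inE; apply/orP; right; apply/eqP/setP=> w; rewrite !inE.
apply/eqP/eqP=> [gw|-> //]; apply/eqP/negPn/negP=> wz; case/eqP: gn1.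
have uz_ : pgl_act u z = z by apply/eqP; rewrite fE.
have uwz : pgl_act u w != z.
  by rewrite -[X in _ != X]uz_ (inj_eq (@pgl_act_inj _ u)).
apply: (@pgl_fix3 _ g z w (pgl_act u w)) => //.
- by rewrite eq_sym.
- by rewrite eq_sym.
- by rewrite eq_sym fE.
- by rewrite -pgl_actM -cug pgl_actM gw.
Qed.

Lemma stabE (G : {set PGL F}) g z :
  (g \in 'C_G[z | 'to]) = (g \in G) && (pgl_act g z == z).
Proof. by rewrite inE; congr (_ && _); rewrite -pgl_fix; apply/astab1P/eqP. Qed.

Lemma card_option_mod p : p \in [pchar F]%R -> #|[set: option F]| = 1 %[mod p].
Proof.
move=> ch; rewrite cardsT card_option -[#|F|]/(#|pPrimeCharType ch|).
rewrite card_pprimeChar -addn1 -modnDml.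
case E: (logn p #|pPrimeCharType ch|) => [|n]; last by rewrite expnS modnMr.
have := finNzRing_gt1 F; have := card_pprimeChar ch; rewrite E expn0.
by rewrite -[#|pPrimeCharType ch|]/(#|F|) => ->.
Qed.

(** A [p]-group fixes a point, because the projective line has [q + 1] points; its
    nontrivial elements cannot fix a second one. *)
Lemma pgroup_sub_trans p (Q : {group PGL F}) : p \in [pchar F]%R -> p.-group Q ->
  exists z, Q \subset trans z.
Proof.
move=> ch pQ; have p_pr := pcharf_prime ch; have p1 := prime_gt1 p_pr.
have fixmod (H : {group PGL F}) : p.-group H -> #|'Fix_'to(H)| = 1 %[mod p].
  move=> pH; rewrite -(card_option_mod ch).
  have := @pgroup_fix_mod _ _ _ 'to p H [set: option F] pH.
  by rewrite setTI => <- //; apply/actsP=> g _ P; rewrite !inE.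
have [z zQ] : exists z, z \in 'Fix_'to(Q).
  apply/card_gt0P; rewrite lt0n; apply/eqP=> Q0; have := fixmod Q pQ.
  by rewrite Q0 mod0n modn_small.
exists z; apply/subsetP=> g Qg; rewrite inE; have [//|gn1] /= := eqVneq g 1.
have gz : z \in fixes g.
  by rewrite inE -pgl_fix; apply/eqP; move/afixP: zQ; apply.
have fE : 'Fix_'to(<[g]>) = fixes g.
  by rewrite afix_cycle ?inE //; apply/setP=> w; rewrite [w \in fixes g]inE -pgl_fix; apply/afix1P/eqP.
have := fixmod <[g]>%G (pgroupS _ pQ); rewrite cycle_subG => /(_ Qg).
rewrite [#|_|](_ : _ = #|fixes g|) -?fE // fE; have := card_fixes_le2 gn1.
rewrite eq_sym eqEcard sub1set gz cards1 leq_eqVlt => /orP[/eqP->|lt2 _]; last by rewrite -ltnS.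
move/eqP; rewrite eqn_mod_dvd // subn1 dvdn1 => /eqP p1E.
by rewrite p1E in p1.
Qed.

Lemma order_pchar_unipotent p u :
  p \in [pchar F]%R -> #[u] = p -> unipotent u.
Proof.
move=> chK ou; have p_pr := pcharf_prime chK.
have un1 : u != 1 by rewrite -order_gt1 ou prime_gt1.
have [|v] := pgroup_sub_trans (Q := <[u]>%G) chK.
  by rewrite /pgroup -orderE ou pnat_id.
by rewrite cycle_subG => uv; apply: trans_unipotent uv un1.
Qed.

Lemma unipotent_order p u :
  p \in [pchar F]%R -> unipotent u -> #[u] = p.
Proof.
move=> chK uu; have p_pr := pcharf_prime chK; have un1 := unipotent_neq1 uu.
apply: (prime_nt_dvdP p_pr); first by rewrite order_eq1.
have [h [b [_ _ ->]]] := unipotent_conj uu.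
by rewrite orderJ order_dvdn unipX -mulr_natr (pcharf0 chK) mulr0 unip0.
Qed.

End LocalStructure.

(** * Sylow subgroups and centers of a subgroup *)

Lemma dvdn_card_orbits (aT : finGroupType) (sT : finType) (D : {group aT})
    (to : action D sT) (A : {group aT}) (S : {set sT}) k :
  [acts A, on S | to] -> {in S, forall x, k %| #|orbit to A x|} -> k %| #|S|.
Proof.
move=> actsA kS; rewrite -(acts_sum_card_orbit actsA).
by apply: dvdn_sum => _ /imsetP[x Sx ->]; apply: kS.
Qed.

(** The arithmetic of [orbit_count], separated from its group theory. *)
Lemma count_arith n y a b x m N : 0 < n ->
  N + a = n -> y + b = x -> a + b + (m + N) = (2 * n.-1)%N -> x + m + 2 = y + n.
Proof. lia. Qed.

Lemma count_arith0 n N k s : 0 < N -> 0 < k -> 1 < s ->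
  n = (N * (k * s))%N -> (N * s.-2)%N + 2 = n -> N = 1%N /\ n = s.
Proof.
move=> N0 k0 s1 -> E; have N1 : N = 1%N.
  case: s s1 E => [|[|s]] //= _ E; have : s + 2 <= k * s.+2 by nia.
  nia.
by split=> //; rewrite -E N1 mul1n; lia.
Qed.

Lemma count_arith1 n m y : (1 * n)%N + m + 2 = y + n -> y = m + 2.
Proof. lia. Qed.

Section Centers.
Variable F : finFieldType.
Implicit Types (g h u : PGL F) (P Q R z w : option F) (a b c : F).
Local Notation "'to" := (pgl_to_action F).
Variables (G : {group PGL F}).

(** The fixed points of the unipotent elements of [G]; [G :&: trans z] is the
    corresponding Sylow subgroup. *)
Definition centers : {set option F} := [set z | [exists g in G, fixes g == [set z]]].

Lemma centersP z : reflect (exists2 u, u \in G :&: trans z & u != 1) (z \in centers).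
Proof.
rewrite inE; apply: (iffP exists_inP) => [[u Gu fu]|[u /setIP[Gu uz] un1]].
  exists u; first by rewrite !inE Gu fu orbT.
  by apply: unipotent_neq1; rewrite /unipotent (eqP fu) cards1.
by exists u => //; rewrite (transP uz un1).
Qed.

Lemma trans_fix g z : g \in trans z -> pgl_act g z = z.
Proof.
move=> gz; have [-> | gn1] := eqVneq g 1; first by rewrite pgl_act1.
by have := set11 z; rewrite -(transP gz gn1) inE => /eqP.
Qed.

Lemma acts_centers : [acts G, on centers | 'to].
Proof.
apply/actsP=> g Gg z.
have im h w : h \in G -> w \in centers -> 'to w h \in centers.
  move=> Gh /centersP[u /setIP[Gu uw] un1]; apply/centersP; exists (u ^ h).
    rewrite inE groupJ //= -[_ \in trans _]/(u ^ h \in trans (pgl_act h^-1 w)).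
    by rewrite -transJ memJ_conjg.
  by rewrite conjg_eq1.
apply/idP/idP=> [cz|]; last exact: im.
by rewrite -[z](actK 'to g) im ?groupV.
Qed.

Lemma transI_J z g : g \in G -> (G :&: trans z) :^ g = G :&: trans ('to z g).
Proof. by move=> Gg; rewrite conjIg transJ conjGid. Qed.

Variable p : nat.
Hypothesis ch : p \in [pchar F]%R.

Lemma pgroup_trans z : p.-group (G :&: trans z).
Proof.
apply: pgroupS (subsetIr _ _) _; rewrite /pgroup card_trans.
rewrite -[#|F|]/(#|pPrimeCharType ch|) card_pprimeChar.
by rewrite pnatX pnat_id ?(pcharf_prime ch).
Qed.

Lemma Sylow_sub_trans (P : {group PGL F}) : p.-Sylow(G) P ->
  exists z, P :=: G :&: trans z.
Proof.
move=> sylP; have [z Pz] := pgroup_sub_trans ch (pHall_pgroup sylP).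
exists z; apply/eqP; rewrite eqEsubset subsetI (pHall_sub sylP) Pz /=.
rewrite (sub_pHall sylP (pgroup_trans z)) //; last by rewrite subsetIl.
by rewrite subsetI (pHall_sub sylP) Pz.
Qed.

Lemma centers_Sylow z : z \in centers -> p.-Sylow(G) (G :&: trans z).
Proof.
case/centersP=> u Uu un1.
have [P sylP sUP] := Sylow_superset (subsetIl G (trans z)) (pgroup_trans z).
have [w Dw] := Sylow_sub_trans sylP.
have /setIP[_ uw] : u \in G :&: trans w by rewrite -Dw (subsetP sUP).
have /setIP[_ uz] := Uu.
by rewrite (trans_eq uz uw un1) -Dw.
Qed.

(** Centers correspond to Sylow subgroups, which are conjugate. *)
Lemma transitive_centers z : z \in centers -> orbit 'to G z = centers.
Proof.
move=> cz; apply/eqP; rewrite eqEsubset acts_sub_orbit ?acts_centers // cz /=.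
apply/subsetP=> w cw; apply/orbitP.
have [g Gg E] := Sylow_trans (centers_Sylow cz) (centers_Sylow cw).
exists g => //; have /centersP[u Uu un1] := cw.
move: (Uu); rewrite E transI_J // => /setIP[_ u1]; case/setIP: Uu => _ u2.
exact: trans_eq u1 u2 un1.
Qed.

Section AtPoint.
Variables (z : option F) (cz : z \in centers).
Let U := G :&: trans z.

Lemma card_G_centers : #|G| = (#|centers| * #|'C_G[z | 'to]|)%N.
Proof. by rewrite -(transitive_centers cz) card_orbit_stab. Qed.

Lemma trans_sub_stab : U \subset 'C_G[z | 'to].
Proof.
apply/subsetP=> u /setIP[Gu uz].
by rewrite stabE Gu (trans_fix uz) eqxx.
Qed.

Lemma stab_norm_trans : 'C_G[z | 'to] \subset 'N(U).
Proof.
apply/subsetP=> g; rewrite stabE => /andP[Gg /eqP gz].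
rewrite inE transI_J //= (_ : pgl_to z g = z) //.
by rewrite /pgl_to -{1}gz pgl_actK.
Qed.

Lemma cent1_unipotent u : u \in U -> u != 1 -> 'C_G[u] = U.
Proof.
case/setIP=> Gu uz un1; apply/setP=> g; rewrite !in_setI; case Gg: (g \in G) => //=.
apply/cent1P/idP=> [cug | gz].
  exact: cent_unipotent uz un1 (commute_sym cug).
by apply: (centsP (trans_abelian z)).
Qed.

Lemma card_class_unipotent u : u \in U -> u != 1 ->
  #|u ^: 'C_G[z | 'to]| = #|'C_G[z | 'to] : U|.
Proof.
move=> Uu un1; rewrite -index_cent1; congr #|_ : _|.
rewrite -[RHS](cent1_unipotent Uu un1); apply/setP=> g.
rewrite in_setI [in RHS]in_setI [g \in gval _]stabE.
rewrite -andbA; case Gg: (g \in G) => //=; case ug: (g \in 'C[u]); rewrite ?andbF ?andbT //.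
have : g \in U by rewrite -(cent1_unipotent Uu un1) inE Gg.
by move/(subsetP trans_sub_stab); rewrite stabE => /andP[].
Qed.

(** The stabiliser of [z] modulo [U] acts freely on the nontrivial elements of [U]
    by conjugation, since the centraliser of each of them is [U]. *)
Lemma index_stab_dvd : #|'C_G[z | 'to] : U| %| #|U|.-1.
Proof.
have -> : #|U|.-1 = #|U^#| by rewrite (cardsD1 1 U) group1.
apply: (@dvdn_card_orbits _ _ _ 'J 'C_G[z | 'to]) => [|u /setD1P[un1 Uu]].
  by rewrite astabsJ normD1 stab_norm_trans.
by rewrite orbitJ card_class_unipotent.
Qed.

(** [U] acts freely on the other centers. *)
Lemma card_trans_dvd_centers : #|U| %| #|centers|.-1.
Proof.
have -> : #|centers|.-1 = #|centers :\ z| by rewrite (cardsD1 z centers) cz.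
have UG : U \subset G by apply: subsetIl.
apply: (@dvdn_card_orbits _ _ _ 'to (G :&: trans_group z)) => [|w /setD1P[wz cw]].
  apply/actsP=> g Ug w; rewrite !in_setD1 (acts_act acts_centers) ?(subsetP UG) //.
  congr (~~ _ && _); have /setIP[_ /trans_fix/eqP] := Ug.
  by rewrite -pgl_fix => /eqP gz; rewrite -{1}gz (inj_eq (act_inj 'to g)).
rewrite -(card_orbit_stab 'to (G :&: trans_group z) w) (_ : 'C__[_ | _] = 1) ?cards1 ?muln1 //.
apply/trivgP/subsetP=> g; rewrite stabE in_set1 => /andP[/setIP[_ gz] gw].
by apply: contraR wz => gn1; rewrite -in_set1 -(transP gz gn1) inE.
Qed.

Lemma card_trans_gt1 : 1 < #|U|.
Proof.
have /centersP[u Uu un1] := cz; rewrite cardG_gt1; apply/trivgPn.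
by exists u.
Qed.

Lemma card_trans_const w : w \in centers -> #|G :&: trans w| = #|U|.
Proof.
by move=> cw; rewrite (card_Hall (centers_Sylow cw)) -(card_Hall (centers_Sylow cz)).
Qed.

(** Each unipotent element of [G] lies in exactly one of the groups [trans w]. *)
Lemma sum_unipotent :
  (\sum_(g in G^#) unipotent g = #|centers| * #|U|.-1)%N.
Proof.
transitivity (\sum_(g in G^#) \sum_(w in centers) (g \in trans w : nat)).
  apply: eq_bigr => g /setD1P[gn1 Gg]; have [ug|nug] := boolP (unipotent g).
    have /unipotentP[w fw] := ug.
    have gw : g \in trans w by rewrite inE fw eqxx orbT.
    have cw : w \in centers by apply/centersP; exists g; rewrite // inE Gg.
    rewrite (bigD1 w) //= gw big1 // => v /andP[_ vw].
    case gv: (g \in trans v) => //.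
    by rewrite (trans_eq gv gw gn1) eqxx in vw.
  rewrite big1 // => w _; case gw: (g \in trans w) => //.
  by rewrite (trans_unipotent gw gn1) in nug.
rewrite exchange_big /= -sum_nat_const; apply: eq_bigr => w cw.
rewrite -(card_trans_const cw) (cardsD1 1 (_ :&: _)) group1 /= -sum1_card.
rewrite big_mkcond [RHS]big_mkcond /=; apply: eq_bigr => g _.
by rewrite !inE; case: (g == 1); case: (g \in G); case: (fixes g == _).
Qed.

End AtPoint.

(** The Riemann-Hurwitz count: every nontrivial element of [G] fixes two points,
    or one if it is unipotent, so counting the orbits on points with nontrivial
    stabiliser leaves at most one orbit besides the orbit of centers. *)
Lemma orbit_count z : z \in centers -> {in G, forall g, fixes g != set0} ->
  (#|centers| = 1%N /\ #|G| = #|G :&: trans z|) \/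
  (exists2 w, w \notin centers &
    [/\ 1 < #|'C_G[w | 'to]|,
        #|orbit 'to G w| = (#|G :&: trans z|.-2 * #|centers| + 2)%N
      & #|G| = (#|orbit 'to G w| * #|'C_G[w | 'to]|)%N]).
Proof.
move=> cz split; set s := #|G :&: trans z|; set N := #|centers|.
pose Y := [set w | w \notin centers & 'C_G[w | 'to] != 1].
have actsY : [acts G, on Y | 'to].
  apply/actsP=> g Gg w; rewrite [LHS]inE [RHS]inE (acts_act acts_centers) //.
  congr (_ && ~~ _); have -> : 'C_G[pgl_to w g | 'to] = 'C_G[w | 'to] :^ g.
    by rewrite conjIg -(astab1_act 'to) conjGid.
  by apply/eqP/eqP=> [/(canRL (conjsgK g))|->]; rewrite ?conjs1g.
have FC1 := Frobenius_Cauchy acts_centers; have FCY := Frobenius_Cauchy actsY.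
set r := #|orbit 'to G @: Y| in FCY.
have orbC : #|orbit 'to G @: centers| = 1%N.
  rewrite (_ : orbit 'to G @: centers = [set centers]) ?cards1 //.
  apply/setP=> T; rewrite in_set1; apply/imsetP/eqP=> [[w cw ->]|->].
    exact: transitive_centers.
  by exists z; rewrite ?transitive_centers.
rewrite orbC mul1n in FC1.
have Fix1 (S : {set option F}) : 'Fix_(S | 'to)[1] = S.
  by apply/setIidPl/subsetP=> w _; apply/afix1P; rewrite act1.
rewrite (big_setD1 1) ?group1 //= Fix1 in FC1.
rewrite (big_setD1 1) ?group1 //= Fix1 in FCY.
(* [Y] contains every fixed point, not a center, of a nontrivial element. *)
have fixE g : g \in G^# ->
    (#|'Fix_(centers | 'to)[g]| + #|'Fix_(Y | 'to)[g]| + unipotent g = 2)%N.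
  case/setD1P=> gn1 Gg.
  have -> : #|'Fix_(centers | 'to)[g]| = #|fixes g :&: centers|.
    rewrite setIC; congr #|pred_of_set _|; congr (_ :&: _); apply/setP=> w.
    by rewrite [RHS]inE -pgl_fix; apply/afix1P/eqP.
  have -> : #|'Fix_(Y | 'to)[g]| = #|fixes g :\: centers|.
    congr #|pred_of_set _|; apply/setP=> w.
    have -> : (w \in 'Fix_(Y | 'to)[g]) = (w \in Y) && (w \in fixes g).
      by rewrite in_setI; congr (_ && _); rewrite [RHS]inE -pgl_fix; apply/afix1P/eqP.
    rewrite in_setD [w \in Y]inE; case: (w \notin centers) => //=.
    case gw: (w \in fixes g); rewrite ?andbF // andbT.
    apply/trivgPn; exists g => //; rewrite stabE Gg /=; by rewrite inE in gw.
  rewrite cardsID /unipotent; have := card_fixes_le2 gn1.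
  by have := split g Gg; rewrite -card_gt0; case: #|_| => [|[|[|]]].
have S2 : (\sum_(g in G^#) #|'Fix_(centers | 'to)[g]| +
   \sum_(g in G^#) #|'Fix_(Y | 'to)[g]| + N * s.-1 = 2 * #|G|.-1)%N.
  rewrite -(sum_unipotent cz) -!big_split /= (eq_bigr (fun=> 2)) //.
  by rewrite sum_nat_const mulnC (cardsD1 1 G) group1.
(* Every orbit in [Y] has length at most [#|G| / 2]. *)
have Y2 : (2 * #|Y| <= r * #|G|)%N.
  rewrite -(acts_sum_card_orbit actsY) -sum_nat_const big_distrr /=.
  apply: leq_sum => _ /imsetP[w /[!inE] /andP[_ Cw] ->].
  rewrite -[X in _ <= X](card_orbit_stab 'to G w) mulnC leq_mul2l cardG_gt1.
  by rewrite Cw orbT.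
have s1 : 1 < s := card_trans_gt1 cz.
have N1 : 0 < N by apply/card_gt0P; exists z.
have oG := card_G_centers cz.
have [k Ek] : exists k, #|'C_G[z | 'to]| = (k * s)%N.
  by apply/dvdnP/cardSg/trans_sub_stab.
have k0 : 0 < k by have := cardG_gt0 'C_G[z | 'to]; rewrite /= Ek; case: k {Ek}.
rewrite Ek -/N in oG; rewrite -/N in FC1.
have G0 : 0 < #|G| := cardG_gt0 G.
move: FC1 FCY S2; set A := (\sum_(g in _) _)%N; set B := (\sum_(g in _) _)%N => FC1 FCY S2.
(* [r] is the number of orbits in [Y]; with the bound on [#|Y|] this gives [r < 2]. *)
have key : (r * #|G| + N * s.-2 + 2 = #|Y| + #|G|)%N.
  have Es : (N * s.-1 = N * s.-2 + N)%N by rewrite -mulnSr; congr (_ * _)%N; move: s1; case: (s) => [|[]].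
  by rewrite Es in S2; apply: count_arith FC1 FCY S2.
have r1 : r <= 1.
  rewrite leqNgt; apply/negP=> r2.
  have : (2 * #|G| <= r * #|G|)%N by rewrite leq_mul2r r2 orbT.
  move: key Y2; move: (r * #|G|)%N (N * s.-2)%N => x y; lia.
have {r1} /orP[/eqP r0|/eqP r1] : (r == 0%N) || (r == 1%N) by case: (r) r1 => [|[]].
  left; rewrite r0 in key Y2; have Y0 : #|Y| = 0%N by move: Y2; rewrite mul0n; lia.
  apply: (count_arith0 N1 k0 s1 oG).
  by move: key; rewrite mul0n Y0 !add0n.
right; rewrite r1 in key; have cY := count_arith1 key.
have /card_gt0P[w Yw] : 0 < #|Y| by rewrite cY addn2.
have oY : orbit 'to G w = Y.
  have /cards1P[T DT] : #|orbit 'to G @: Y| == 1%N by rewrite -r1.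
  apply/eqP; rewrite eqEsubset acts_sub_orbit // Yw /=; apply/subsetP=> v Yv.
  have : orbit 'to G w \in [set T] by rewrite -DT imset_f.
  have : orbit 'to G v \in [set T] by rewrite -DT imset_f.
  by move=> /set1P vT /set1P ->; rewrite -vT orbit_refl.
have := Yw; rewrite inE => /andP[ncw Cw]; exists w => //; split.
- by rewrite cardG_gt1.
- by rewrite oY cY mulnC.
- by rewrite card_orbit_stab.
Qed.

End Centers.

(** * Extension of the base field *)

Section BaseChange.
Variables (F K : finFieldType) (f : {rmorphism F -> K}).
Implicit Types (g h u : PGL F) (P z w : option F) (a b c d x : F).
Local Open Scope ring_scope.

(** The entries are read off a representative; [pgl_map_mob] shows that they may be
    read off any matrix of the class. *)
Definition pgl_map g : PGL K :=
  let A := GLval (repr (set_of_coset g)) in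
  mob (f (A ord0 ord0)) (f (A ord0 ord_max)) (f (A ord_max ord0)) (f (A ord_max ord_max)).

Lemma det_map a b c d : a * d - b * c != 0 -> f a * f d - f b * f c != 0.
Proof. by rewrite -!rmorphM -rmorphB fmorph_eq0. Qed.

Lemma pgl_map_mob a b c d : a * d - b * c != 0 ->
  pgl_map (mob a b c d) = mob (f a) (f b) (f c) (f d).
Proof.
move=> nz; rewrite /pgl_map /mob.
have := mem_repr_coset (coset (scalars F) (gl2 a b c d)).
set r := repr _; rewrite val_coset ?norm_scalars // => /rcosetP[s].
rewrite inE => /is_scalar_mxP[k sk] ->; rewrite GL_ME sk gl2E //.
have kn0 : k != 0.
  apply/negP=> /eqP k0; have := GL_det s.
  by rewrite sk k0 -scalemx1 scale0r det0 eqxx.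
have E i j : (k%:M * mx2 a b c d) i j = k * mx2 a b c d i j.
  by rewrite [_ * _]mul_scalar_mx mxE.
rewrite !E !mxE /= !rmorphM -/(mob _ _ _ _) -/(mob (f a) _ _ _).
by rewrite mobZ ?fmorph_eq0 // det_map.
Qed.

Lemma pgl_map_morphM : {in [set: PGL F] &, {morph pgl_map : g h / (g * h)%g}}.
Proof.
move=> g h _ _; have [a [b [c [d [nz ->]]]]] := mob_surj g.
have [a' [b' [c' [d' [nz' ->]]]]] := mob_surj h.
rewrite mobM // !pgl_map_mob //; last first.
  rewrite (_ : _ - _ = (a * d - b * c) * (a' * d' - b' * c')) ?mulf_neq0 //.
  by ring.
by rewrite mobM ?det_map // !rmorphD !rmorphM.
Qed.
Canonical pgl_map_morphism := Morphism pgl_map_morphM.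

Lemma pgl_mapM g h : pgl_map (g * h)%g = (pgl_map g * pgl_map h)%g.
Proof. by rewrite pgl_map_morphM ?inE. Qed.

Lemma pgl_mapV g : pgl_map g^-1 = (pgl_map g)^-1%g.
Proof. by rewrite (morphV pgl_map_morphism) ?inE. Qed.

Lemma pgl_mapJ g h : pgl_map (g ^ h)%g = (pgl_map g ^ pgl_map h)%g.
Proof. by rewrite (morphJ pgl_map_morphism) ?inE. Qed.

Lemma pgl_map_unip b : pgl_map (unip b) = unip (f b).
Proof. by rewrite !unipE pgl_map_mob ?det_unip // rmorph1 rmorph0. Qed.

Lemma pgl_map_act g P : pgl_act (pgl_map g) (omap f P) = omap f (pgl_act g P).
Proof.
have [a [b [c [d [nz ->]]]]] := mob_surj g; rewrite pgl_map_mob // !mob_act ?det_map //.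
have -> : hx (omap f P) = f (hx P) by case: P => //=; rewrite rmorph1.
have -> : hy (omap f P) = f (hy P) by case: P => //=; rewrite ?rmorph1 ?rmorph0.
rewrite -!rmorphM -!rmorphD /pt fmorph_eq0.
by case: ifP => //= _; rewrite fmorph_div.
Qed.

Lemma omap_inj : injective (omap f).
Proof. by move=> [x|] [y|] //= [/fmorph_inj->]. Qed.

Lemma pgl_map_inj : 'injm pgl_map_morphism.
Proof.
apply/subsetP=> g /morphpreP[_ /set1P g1]; rewrite inE; apply/eqP.
have fixg P : pgl_act g P = P.
  apply: omap_inj; rewrite -pgl_map_act.
  by rewrite -[pgl_map g]/(pgl_map_morphism g) g1 pgl_act1.
exact: fix_std.
Qed.

Lemma pgl_map_eq1 g : (pgl_map g == 1%g) = (g == 1%g).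
Proof. by rewrite -[pgl_map g]/(pgl_map_morphism g) morph_injm_eq1 ?inE ?pgl_map_inj. Qed.

Lemma pgl_map_trans g z : (pgl_map g \in trans (omap f z)) = (g \in trans z).
Proof.
have [-> | gn1] := eqVneq g 1%g; first by rewrite (morph1 pgl_map_morphism) !group1.
apply/idP/idP=> [gz|].
  rewrite inE (negPf gn1) /=; apply/eqP/setP=> w; rewrite !inE.
  rewrite -(inj_eq omap_inj) -(inj_eq omap_inj w) -pgl_map_act.
  have := erefl (omap f w \in fixes (pgl_map g)).
  by rewrite {2}(transP gz) ?pgl_map_eq1 // in_set1 [in LHS]inE.
have [h _ hz] := pgl_trans1 z.
rewrite -hz -{1}[h]invgK -{1}transJ mem_conjg invgK trans_inf => /imsetP[b _ Dg].
have -> : g = (unip b ^ h^-1)%g by rewrite -Dg conjgK.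
rewrite pgl_mapJ pgl_map_unip pgl_mapV -pgl_map_act -{2}[pgl_map h]invgK.
rewrite -[omap f None]/None -transJ memJ_conjg trans_inf.
by apply/imsetP; exists (f b).
Qed.

Lemma pgl_map_centers p (G : {group PGL F}) : p \in [pchar F] ->
  centers (pgl_map_morphism @* G)%g = omap f @: centers G.
Proof.
move=> ch; have chK : p \in [pchar K] by rewrite (fmorph_pchar f).
apply/setP=> w; apply/centersP/imsetP=> [[u /setIP[Gu uw] un1]|[z /centersP[g /setIP[Gg gz] gn1] ->]].
  have [g _ Gg Du] := morphimP Gu; rewrite /= in Du.
  have pg : p.-group <[g]>%g.
    have oE : #[u]%g = #[g]%g by rewrite Du (order_injm pgl_map_inj) ?inE.
    rewrite /pgroup -orderE -oE orderE.
    have := pgroup_trans [set: PGL K]%G chK w; apply: pgroupS.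
    by rewrite subsetI subsetT cycle_subG.
  have [z gz] := pgroup_sub_trans ch pg; rewrite cycle_subG in gz.
  have uz : u \in trans (omap f z) by rewrite Du pgl_map_trans.
  have -> := trans_eq uw uz un1; exists z => //; apply/centersP.
  exists g; first by rewrite inE Gg.
  by rewrite -pgl_map_eq1 -Du.
exists (pgl_map g); last by rewrite pgl_map_eq1.
by rewrite inE pgl_map_trans gz mem_morphim ?inE.
Qed.

Lemma pgl_map_transI (G : {group PGL F}) z :
  #|(pgl_map_morphism @* G :&: trans (omap f z))%g| = #|(G :&: trans z)%g|.
Proof.
rewrite -(card_injm pgl_map_inj (subsetT (G :&: trans z)%g)); congr #|pred_of_set _|.
apply/setP=> u; apply/setIP/morphimP=> [[Gu uz]|[g _ /setIP[Gg gz] ->]].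
  have [g _ Gg Du] := morphimP Gu; exists g => //.
  by rewrite in_setI Gg -pgl_map_trans -[pgl_map g]Du.
split; first by rewrite mem_morphim ?inE.
by rewrite -[pgl_map_morphism g]/(pgl_map g) pgl_map_trans.
Qed.

(** The finite fixed points of a map with rows [(a, b)] and [(c, d)] are the roots
    of a quadratic polynomial with coefficients in [F]. *)
Lemma pgl_map_split : (forall b c : F, exists z : K, z ^+ 2 + f b * z + f c = 0) ->
  forall g, fixes (pgl_map g) != set0.
Proof.
move=> quad g; have [a [b [c [d [nz ->]]]]] := mob_surj g; apply/set0Pn.
rewrite pgl_map_mob //; have nz' := det_map nz.
have [c0 | cn0] := eqVneq c 0.
  by exists None; rewrite inE act_inf // c0 rmorph0 /pt eqxx.
have [z] := quad ((d - a) / c) (- b / c).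
rewrite !fmorph_div /= rmorphB rmorphN => zE; exists (Some z); rewrite inE mob_act //=.
have fc0 : f c != 0 by rewrite fmorph_eq0.
have E : f a * z + f b * 1 = (f c * z + f d * 1) * z.
  apply/eqP; rewrite -subr_eq0; apply/eqP.
  transitivity (- f c * (z ^+ 2 + (f d - f a) / f c * z + - f b / f c)); first by field.
  by rewrite zE mulr0.
have wn0 : f c * z + f d * 1 != 0.
  apply: contraNneq nz' => w0; rewrite w0 mul0r in E.
  have dE : f d = - (f c * z) by apply/eqP; rewrite -addr_eq0 addrC -[f d]mulr1 w0.
  have bE : f b = - (f a * z) by apply/eqP; rewrite -addr_eq0 addrC -[f b]mulr1 E.
  by apply/eqP; rewrite dE bE; ring.
by rewrite E -{2}[f c * z + _]mulr1 ptZ // /pt oner_eq0 divr1.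
Qed.

End BaseChange.

(** * The order of a subgroup containing unipotents *)

Section Cyclic.
Variable F : finFieldType.
Implicit Types (g h u : PGL F) (z w : option F) (a b c d : F).

(** A group fixing a point and containing no unipotent element at that point
    embeds in the multiplicative group, by its linear part. *)
Lemma stab_cyclic (C : {group PGL F}) w :
  {in C, forall g, pgl_act g w = w} -> C :&: trans w = 1 -> cyclic C.
Proof.
have [h _ <-] := pgl_trans1 w => fixC CT.
rewrite -(cyclicJ C h).
pose lin g : F := (hx (pgl_act g (Some 1)) - hx (pgl_act g (Some 0)))%R.
have aff g : g \in C :^ h -> exists a b, (a != 0)%R /\ g = mob a b 0 1.
  case/imsetP=> k Ck ->; apply: stab_inf.
  by rewrite conjgE !pgl_actM fixC // pgl_actK.
have linE a b : (a != 0)%R -> lin (mob a b 0 1) = a.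
  by move=> an0; rewrite /lin !act_aff //= mulr0 mulr1 add0r addrK.
apply: (@field_mul_group_cyclic _ _ _ lin) => [g k|g].
  move=> /aff[a [b [an0 ->]]] /aff[c [d [cn0 ->]]].
  rewrite mobM ?det_aff // !linE //.
  rewrite (_ : mob _ _ _ _ = mob (a * c) (a * d + b) 0 1) ?linE ?mulf_neq0 //.
  by apply: mob_eq; ring.
move=> Cg; have [a [b [an0 Dg]]] := aff g Cg; split=> [|->]; last first.
  by rewrite -mob1 linE ?oner_neq0.
rewrite Dg linE // => a1; have : g \in (C :&: trans (pgl_act h None)) :^ h.
  rewrite conjIg inE Cg transJ pgl_actK trans_inf Dg a1.
  by apply/imsetP; exists b; rewrite ?unipE.
by rewrite CT conjs1g Dg a1 => /set1P.
Qed.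

End Cyclic.

Section OrderDichotomy.
Variable F : finFieldType.

(** Over the extension of [quadratic_extension] every element has a fixed point, so
    that [orbit_count] applies to the image of [G].  The group [C] is the inverse
    image of the stabiliser of a point that is not a center: it contains no
    unipotent element, whence [stab_cyclic] and the prime-to-[p] order.  Over [F]
    itself, [C] need not fix a point. *)
Lemma order_dichotomy p (G : {group PGL F}) z : p \in [pchar F]%R -> z \in centers G ->
  (#|centers G| = 1%N /\ #|G| = #|G :&: trans z|) \/
  (exists C : {group PGL F}, [/\ C \subset G, cyclic C, 1 < #|C|, ~~ (p %| #|C|)
      & #|G| = ((#|G :&: trans z|.-2 * #|centers G| + 2) * #|C|)%N]).
Proof.
move=> ch cz; have [K [f quad]] := quadratic_extension F.
have chK : p \in [pchar K]%R by rewrite (fmorph_pchar f).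
have injf := pgl_map_inj f; set m := pgl_map_morphism f in injf.
have czK : omap f z \in centers (m @* G) by rewrite (pgl_map_centers f G ch) imset_f.
have cardG : #|m @* G| = #|G| by rewrite (card_injm injf) ?subsetT.
have cardN : #|centers (m @* G)| = #|centers G|.
  by rewrite (pgl_map_centers f G ch) card_imset //; apply: omap_inj.
have split : {in m @* G, forall g : PGL K, fixes g != set0}.
  by move=> _ /morphimP[g _ _ ->]; apply: pgl_map_split.
have [[]|[w ncw [c1 oE]]] := orbit_count chK czK split.
  by rewrite cardN cardG pgl_map_transI => -> ->; left.
rewrite cardG oE cardN pgl_map_transI => cG; right.
pose S := ('C_(m @* G)[w | pgl_to_action K])%G.
rewrite -/(gval S) in c1 cG.
have SG : S \subset m @* G by apply: subsetIl.
have trivS : S :&: trans w = 1.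
  apply/trivgP/subsetP=> u /setIP[Su uw]; rewrite in_set1; apply: contraR ncw => un1.
  by apply/centersP; exists u; rewrite // inE (subsetP SG).
have cS : cyclic S.
  by apply: (@stab_cyclic K S w) => // u; rewrite stabE => /andP[_ /eqP].
have pS : ~~ (p %| #|S|).
  apply/negP=> /(Cauchy (pcharf_prime ch))[u Su ou].
  have un1 : u != 1 by rewrite -order_gt1 ou (prime_gt1 (pcharf_prime ch)).
  have [v] : exists v, <[u]> \subset trans v.
    by apply: (pgroup_sub_trans chK); rewrite /pgroup -orderE ou pnat_id ?(pcharf_prime ch).
  rewrite cycle_subG => uv; have : w \in fixes u.
    by rewrite inE; move: Su; rewrite stabE => /andP[].
  rewrite (transP uv un1) => /set1P wv; rewrite -wv in uv.
  have : u \in S :&: trans w by rewrite inE Su.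
  by rewrite trivS in_set1 (negPf un1).
have mK : m @* (m @*^-1 S) = S.
  by rewrite morphpreK // (subset_trans SG) // morphimS ?subsetT.
have cardC : #|m @*^-1 S| = #|S| by rewrite -(card_injm injf (subsetT _)) mK.
have CG : m @*^-1 S \subset G by rewrite -(injmK injf (subsetT G)) morphpreS.
have cC : cyclic (m @*^-1 S) by rewrite -(injm_cyclic injf (subsetT _)) /= mK.
by exists (m @*^-1 S)%G; rewrite /= cardC.
Qed.

End OrderDichotomy.

(** Here [k] divides [s - 1] because a point stabiliser acts freely on the
    nontrivial unipotents it contains, and [N = 1 mod s] because these act freely
    on the other centers.  Writing [N = 1 + f s] and eliminating [n] and [c] shows
    that [m = 1 + (s - 2) f], which is prime to [f], divides [2 k], and [k] is at
    most [s - 1]: this leaves [s = 2], [f = 1] or [s = f = 3]. *)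
Lemma order_trichotomy s N k c n : 1 < s -> 1 < N -> k %| s.-1 -> s %| N.-1 ->
  n = (N * (s * k))%N -> n = ((s.-2 * N + 2) * c)%N ->
  [\/ s = 2, N = s.+1 | [/\ s = 3, N = 10 & n = 60]].
Proof.
case: s => [|[|t]] //= _ N1 /dvdnP[d Dk] /dvdnP[f DN] En Ec.
have {}DN : N = (f * t.+2).+1 by case: N N1 DN {En Ec} => //= N _ ->.
have f0 : 0 < f by move: N1; rewrite DN; case: (f).
have [-> | t0] := posnP t; first by constructor 1.
pose m := (1 + t * f)%N.
have mN : (k * N = c * m)%N.
  apply/eqP; rewrite -(@eqn_pmul2l t.+2) //; apply/eqP.
  have := En; rewrite Ec DN /m; nia.
have m2k : m %| 2 * k.
  have cmf : coprime m f by rewrite /m /coprime addnC gcdnC gcdnMDl gcdn1.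
  rewrite -(Gauss_dvdl _ cmf) -(dvdn_addr _ (dvdn_mull k (dvdnn m))).
  have -> : (k * m + 2 * k * f)%N = (k * N)%N by rewrite DN /m; nia.
  by rewrite mN dvdn_mull.
have k0 : 0 < k by move: Dk; case: (k) => //; rewrite muln0.
have le_m : m <= 2 * k by apply: dvdn_leq m2k; rewrite muln_gt0.
have [d2 | d1] := leqP 2 d.
  constructor 2; suff f1 : f = 1%N by rewrite DN f1 mul1n.
  have : t * f <= t * 1.
    have : 2 * k <= t.+1 by rewrite Dk leq_mul2r d2 orbT.
    move: le_m; rewrite /m; lia.
  by rewrite leq_pmul2l // => f1; apply: anti_leq; rewrite f1 f0.
have {d1}Dk : k = t.+1 by move: Dk; case: d d1 => [|[]] //; rewrite mul1n.
have [f1 | f2] := leqP f 1; first by constructor 2; rewrite DN (anti_leq (_ : f <= 1 <= f)) ?mul1n ?f1.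
have [f2E | f3] := leqP f 2.
  have Ef : f = 2 by apply: anti_leq; rewrite f2E f2.
  have E : (2 * k)%N = m + 1 by rewrite /m Ef Dk; lia.
  move: m2k; rewrite E dvdn_addr // dvdn1 /m Ef; case: (t) t0 => // u _; lia.
have tf : t * 3 <= t * f by rewrite leq_mul2l f3 orbT.
have t1 : t = 1%N.
  by clear -tf t0 le_m Dk; subst m; move: (t * f)%N tf le_m => x; rewrite Dk; lia.
have Ef : f = 3.
  by clear -t1 f3 le_m Dk; subst m; move: le_m; rewrite Dk t1 mul1n; lia.
by constructor 3; rewrite En Dk DN t1 Ef.
Qed.

(** * Recognising a subfield and its special linear group *)

(** A matrix of determinant 1 with nonzero lower left entry is a product of an upper,
    a lower and an upper unitriangular matrix. *)
Lemma PSL_generated (F : finFieldType) (H : {group PGL F}) :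
  (forall b : F, unip b \in H) -> (forall c : F, mob 1 0 c 1 \in H) -> PSL F \subset H.
Proof.
move=> HU HL.
have gen (a b c d : F) : (c != 0)%R -> (a * d - b * c = 1)%R -> mob a b c d \in H.
  move=> cn0 D.
  have nzL : (1 * 1 - 0 * c != 0 :> F)%R by rewrite mul1r mul0r subr0 oner_neq0.
  have nz2 : (1 * 1 - (d - 1) / c * 0 != 0 :> F)%R by apply: det_unip.
  have nz3 : (1 * 1 - (a - 1) / c * 0 != 0 :> F)%R by apply: det_unip.
  have -> : mob a b c d = unip ((a - 1) / c)%R * (mob 1 0 c 1 * unip ((d - 1) / c)%R).
    rewrite !unipE (mobM nzL nz2) mobM //; last first.
      by rewrite (_ : (_ - _ = 1)%R) ?oner_neq0 //; field.
    have -> : b = ((a * d - 1) / c)%R by rewrite -D; field.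
    by apply: mob_eq; field.
  by rewrite !groupM.
apply/subsetP=> g; have [a [b [c [d [nz ->]]]]] := mob_surj g.
rewrite mob_PSL // => /imsetP[t /[!inE] tn0 D].
pose a' := (a / t)%R; pose b' := (b / t)%R; pose c' := (c / t)%R; pose d' := (d / t)%R.
have D' : (a' * d' - b' * c' = 1)%R.
  by rewrite /a' /b' /c' /d' -(mulfV (expf_neq0 2 tn0)) -{1}D; field.
have nz' : (a' * d' - b' * c' != 0)%R by rewrite D' oner_neq0.
rewrite (_ : mob a b c d = mob a' b' c' d'); last first.
  rewrite -[RHS](mobZ tn0 nz').
  by apply: mob_eq; rewrite mulrC divfK.
have [c0 | cn0] := eqVneq c' 0%R; last exact: gen.
have dn0 : (d' != 0)%R.
  by apply: contraNneq nz' => d0; rewrite d0 c0 !mulr0 subrr.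
have nzL : (1 * 1 - 0 * 1 != 0 :> F)%R by rewrite mul1r mul0r subr0 oner_neq0.
rewrite -(groupMr _ (HL 1%R)) mobM // gen //.
  by rewrite c0 !mul0r mulr1 add0r.
transitivity (a' * d' - b' * c')%R => //; ring.
Qed.

Section Hua.
Variables (F : finFieldType) (A : {set F}) (r : F).
Hypotheses (A1 : 1%R \in A) (AB : {in A &, forall a b, (a - b)%R \in A}).
Hypotheses (rn0 : (r != 0)%R).
Hypothesis Ar : {in A, forall a, (a != 0)%R -> (r / a)%R \in A}.
Local Open Scope ring_scope.

Lemma hua_group0 : 0 \in A.
Proof. by rewrite -(subrr 1) AB. Qed.

Lemma hua_groupN a : a \in A -> - a \in A.
Proof. by move=> Aa; rewrite -[- a]add0r AB // hua_group0. Qed.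

Lemma hua_groupD a b : a \in A -> b \in A -> a + b \in A.
Proof. by move=> Aa Ab; rewrite -[b]opprK AB // hua_groupN. Qed.

(** Hua's identity: [a - a^2 b / r] is built from [a] and [b] with subtractions and
    the map [z |-> r / z] alone. *)
Lemma hua_identity a b : a \in A -> b \in A -> a ^+ 2 * b / r \in A.
Proof.
move=> Aa Ab.
have [-> | an0] := eqVneq a 0; first by rewrite expr0n !mul0r hua_group0.
have [-> | bn0] := eqVneq b 0; first by rewrite mulr0 mul0r hua_group0.
have [E | nz] := eqVneq (r - a * b) 0.
  have -> : a ^+ 2 * b / r = a; last by [].
  have -> : a ^+ 2 * b = a * r by rewrite -(subrK (a * b) r) E; ring.
  by rewrite mulfK.
have n1 : r / b - a != 0.
  by apply: contraNneq nz => E; apply/eqP; rewrite -(divfK bn0 r) -(subrK a (r / b)) E; ring.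
have E2 : r / a + r / (r / b - a) = r ^+ 2 / (a * (r - a * b)).
  by field; rewrite an0 bn0 nz.
have n2 : r / a + r / (r / b - a) != 0.
  by rewrite E2 mulf_neq0 ?invr_eq0 ?expf_neq0 ?mulf_neq0.
have : r / (r / a + r / (r / b - a)) \in A.
  by apply: Ar n2; apply: hua_groupD; apply: Ar => //; apply: AB => //; apply: Ar.
have -> : r / (r / a + r / (r / b - a)) = a - a ^+ 2 * b / r.
  by rewrite E2; field; rewrite rn0 an0 nz.
by move=> h; rewrite -[X in X \in _](subKr a) AB.
Qed.

(** By Hua's identity, [x ^ 2 * y] stays in [A] for [x] and [y] in [A].  In
    characteristic 2 every element of [A] is a square of [A], by injectivity of the
    Frobenius map; otherwise [2 a b] is a combination of squares, and division by 2
    preserves the finite group [A]. *)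
Lemma hua_mul a b : a \in A -> b \in A -> a * b \in A.
Proof.
have rA : r \in A by rewrite -[r]divr1 Ar ?oner_neq0.
have sqM x y : x \in A -> y \in A -> x ^+ 2 * y \in A.
  move=> Ax Ay; have Ary : r * y \in A.
    by have := hua_identity rA Ay; rewrite expr2 -!mulrA [r * (y / r)]mulrC divfK.
  have := hua_identity Ax Ary.
  by rewrite (_ : x ^+ 2 * (r * y) / r = x ^+ 2 * y) //; field.
move=> Aa Ab; have [two0 | two_n0] := eqVneq (2%:R : F) 0.
  have ch2 : 2 \in [pchar F] by rewrite inE /= two0.
  have sqinj : {in A &, injective (fun x : F => x ^+ 2)}.
    by move=> x y _ _; rewrite -!(pFrobenius_autE ch2); apply: fmorph_inj.
  have : [set x ^+ 2 | x in A] = A.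
    apply/eqP; rewrite eqEcard (card_in_imset sqinj) leqnn andbT.
    apply/subsetP=> _ /imsetP[x Ax ->]; rewrite -[x ^+ 2]mulr1; exact: sqM.
  by move=> E; move: Aa; rewrite -{1}E => /imsetP[x Ax ->]; apply: sqM.
have sq x : x \in A -> x ^+ 2 \in A by move=> Ax; rewrite -[x ^+ 2]mulr1 sqM.
have : [set 2%:R * x | x in A] = A.
  apply/eqP; rewrite eqEcard card_imset ?leqnn ?andbT; last exact: mulfI.
  by apply/subsetP=> _ /imsetP[x Ax ->]; rewrite mulr_natl mulr2n hua_groupD.
have ab2 : 2%:R * (a * b) \in A.
  rewrite (_ : 2%:R * _ = (a + b) ^+ 2 - a ^+ 2 - b ^+ 2); last by ring.
  by rewrite !AB ?sq ?hua_groupD.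
by move=> E; move: ab2; rewrite -{1}E => /imsetP[x Ax /(mulfI two_n0) ->].
Qed.

End Hua.

(** The exponents of a subfield and of a field are comparable through the orders of
    their multiplicative groups alone. *)
Lemma dvdn_pred_exp p a e : 1 < p -> 0 < a -> (p ^ a).-1 %| (p ^ e).-1 -> a %| e.
Proof.
move=> p1 a0; elim/ltn_ind: e => e IH D.
have [ea | ae] := ltnP e a.
  have le : p ^ e < p ^ a by rewrite ltn_exp2l.
  have pe : 0 < p ^ e by rewrite expn_gt0 ltnW.
  have : (p ^ e).-1 < (p ^ a).-1 by rewrite -ltnS !prednK // (ltn_trans pe).
  have [pe1|/(dvdn_leq)/(_ D)] := posnP (p ^ e).-1; last by rewrite leqNgt => /negP.
  move=> _; have : (p ^ e)%N = 1%N by rewrite -(prednK pe) pe1.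
  by move/eqP; rewrite -(expn0 p) eqn_exp2l // => /eqP->.
rewrite -(subnK ae) dvdn_addl //; apply: IH; first by rewrite ltn_subrL a0 (leq_trans a0).
have pe : 0 < p ^ (e - a) by rewrite expn_gt0 ltnW.
have pa : 0 < p ^ a by rewrite expn_gt0 ltnW.
have E : (p ^ e).-1 = ((p ^ a).-1 * p ^ (e - a) + (p ^ (e - a)).-1)%N.
  by rewrite -{1}(subnK ae) expnD mulnC; nia.
by move: D; rewrite E dvdn_addr // dvdn_mulr.
Qed.

(** The nonzero elements of [A] form a subgroup of the multiplicative group, so that
    [A] consists of the roots of [X ^ #|A| - X], and so does the image of the field
    with [#|A|] elements, which embeds in [F] by [dvdn_pred_exp]. *)
Lemma subfield_image (F : finFieldType) p (A : {set F}) :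
  p \in [pchar F]%R -> 1%R \in A -> {in A &, forall a b, (a - b)%R \in A} ->
  {in A &, forall a b, (a * b)%R \in A} -> p.-nat #|A| ->
  exists (F0 : finFieldType) (f : {rmorphism F0 -> F}),
    f @: setT = A /\ power_of #|F0| #|F|.
Proof.
move=> ch A1 AB AM pA; have p_pr := pcharf_prime ch; have p1 := prime_gt1 p_pr.
have [a cA] := p_natP pA.
have A0 : 0%R \in A by rewrite -(subrr 1%R) AB.
have a0 : 0 < a.
  rewrite lt0n; apply/eqP=> E; move: cA; rewrite E expn0 => /eqP/cards1P[x DA].
  by move: A0 A1; rewrite DA !inE => /eqP<-; rewrite oner_eq0.
pose V := [set u : {unit F} | val u \in A].
have Vg : group_set V.
  apply/group_setP; split; first by rewrite inE.
  by move=> u v; rewrite !inE; apply: AM.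
have cV : #|V| = #|A|.-1.
  rewrite -(card_imset _ val_inj) (cardsD1 0%R A) A0 /=; congr #|pred_of_set _|.
  apply/setP=> x; rewrite !inE; apply/imsetP/andP=> [[u Vu ->]|[xn0 Ax]].
    by rewrite inE in Vu; split=> //; rewrite -unitfE; apply: (valP u).
  by exists (finField_unit xn0); rewrite ?inE.
have VdF : #|A|.-1 %| #|F|.-1.
  by rewrite -cV -card_finField_unit; apply: (@cardSg _ [set: {unit F}]%G (Group Vg)); apply: subsetT.
have := card_pprimeChar ch; rewrite -[#|pPrimeCharType ch|]/(#|F|); set e := logn _ _ => cF.
have ae : a %| e by apply: (dvdn_pred_exp p1 a0); rewrite -cA -cF.
have e0 : 0 < e.
  by have := finNzRing_gt1 F; rewrite cF; case: (e); rewrite ?expn0.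
have [F0 ch0 cF0] := pPrimePowerField p_pr a0.
have Ee : #|F| = (#|F0| ^ (e %/ a))%N by rewrite cF0 -expnM mulnC divnK.
have ea0 : 0 < e %/ a by rewrite divn_gt0 // dvdn_leq.
have [f injf] := finField_embed ea0 Ee.
exists F0, f; split; last by exists (e %/ a).
pose R := [set x : F | (x ^+ #|A| == x)%R].
have cA1 : 1 < #|A| by rewrite cA -{1}(expn0 p) ltn_exp2l.
have cR : #|R| <= #|A|.
  have PnX : size ('X^#|A| - 'X : {poly F})%R = #|A|.+1.
    by rewrite size_polyDl size_polyXn // size_polyN size_polyX.
  rewrite -ltnS -PnX cardE; apply: max_poly_roots; last exact: enum_uniq.
    by rewrite -size_poly_eq0 PnX.
  by apply/allP=> x; rewrite mem_enum inE rootE !hornerE subr_eq0.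
have AR : A \subset R.
  apply/subsetP=> x Ax; rewrite inE; have [-> | xn0] := eqVneq x 0%R.
    by rewrite expr0n gtn_eqF // ltnW.
  rewrite -(prednK (ltnW cA1)) -cV exprS.
  pose u := finField_unit xn0; have Vu : u \in Group Vg by rewrite inE.
  have := expg_cardG Vu => /(congr1 val); rewrite FinRing.val_unitX /= => ->.
  by rewrite mulr1.
have fR : f @: setT \subset R.
  apply/subsetP=> _ /imsetP[y _ ->]; rewrite inE cA -cF0 -rmorphXn.
  by rewrite expf_card.
have AE : A = R by apply/eqP; rewrite eqEcard AR cR.
apply/eqP; rewrite AE eqEcard fR (leq_trans cR) // card_imset //.
by rewrite cardsT cF0 cA.
Qed.

(** * Racks in groups and racks of unipotents *)

Lemma unipotent_PGL_class (F : finFieldType) (u : PGL F) :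
  unipotent u -> u \in unip (1 : F)%R ^: [set: PGL F].
Proof.
case/unipotent_conj=> [h [d [_ dn0 ->]]].
apply/imsetP; exists (mob d^-1 0 0 1 * h); rewrite ?inE //.
by rewrite conjgM unipJ_aff ?invr_eq0 // invrK mul1r.
Qed.

Lemma PGL_classP (F : finFieldType) (u : PGL F) :
  (u \in unip (1 : F)%R ^: [set: PGL F]) = unipotent u.
Proof.
apply/idP/idP=> [/imsetP[h _ ->]|]; last exact: unipotent_PGL_class.
by rewrite unipotentJ unipotent_unip ?oner_neq0.
Qed.

(** The inverse bijection is extended by 1; closure of [X] is needed for it to
    commute with the operations. *)
Lemma rack_isom_sym (T U : finGroupType) (X : {set T}) (Y : {set U}) :
  {in X &, forall x y, conj_op x y \in X} ->
  rack_isom (@conj_op T) (@conj_op U) X Y -> rack_isom (@conj_op U) (@conj_op T) Y X.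
Proof.
move=> clX [f [injf <- morf]].
pose g u := if [pick x in X | f x == u] is Some x then x else 1.
have gK : {in X, cancel f g}.
  move=> x Xx; rewrite /g; case: pickP => [y /andP[Xy /eqP/injf->] //|/(_ x)].
  by rewrite Xx eqxx.
exists g; split.
- by move=> _ _ /imsetP[x Xx ->] /imsetP[y Xy ->]; rewrite !gK // => ->.
- apply/setP=> x; apply/imsetP/idP=> [[_ /imsetP[y Xy ->] ->]|Xx]; first by rewrite gK.
  by exists (f x); rewrite ?imset_f ?gK.
move=> _ _ /imsetP[x Xx ->] /imsetP[y Xy ->].
by rewrite -morf // !gK // clX.
Qed.

Lemma rack_isom_trans (T U W : finGroupType) (X : {set T}) (Y : {set U}) (Z : {set W}) :
  rack_isom (@conj_op T) (@conj_op U) X Y -> rack_isom (@conj_op U) (@conj_op W) Y Z ->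
  rack_isom (@conj_op T) (@conj_op W) X Z.
Proof.
move=> [f [injf <- morf]] [g [injg <- morg]].
exists (g \o f); split; last 1 first.
- by move=> x y Xx Xy /=; rewrite morf // morg ?imset_f.
- by move=> x y Xx Xy /= /injg => /(_ (imset_f _ Xx) (imset_f _ Xy))/injf; apply.
by rewrite imset_comp.
Qed.

Lemma rack_isom_morphism (T U : finGroupType) (D : {group T}) (f : {morphism D >-> U})
    (X : {set T}) : 'injm f -> X \subset D ->
  rack_isom (@conj_op T) (@conj_op U) X (f @: X).
Proof.
move=> /injmP injf /subsetP XD; exists f; split=> // [x y /XD Dx /XD Dy|x y /XD Dx /XD Dy].
  exact: injf.
by rewrite /conj_op !morphM ?groupM ?groupV // morphV.
Qed.

Lemma rack_isomJ (T : finGroupType) (X : {set T}) g :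
  rack_isom (@conj_op T) (@conj_op T) X (X :^ g).
Proof.
exists (fun x => x ^ g); split=> // [x y _ _ /conjg_inj //|x y _ _].
by rewrite /conj_op !conjMg conjVg.
Qed.

(** Closure under the rack operation is normality, as [X] is finite. *)
Lemma closed_normJ (T : finGroupType) (X : {set T}) :
  {in X &, forall x y, conj_op x y \in X} -> <<X>> \subset 'N(X).
Proof.
move=> clX; rewrite gen_subG; apply/subsetP=> x Xx; rewrite -groupV inE.
apply/subsetP=> _ /imsetP[y Xy ->].
by have := clX x y Xx Xy; rewrite /conj_op conjgE invgK mulgA.
Qed.

Lemma norm_closed (T : finGroupType) (X : {set T}) :
  X \subset 'N(X) -> {in X &, forall x y, conj_op x y \in X}.
Proof.
move=> nX x y Xx Xy; have -> : conj_op x y = y ^ x^-1.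
  by rewrite /conj_op conjgE invgK mulgA.
by rewrite memJ_norm // groupV (subsetP nX).
Qed.

Lemma unip_orbit_refl (L : finFieldType) (b : L) : unip b \in unip_orbit b.
Proof. exact: class_refl. Qed.

Lemma unip_orbit_eq (L : finFieldType) (x : L) (u v : PGL L) :
  u \in unip_orbit x -> v \in unip_orbit x -> v \in u ^: PSL L.
Proof. by move=> ux vx; rewrite (class_eqP ux). Qed.

Lemma odd_geometric n m : odd n -> odd (\sum_(i < m) n ^ i) = odd m.
Proof.
move=> on; elim: m => [|m IH]; first by rewrite big_ord0.
by rewrite big_ord_recr oddD IH oddX on orbT addbT.
Qed.

Section UnipotentRacks.
Variables (p q : nat) (F F0 : finFieldType) (f : {rmorphism F0 -> F}).
Hypothesis F_card : #|F| = q.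
Implicit Types (u v w : PGL F0) (b c : F0).

(** In an extension of odd degree, Euler's criterion applied to the image of [b]
    gives the same sign as for [b], as the index of the multiplicative groups is
    odd. *)
Lemma nonsquare_to_square b m : (b != 0)%R -> b \notin unit_squares F0 ->
  f b \in unit_squares F -> q = (#|F0| ^ m)%N -> 0 < m -> odd #|F0| /\ ~~ odd m.
Proof.
move=> bn0 nb sb Eq m0; have oF0 : odd #|F0|.
  by apply: contraR nb => ev; apply: even_unit_squares.
split=> //; apply/negP=> om; have [y /[!inE] yn0 Dy] := imsetP sb.
have E := odd_half_pred oF0; have Nb := nonsquare_exp oF0 bn0 nb.
have oh : odd (\sum_(i < m) #|F0| ^ i) by rewrite odd_geometric.
have Dh : (#|F|.-1 = #|F0|.-1 * \sum_(i < m) #|F0| ^ i)%N by rewrite -predn_exp -Eq F_card.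
have Ey : (y ^+ #|F0|.-1 = -1)%R.
  by rewrite -E -mul2n exprM -Dy -rmorphXn Nb rmorphN rmorph1.
have := expf_card1 yn0; rewrite Dh exprM Ey -signr_odd oh expr1 => m1.
move: nb; rewrite euler_square // Nb => /eqP; case.
by apply: (fmorph_inj f); rewrite rmorphN rmorph1.
Qed.

(** A set of unipotents normalised by [PSL F0] consists of one or both of the two
    classes of unipotents; in the latter case they can only fuse in [PSL F] if
    nonsquares of [F0] become squares in [F]. *)
Lemma unipotent_listed m (Y : {set PGL F0}) :
  Y != set0 -> {in Y, forall u, unipotent u} -> PSL F0 \subset 'N(Y) ->
  {in Y &, forall u v, pgl_map f v \in pgl_map f u ^: PSL F} ->
  q = (#|F0| ^ m)%N -> 0 < m -> listed_rack p q Y.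
Proof.
case/set0Pn=> y Yy unipY nY fuse Eq m0.
have sub u b : u \in Y -> u \in unip_orbit b -> unip_orbit b \subset Y.
  move=> Yu ub; rewrite /unip_orbit -(class_eqP ub).
  by apply/subsetP=> _ /imsetP[g Pg ->]; rewrite memJ_norm // (subsetP nY).
have [b bn0 yb] := unipotent_orbit (unipY y Yy); have subb := sub y b Yy yb.
have [Yb | nYb] := boolP (Y \subset unip_orbit b).
  have -> : Y = unip_orbit b by apply/eqP; rewrite eqEsubset Yb.
  apply: (@listed_PSL _ _ #|F0|) => //; first by exists m.
  split; first by rewrite mem_classes // (subsetP (unip_orbit_sub b)) // unip_orbit_refl.
  by move=> u /(unip_orbit_unipotent bn0)/eqP.
have [u Yu nub] := subsetPn nYb; have [c cn0 uc] := unipotent_orbit (unipY u Yu).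
have subc := sub u c Yu uc.
have nsq : (c / b)%R \notin unit_squares F0.
  rewrite -unip_orbitP //; apply: contra nub => cb.
  by rewrite /unip_orbit -(class_eqP cb).
have cbn0 : (c / b != 0)%R by rewrite mulf_neq0 ?invr_eq0.
have [fbn0 fcn0] : (f b != 0)%R /\ (f c != 0)%R by rewrite !fmorph_eq0.
have sq : f (c / b)%R \in unit_squares F.
  rewrite fmorph_div -unip_orbitP // /unip_orbit -!pgl_map_unip; apply: fuse.
    exact/(subsetP subb)/unip_orbit_refl.
  exact/(subsetP subc)/unip_orbit_refl.
have [oF0 em] := nonsquare_to_square cbn0 nsq sq Eq m0.
have YE : Y = unip (1 : F0)%R ^: [set: PGL F0].
  apply/setP=> v; rewrite PGL_classP; apply/idP/idP=> [/unipY //|].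
  case/unipotent_conj=> k [d [kP dn0 ->]]; rewrite memJ_norm ?(subsetP nY) //.
  have [db | ndb] := boolP ((d / b)%R \in unit_squares F0).
    by apply: (subsetP subb); rewrite unip_orbitP.
  apply: (subsetP subc); rewrite unip_orbitP // (_ : (d / c = d / b / (c / b))%R); last first.
    by field; rewrite bn0 cn0.
  have sqi : (c / b)^-1%R \notin unit_squares F0.
    by apply: contra nsq => /unit_squaresV; rewrite invrK.
  by rewrite nonsquareM ?invr_eq0 // mulf_neq0 ?invr_eq0.
rewrite YE; apply: (@listed_PGL _ _ #|F0|) => //.
  by rewrite Eq oddX oF0 orbT.
exists m./2; last by rewrite -expnM mul2n Eq -{1}(odd_double_half m) (negPf em).
by move: m0 em; case: (m) => [|[|]].
Qed.

End UnipotentRacks.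

(** A subrack of some class [unip_orbit x], with [x] not named: this makes the
    notion invariant under conjugation by [PGL F], which permutes these classes. *)
Definition fused_rack (F : finFieldType) (X : {set PGL F}) : Prop :=
  [/\ X != set0, {in X &, forall u v, conj_op u v \in X}, {in X, forall u, unipotent u}
    & {in X &, forall u v, v \in u ^: PSL F}].

Lemma fused_rackJ (F : finFieldType) (X : {set PGL F}) g :
  fused_rack X -> fused_rack (X :^ g).
Proof.
case=> Xn0 clX uniX fusX; split.
- by have /set0Pn[u Xu] := Xn0; apply/set0Pn; exists (u ^ g); rewrite memJ_conjg.
- move=> _ _ /imsetP[u Xu ->] /imsetP[v Xv ->].
  by rewrite /conj_op -conjVg -!conjMg memJ_conjg clX.
- by move=> _ /imsetP[u Xu ->]; rewrite unipotentJ uniX.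
move=> _ _ /imsetP[u Xu ->] /imsetP[v Xv ->].
have /imsetP[h hP ->] := fusX u v Xu Xv.
by apply/imsetP; exists (h ^ g); rewrite -?conjJg // memJ_norm ?norm_PSL.
Qed.

Lemma act_centers (F : finFieldType) (G : {group PGL F}) g z :
  g \in G -> (pgl_act g z \in centers G) = (z \in centers G).
Proof.
move=> Gg; rewrite -[g]invgK -[pgl_act _ _]/(pgl_to_action F z g^-1).
by rewrite (acts_act (acts_centers G)) ?groupV.
Qed.

(** * The case N = s + 1: classes over a subfield *)

Section SubfieldCase.
Variables (F : finFieldType) (p : nat) (X : {set PGL F}).
Hypotheses (ch : p \in [pchar F]%R) (rackX : fused_rack X).
Let G : {group PGL F} := <<X>>%G.
Hypothesis c_inf : None \in centers G.
Hypothesis c_0 : Some 0%R \in centers G.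
Hypothesis c_1 : Some 1%R \in centers G.
Hypothesis card_c : #|centers G| = #|G :&: trans None|.+1.
Local Notation "'to" := (pgl_to_action F).

(** By cardinality, [A] is the set of finite centers: the translations in [G] act
    transitively on them. *)
Let A : {set F} := [set b | unip b \in G].

Let cardA : #|A| = #|G :&: trans None|.
Proof.
rewrite -(card_imset _ (@unip_inj F)); congr #|pred_of_set _|.
apply/setP=> u; rewrite inE trans_inf; apply/imsetP/andP=> [[b Ab ->]|[Gu /imsetP[b _ Du]]].
  by rewrite inE in Ab; rewrite imset_f.
by exists b; rewrite // inE -Du.
Qed.

Let centersE : centers G = None |: (Some @: A).
Proof.
apply/esym/eqP; rewrite eqEcard cardsU1 card_imset; last by move=> x y [].
rewrite (_ : None \notin _) /=; last by apply/imsetP=> -[].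
rewrite cardA add1n card_c leqnn andbT subUset sub1set c_inf /=.
apply/subsetP=> _ /imsetP[b Ab ->]; rewrite inE in Ab.
have := c_0; rewrite -(act_centers _ Ab).
by rewrite unipE act_aff ?oner_neq0 // mulr0 add0r.
Qed.

Let mem_centers z : (Some z \in centers G) = (z \in A).
Proof.
rewrite centersE in_setU1 /=; apply/imsetP/idP=> [[b Ab [->]] //|Az].
by exists z.
Qed.

Let A1 : 1%R \in A. Proof. by rewrite -mem_centers. Qed.

Let AB : {in A &, forall a b, (a - b)%R \in A}.
Proof. by move=> a b /[!inE] Ga Gb; rewrite unipD -unipV groupM ?groupV. Qed.

(** Some element of [G] maps infinity to 0, by transitivity on centers; a translation
    of [G] makes it exchange the two points. *)
Lemma swap_exists : exists2 r : F, (r != 0)%R & mob 0 r 1 0 \in G.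
Proof.
have := c_0; rewrite -(transitive_centers ch c_inf) => /orbitP[h Gh h0].
have g00 : pgl_act h^-1 None = Some 0%R by [].
have : pgl_act h None \in centers G by rewrite act_centers.
case E : (pgl_act h None) => [a|]; last first.
  by move: g00; rewrite -{1}E pgl_actK.
rewrite mem_centers inE => Ga.
pose g := h^-1 * unip a.
have ga z : pgl_act (unip a) z = omap (fun y => y + a)%R z.
  rewrite unipE; case: z => [z|] /=; last by rewrite act_aff_inf ?oner_neq0.
  by rewrite act_aff ?oner_neq0 // mul1r.
have gN : pgl_act g None = Some 0%R by rewrite pgl_actM ga.
have g0 : pgl_act g (Some 0%R) = None by rewrite pgl_actM ga /= add0r -E pgl_actK.
have Gg : g \in G by rewrite groupM ?groupV.
have [x [b [c [d [nz Dg]]]]] := mob_surj g.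
move: gN g0; rewrite Dg act_inf // mob_act //= !mulr0 !add0r !mulr1.
rewrite {1}/pt; case: eqP => // /eqP cn0 [/eqP]; rewrite mulf_eq0 invr_eq0 (negPf cn0) orbF => /eqP x0.
move/eqP; rewrite pt_inf => /eqP d0.
have bn0 : (b != 0)%R by apply: contraNneq nz => b0; rewrite b0 x0 !mul0r subrr.
exists (b / c)%R; first by rewrite mulf_neq0 ?invr_eq0.
rewrite (_ : mob _ _ _ _ = g) // Dg x0 d0 -[LHS](@mobZ _ c) //.
  by apply: mob_eq; rewrite ?mulr0 ?mulr1 // mulrC divfK.
by rewrite mul0r sub0r mulr1 oppr_eq0 mulf_neq0 ?invr_eq0.
Qed.

(** Elements of [X] permute the projective line over [A], so come from [PGL F0] by
    their values at three points.  The translations of [G] and their conjugates by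
    the exchange generate [PSL F0]. *)
Lemma subfield_case q : #|F| = q ->
  exists (gT : finGroupType) (C : {set gT}),
    listed_rack p q C /\ rack_isom (@conj_op (PGL F)) (@conj_op gT) X C.
Proof.
move=> F_card; have [r rn0 Gw] := swap_exists; set w := mob 0 r 1 0 in Gw.
have nzw : (0 * 0 - r * 1 != 0)%R by rewrite mul0r sub0r mulr1 oppr_eq0.
have Ar : {in A, forall a, (a != 0)%R -> (r / a)%R \in A}.
  move=> a Aa an0; have : pgl_act w (Some a) \in centers G.
    by rewrite act_centers // mem_centers.
  rewrite mob_act //= !mulr1 !mul0r add0r mul1r addr0 /pt (negPf an0).
  by rewrite mem_centers.
have AM := hua_mul A1 AB rn0 Ar.
have rA : r \in A by rewrite -[r]divr1 Ar ?oner_neq0.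
have pA : p.-nat #|A| by rewrite cardA; apply: (pgroup_trans G ch None).
have [F0 [f [fA [m m0 cF]]]] := subfield_image ch A1 AB AM pA.
have memA b : f b \in A by rewrite -fA imset_f.
have cE z : z \in centers G -> exists z0, z = omap f z0.
  case: z => [z|_]; last by exists None.
  by rewrite mem_centers -fA => /imsetP[z0 _ ->]; exists (Some z0).
have [Xn0 clX uniX fusX] := rackX.
have XG : X \subset G by apply: subset_gen.
pose Y := [set y | pgl_map f y \in X].
have XE : pgl_map f @: Y = X.
  apply/eqP; rewrite eqEsubset; apply/andP; split; apply/subsetP=> u.
    by case/imsetP=> y /[!inE] Xy ->.
  move=> Xu; have Gu := subsetP XG u Xu.
  have [P EP] : exists P, pgl_act u None = omap f P by apply: cE; rewrite act_centers.
  have [Q EQ] : exists Q, pgl_act u (Some 0%R) = omap f Q.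
    by apply: cE; rewrite act_centers.
  have [R ER] : exists R, pgl_act u (Some 1%R) = omap f R.
    by apply: cE; rewrite act_centers.
  have neq z z' w0 w1 : pgl_act u z = omap f w0 -> pgl_act u z' = omap f w1 ->
      z != z' -> w0 != w1.
    move=> E0 E1; apply: contra => /eqP E; apply/eqP.
    by apply: (@pgl_act_inj _ u); rewrite E0 E1 E.
  have o01 : Some 0%R != Some 1%R :> option F.
    by apply/eqP=> -[/eqP]; rewrite eq_sym oner_eq0.
  have [y [yP yQ yR]] := pgl_trans3 (neq _ _ _ _ EP EQ isT) (neq _ _ _ _ EP ER isT)
    (neq _ _ _ _ EQ ER o01).
  suff Du : u = pgl_map f y by rewrite Du imset_f // inE -Du.
  apply: (@pgl_eq3 _ u _ None (Some 0%R) (Some 1%R)) => //.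
  - by rewrite EP -[None]/(omap f None) pgl_map_act yP.
  - by rewrite EQ -[0%R in RHS](rmorph0 f) -[Some _]/(omap f (Some 0%R)) pgl_map_act yQ.
  - by rewrite ER -[1%R in RHS](rmorph1 f) -[Some _]/(omap f (Some 1%R)) pgl_map_act yR.
have Yn0 : Y != set0.
  have /set0Pn[u] := Xn0; rewrite -XE => /imsetP[y Yy _]; apply/set0Pn; by exists y.
have uniY : {in Y, forall y, unipotent y}.
  move=> y Yy; have Xu : pgl_map f y \in X by rewrite inE in Yy.
  have /unipotentP[v fv] := uniX _ Xu.
  have vt : pgl_map f y \in trans v by rewrite inE fv eqxx orbT.
  have un1 := unipotent_neq1 (uniX _ Xu).
  have [z0 Dv] : exists z0, v = omap f z0.
    by apply/cE/centersP; exists (pgl_map f y); rewrite // inE (subsetP XG).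
  rewrite Dv pgl_map_trans in vt; rewrite pgl_map_eq1 in un1.
  exact: trans_unipotent vt un1.
have nX : G \subset 'N(X) by apply: closed_normJ.
have nY : PSL F0 \subset 'N(Y).
  apply: (@subset_trans _ _ (pgl_map_morphism f @*^-1 G)).
    apply: PSL_generated => [b|c]; rewrite !inE /=.
      by rewrite pgl_map_unip; have := memA b; rewrite inE.
    rewrite pgl_map_mob ?mulr1 ?mul0r ?subr0 ?oner_neq0 // rmorph1 rmorph0.
    have := AM _ _ (memA c) rA; rewrite inE => Gcr.
    suff -> : mob 1 0 (f c) 1 = w * unip (f c * r)%R * w^-1 by rewrite !groupM ?groupV.
    apply: (mulIg w); rewrite mulgKV unipE !mobM ?det_unip //.
      by apply: mob_eq; ring.
    by rewrite mul0r subr0 mulr1 oner_neq0.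
  apply/subsetP=> h; rewrite !inE /= => Gh; apply/subsetP=> _ /imsetP[y Yy ->].
  rewrite inE in Yy; rewrite inE pgl_mapJ memJ_norm // (subsetP nX) //.
have fusY : {in Y &, forall u v, pgl_map f v \in pgl_map f u ^: PSL F}.
  by move=> u v /[!inE] Xu Xv; apply: fusX.
exists (PGL F0), Y; split.
  by apply: (@unipotent_listed p q F F0 f F_card m Y) => //; rewrite -F_card.
apply: rack_isom_sym; last first.
  by rewrite -XE; apply: (rack_isom_morphism (pgl_map_inj f)); apply: subsetT.
move=> u v Yu Yv; rewrite inE; rewrite inE in Yu; rewrite inE in Yv.
by rewrite /conj_op !pgl_mapM pgl_mapV clX.
Qed.

End SubfieldCase.

(** * The case s = 2: dihedral groups *)

Lemma involutions_is_dihedral (gT : finGroupType) (G : {group gT}) x y n :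
  #[x] = 2 -> #[y] = 2 -> x != y -> G :=: <<[set x; y]>> -> #|G| = n.*2 -> is_dihedral n G.
Proof.
move=> ox oy xy DG oG.
have n1 : 1 < n.
  rewrite ltnNge -leq_double -oG -ltnNge.
  have : #|[set 1; x; y]| <= #|G|.
    rewrite subset_leq_card // !subUset !sub1set group1 DG /=.
    by rewrite !mem_gen ?set21 ?set22.
  apply: leq_trans; rewrite -setUA !cardsU1 cards1 !inE xy !(eq_sym 1) -!order_eq1 ox oy.
  by [].
apply: isoGrp_trans (Grp_dihedral n1).
have := involutions_gen_dihedral ox oy xy; rewrite /= -DG oG.
by [].
Qed.

Section DihedralCase.
Variables (F : finFieldType) (X : {set PGL F}).
Hypotheses (ch : 2 \in [pchar F]%R) (rackX : fused_rack X).
Let G : {group PGL F} := <<X>>%G.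
Variables (C : {group PGL F}) (z0 : option F).
Hypotheses (cz0 : z0 \in centers G) (s2 : #|G :&: trans z0| = 2).
Hypotheses (CG : C \subset G) (cC : cyclic C) (oddC : odd #|C|) (C1 : 1 < #|C|).
Hypothesis oG : #|G| = (2 * #|C|)%N.
Hypothesis oN : #|centers G| = #|C|.
Local Notation "'to" := (pgl_to_action F).

Let X_G u : u \in X -> u \in G. Proof. exact: mem_gen. Qed.

Let order_C c : c \in C -> odd #[c].
Proof. by move=> Cc; apply: dvdn_odd oddC; apply: order_dvdG. Qed.

Let unipotent_notin u : unipotent u -> u \notin C.
Proof. by move=> uu; apply/negP=> /order_C; rewrite (unipotent_order ch uu). Qed.

(** There are [N = #|C|] unipotents in [G], as many as elements outside [C], and they
    have even order. *)
Let complementE : G :\: C = [set u in G | unipotent u].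
Proof.
apply/eqP; rewrite eq_sym eqEcard; apply/andP; split.
  apply/subsetP=> u; rewrite inE => /andP[Gu uu].
  by rewrite inE Gu unipotent_notin.
rewrite cardsD (setIidPr CG) oG mul2n -addnn addnK.
have := sum_unipotent ch cz0; rewrite s2 muln1 oN => <-.
rewrite -sum1_card big_mkcond [X in _ <= X]big_mkcond /=; apply: leq_sum => u _.
by rewrite !inE; case: (u == 1); case: (u \in G) => //=; case: (unipotent u).
Qed.

Let involutionsE : involutions G = [set u in G | unipotent u].
Proof.
rewrite -complementE; apply/setP=> u; rewrite !inE; case Gu: (u \in G); rewrite ?andbF //= andbT.
apply/eqP/idP=> [ou|nCu]; first by apply/negP=> /order_C; rewrite ou.
have : u \in G :\: C by rewrite inE nCu.
by rewrite complementE inE => /andP[_ /(unipotent_order ch)->].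
Qed.

(** The involutions are conjugate, being the nontrivial elements of Sylow subgroups
    of order 2. *)
Lemma dihedral_rackE : X = involutions G.
Proof.
have [/set0Pn[t Xt] clX uniX _] := rackX.
apply/eqP; rewrite eqEsubset involutionsE; apply/andP; split; apply/subsetP=> u.
  by move=> Xu; rewrite inE X_G ?uniX.
rewrite inE => /andP[Gu uu]; have /unipotentP[v fv] := uu.
have /unipotentP[w fw] := uniX t Xt.
have uv : u \in G :&: trans v by rewrite !inE Gu fv eqxx orbT.
have tw : t \in G :&: trans w by rewrite !inE X_G // fw eqxx orbT.
have un1 := unipotent_neq1 uu; have tn1 := unipotent_neq1 (uniX t Xt).
have cv : v \in centers G by apply/centersP; exists u.
have cw : w \in centers G by apply/centersP; exists t.
have := cv; rewrite -(transitive_centers ch cw) => /orbitP[g Gg gw].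
have tgv : t ^ g \in G :&: trans v by rewrite -gw -transI_J // memJ_conjg.
have c2 : #|G :&: trans v| = 2 by rewrite (card_trans_const ch cz0 cv).
have tgn1 : t ^ g != 1 by rewrite conjg_eq1.
have -> : u = t ^ g.
  apply/eqP; apply: contraT => utg.
  have : #|[set 1; u; t ^ g]| <= #|G :&: trans v|.
    by rewrite subset_leq_card // !subUset !sub1set group1 uv tgv.
  by rewrite c2 -setUA !cardsU1 cards1 !inE utg !(eq_sym 1) negb_or un1 tgn1.
by rewrite memJ_norm // (subsetP (closed_normJ clX)).
Qed.

Lemma dihedral_rack_group : is_dihedral #|C| G.
Proof.
have [/set0Pn[t Xt] clX uniX _] := rackX.
have Gt := X_G Xt; have nCt := unipotent_notin (uniX t Xt).
have inv u : u \in G -> u \notin C -> #[u] = 2.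
  move=> Gu nCu; have : u \in G :\: C by rewrite inE nCu.
  by rewrite complementE inE => /andP[_ /(unipotent_order ch)->].
have /cyclicP[c Dc] := cC; have Cc : c \in C by rewrite Dc cycle_id.
have ntc : t * c \notin C by rewrite groupMr.
have cn1 : c != 1 by rewrite -order_gt1 orderE -Dc.
have ot := inv t Gt nCt; have otc : #[t * c] = 2.
  by apply: inv ntc; rewrite groupM // (subsetP CG).
apply: (involutions_is_dihedral ot otc); last by rewrite oG mul2n.
  by rewrite -[t in X in X != _]mulg1 (inj_eq (mulgI t)) eq_sym.
apply/eqP; rewrite eq_sym eqEcard gen_subG subUset !sub1set Gt (groupM Gt (subsetP CG c Cc)) /=.
pose H := generated_group [set t; t * c]; rewrite -/(gval H) -/(gval G).
have Ht : t \in H by rewrite mem_gen ?set21.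
have Hc : c \in H by rewrite -(groupMl _ Ht) mem_gen ?set22.
have CH : C \subset H by rewrite Dc cycle_subG.
rewrite oG -[X in _ <= X](Lagrange CH) mulnC leq_mul2l indexg_gt1.
by apply/orP; right; apply/subsetPn; exists t.
Qed.

(** A nontrivial element of [C] is not unipotent, so has two fixed points or none,
    and all of them have the same ones as [C] is abelian of odd order; [C] acts
    freely on the remaining [q - 1] or [q + 1] points. *)
Lemma dihedral_rack_dvd : (#|C| %| #|F| - 1) || (#|C| %| #|F| + 1).
Proof.
have fix02 c : c \in C -> c != 1 -> fixes c = set0 \/ #|fixes c| = 2.
  move=> Cc cn1; have := card_fixes_le2 cn1.
  have : #|fixes c| != 1%N.
    by apply/negP=> uc; have := unipotent_notin uc; rewrite Cc.
  case E: #|fixes c| => [|[|[|]]] // _ _; last by right.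
  by left; apply/eqP; rewrite -cards_eq0 E.
have [allc | ] := boolP [forall c in C^#, fixes c == set0].
  have -> : #|F| + 1 = #|[set: option F]| by rewrite cardsT card_option addn1.
  apply/orP; right; apply: (@dvdn_card_orbits _ _ _ 'to C) => [|w _].
    by apply/actsP=> g _ w; rewrite !inE.
  rewrite -(card_orbit_stab 'to C w) (_ : 'C_C[w | 'to] = 1) ?cards1 ?muln1 //.
  apply/trivgP/subsetP=> c; rewrite stabE in_set1 => /andP[Cc cw].
  apply: contraLR cw => cn1; have := forall_inP allc c; rewrite !inE cn1 Cc => /(_ isT)/eqP fc.
  by have := in_set0 w; rewrite -fc inE => ->.
rewrite negb_forall_in => /exists_inP[c0 /setD1P[c0n1 Cc0] f0].
have {f0} f2 : #|fixes c0| = 2.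
  by case: (fix02 c0 Cc0 c0n1) => // E; rewrite E eqxx in f0.
have actT : [acts C, on fixes c0 | 'to].
  apply/actsP=> c Cc w; rewrite !inE /= /pgl_to.
  have cc : c0 * c^-1 = c^-1 * c0.
    by apply: (centsP (cyclic_abelian cC)); rewrite ?groupV.
  by rewrite -pgl_actM cc pgl_actM (inj_eq (@pgl_act_inj _ _)).
have fixT w c : w \in fixes c0 -> c \in C -> pgl_act c w = w.
  move=> fw Cc; have o1 : #|orbit 'to C w| = 1%N.
    have oD : odd #|orbit 'to C w| by apply: dvdn_odd oddC; apply: dvdn_orbit.
    have : #|orbit 'to C w| <= 2 by rewrite -f2 subset_leq_card // acts_sub_orbit.
    by move: oD; case: #|_| => [|[|[|]]].
  have /card_orbit1 oE := o1; apply/eqP; rewrite -pgl_fix; apply/eqP/set1P.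
  by rewrite -oE; apply: (mem_orbit 'to).
have -> : #|F| - 1 = #|~: fixes c0|.
  by have := cardsC (fixes c0); rewrite f2 card_option add2n => -[<-]; rewrite subn1.
apply/orP; left; apply: (@dvdn_card_orbits _ _ _ 'to C) => [|w].
  by rewrite astabsC.
rewrite inE => nw; rewrite -(card_orbit_stab 'to C w) (_ : 'C_C[w | 'to] = 1) ?cards1 ?muln1 //.
apply/trivgP/subsetP=> c; rewrite stabE in_set1 => /andP[Cc cw].
apply: contraR nw => cn1.
have sub : fixes c0 \subset fixes c by apply/subsetP=> v /fixT/(_ Cc) E; rewrite inE E.
have /eqP -> : fixes c0 == fixes c by rewrite eqEcard sub f2 card_fixes_le2.
by rewrite inE.
Qed.

Lemma dihedral_case p q : p = 2 -> #|F| = q ->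
  exists (gT : finGroupType) (D : {set gT}),
    listed_rack p q D /\ rack_isom (@conj_op (PGL F)) (@conj_op gT) X D.
Proof.
move=> p2 Fq; exists (PGL F), X; split; last first.
  by exists id; split=> //; rewrite imset_id.
rewrite dihedral_rackE; apply: (listed_dihedral p2) dihedral_rack_group.
by rewrite -Fq dihedral_rack_dvd.
Qed.

End DihedralCase.

(** * The case of order 60: the alternating group on five letters *)

(** The points are renumbered because the groups to compare with permute
    ['I_n.+1]. *)
Lemma perm_representation (aT : finGroupType) (sT : finType)
    (to : {action aT &-> sT}) (G : {group aT}) (S : {set sT}) n :
  [acts G, on S | to] -> #|S| = n.+1 ->
  exists f : {morphism G >-> {perm 'I_n.+1}}, 'ker f = 'C_G(S | to).
Proof.
move=> actG cS.
have /card_gt0P[x0 Sx0] : 0 < #|S| by rewrite cS.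
pose pnt (i : 'I_n.+1) := nth x0 (enum S) i.
pose num x : 'I_n.+1 := inord (index x (enum S)).
have Spnt i : pnt i \in S by rewrite -mem_enum mem_nth // -cardE cS.
have pntK i : num (pnt i) = i.
  by rewrite /num /pnt index_uniq ?enum_uniq ?inord_val // -cardE cS.
have numK x : x \in S -> pnt (num x) = x.
  move=> Sx; rewrite /pnt inordK ?nth_index ?mem_enum //.
  by rewrite -cS cardE index_mem mem_enum.
pose fn g : {ffun 'I_n.+1 -> 'I_n.+1} := [ffun i => num (to (pnt i) g)].
pose f g : {perm 'I_n.+1} := insubd (1 : {perm 'I_n.+1}) (fn g).
have fE g i : g \in G -> f g i = num (to (pnt i) g).
  move=> Gg; have inj : injectiveb (fn g).
    apply/injectiveP=> j k; rewrite !ffunE => E.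
    have Sto l : to (pnt l) g \in S by rewrite (acts_act actG).
    rewrite -(pntK j) -(pntK k); congr num; apply: (act_inj to g).
    by rewrite -(numK _ (Sto j)) -(numK _ (Sto k)) E.
  by rewrite -pvalE -[pval _]/(val (f g)) /f val_insubd inj ffunE.
have fM : {in G &, {morph f : g h / g * h}}.
  move=> g h Gg Gh; apply/permP=> i; rewrite permM !fE ?groupM //.
  by rewrite numK ?(acts_act actG) // actM.
exists (Morphism fM); apply/setP=> g.
apply/morphpreP/setIP=> [[Gg /set1P f1]|[Gg /astabP Cg]]; split=> //.
  apply/astabP=> x Sx; have := fE g (num x) Gg.
  rewrite -[f g]/(Morphism fM g) f1 perm1 numK // => /(congr1 pnt).
  by rewrite !numK ?(acts_act actG).
by apply/set1P/permP=> i; rewrite perm1 /= fE // Cg ?pntK.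
Qed.

(** A product of two disjoint 3-cycles would need six points. *)
Lemma order3_3cycle (T : finType) (s : {perm T}) : #|T| <= 5 ->
  (s \in three_cycles T) = (#[s] == 3).
Proof.
move=> T5; rewrite inE; apply/andP/eqP=> [[_ ]|os].
  case/existsP=> a /existsP[b /existsP[c /and5P[U /eqP sa /eqP sb /eqP sc on]]].
  have s3 : s ^+ 3 = 1.
    apply/permP=> x; rewrite perm1 !expgS expg0 mulg1 !permM.
    have [|nx] := boolP (x \in [set a; b; c]); last by rewrite !(out_perm on).
    by rewrite !inE -orbA => /or3P[] /eqP->; rewrite ?(sa, sb, sc) ?(sa, sb, sc) ?(sa, sb, sc).
  have sn1 : s != 1.
    apply: contraTneq U => E; rewrite /= -sa E perm1 inE eqxx.
    by [].
  have := order_dvdn s 3; rewrite s3 eqxx => /(prime_nt_dvdP _) -> //.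
  by rewrite order_eq1.
have s3 x : s (s (s x)) = x.
  have : s ^+ 3 = 1 by rewrite -os expg_order.
  by move/permP/(_ x); rewrite perm1 !expgS expg0 mulg1 !permM.
have [a sa] : exists a, s a != a.
  apply/existsP; apply: contraT; rewrite negb_exists => /forallP h.
  suff E : s = 1 by rewrite E order1 in os.
  by apply/permP=> x; rewrite perm1; apply/eqP; have := h x; rewrite negbK.
have tri x : s x != x -> uniq [:: x; s x; s (s x)].
  move=> sx; rewrite /= !inE negb_or eq_sym sx andbT /=; apply/andP; split.
    by apply: contra sx => /eqP E; rewrite {1}E s3.
  by rewrite (inj_eq perm_inj) eq_sym.
split.
  rewrite Alt_even; have := odd_perm1 T; rewrite -(expg_order s) os !expgS expg0 mulg1.
  by rewrite !odd_permM; case: (odd_perm s).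
apply/existsP; exists a; apply/existsP; exists (s a); apply/existsP; exists (s (s a)).
rewrite tri // s3 !eqxx /=; apply/subsetP=> d; rewrite inE => sd.
apply: contraLR T5 => nd; rewrite -ltnNge.
have : #|[set a; s a; s (s a)] :|: [set d; s d; s (s d)]| <= #|T| by apply: max_card.
apply: leq_trans.
have c3 x : s x != x -> #|[set x; s x; s (s x)]| = 3.
  by move=> /tri/card_uniqP /= <-; apply: eq_card => y; rewrite !inE orbA.
rewrite cardsU !c3 // (_ : _ :&: _ = set0) ?cards0 ?subn0 //.
apply/setP=> y; rewrite in_set0; apply/negP=> /setIP[y1 y2]; case/negP: nd.
have st z : z \in [set a; s a; s (s a)] -> s z \in [set a; s a; s (s a)].
  rewrite !inE -!orbA => /or3P[] /eqP->; rewrite ?s3 ?eqxx ?orbT //.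
move: y2; rewrite !inE -!orbA => /or3P[] /eqP E; rewrite E in y1.
- by have := y1; rewrite !inE -!orbA.
- by have := st _ (st _ y1); rewrite s3 !inE -!orbA.
by have := st _ y1; rewrite s3 !inE -!orbA.
Qed.

(** [H] is normal, of index 2, so meets the simple alternating group in a normal
    subgroup, which is not trivial for lack of room. *)
Lemma order60_Alt5 (H : {group {perm 'I_5}}) : #|H| = 60 -> H :=: 'Alt_('I_5).
Proof.
move=> oH; have cI : #|'I_5| = 5 by rewrite card_ord.
have oA : #|'Alt_('I_5)| = 60.
  have := @card_Alt 'I_5; rewrite cI => /(_ isT) E.
  by apply/eqP; rewrite -(eqn_pmul2l (isT : 0 < 2)) E.
have oS : #|[set: {perm 'I_5}]| = 120.
  transitivity #|'Sym_('I_5)|; first by apply: eq_card => s; rewrite !inE.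
  by rewrite card_Sym cI.
have nH : H <| [set: {perm 'I_5}].
  by apply: index2_normal; rewrite ?subsetT // -divgS ?subsetT // oS oH.
have /simpleP[_ simA] : simple 'Alt_('I_5) by apply: simple_Alt5; rewrite cI.
have nHA : H :&: 'Alt_('I_5) <| 'Alt_('I_5).
  by rewrite setIC; apply: (normalGI (subsetT _) nH).
have [E|E] := simA [group of H :&: 'Alt_('I_5)] nHA; last first.
  apply/eqP; rewrite eq_sym eqEcard oA oH leqnn andbT.
  by apply/setIidPr; apply: E.
have := mul_cardG H 'Alt_('I_5)%G; rewrite oH oA.
have -> : #|H :&: 'Alt_('I_5)| = 1%N by have -> := E; rewrite cards1.
have : #|H * 'Alt_('I_5)| <= 120 by rewrite -oS subset_leq_card ?subsetT.
by rewrite muln1 => le E2; rewrite -E2 in le.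
Qed.

Lemma pgroup_fix_exists (aT : finGroupType) (D : {group aT}) (sT : finType)
    (to : action D sT) (p : nat) (A : {group aT}) (S : {set sT}) :
  p.-group A -> [acts A, on S | to] -> ~~ (p %| #|S|) ->
  exists2 x, x \in S & x \in 'Fix_to(A).
Proof.
move=> pA actA nd; have fixmod := pgroup_fix_mod pA actA.
have /card_gt0P[x /setIP[Sx Fx]] : 0 < #|'Fix_(S | to)(A)|; last by exists x.
rewrite lt0n; apply: contra nd => /eqP F0; rewrite F0 mod0n in fixmod.
by rewrite /dvdn fixmod.
Qed.

(** Case analysis on the divisors of a concrete number, by computation. *)
Lemma all_divisors (P : pred nat) n m : 0 < m -> n %| m -> all P (divisors m) -> P n.
Proof. by move=> m0; rewrite dvdn_divisors // => dn /allP; apply. Qed.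

Section Icosahedral.
Variables (gT : finGroupType) (G : {group gT}).
Hypothesis oG : #|G| = 60.
Hypothesis cent3 : forall u, u \in G -> #[u] = 3 -> #|'C_G[u]| = 3.

Let Sylow2_card (P : {group gT}) : 2.-Sylow(G) P -> #|P| = 4.
Proof. by move/card_Hall; rewrite oG p_part. Qed.

Let Sylow5_card (P : {group gT}) : 5.-Sylow(G) P -> #|P| = 5.
Proof. by move/card_Hall; rewrite oG p_part. Qed.

Let coprime_cent3 u v : u \in G -> #[u] = 3 -> v \in 'C_G[u] -> coprime 3 #[v] -> v = 1.
Proof.
move=> Gu ou Cv co; apply/eqP; rewrite -order_eq1 -dvdn1 -(eqP co) dvdn_gcd dvdnn.
by rewrite andbT -(cent3 Gu ou) order_dvdG.
Qed.

(** An element of order 3 normalising [Q] would centralise one of its four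
    nontrivial elements. *)
Let norm_Sylow5_3 (Q : {group gT}) : 5.-Sylow(G) Q -> ~~ (3 %| #|'N_G(Q)|).
Proof.
move=> sylQ; have oQ := Sylow5_card sylQ.
apply/negP=> /(Cauchy (isT : prime 3))[u /setIP[Gu Nu] ou].
have [v] : exists2 v, v \in Q^# & v \in 'Fix_'J(<[u]>).
  apply: (@pgroup_fix_exists _ _ _ _ 3); first by rewrite /pgroup -orderE ou.
    by rewrite astabsJ normD1 cycle_subG.
  by have := cardsD1 1 Q; rewrite group1 oQ add1n => -[<-].
case/setD1P=> vn1 Qv; rewrite afixJ cent_cycle => Cv; case/eqP: vn1.
apply: (coprime_cent3 Gu ou); first by rewrite inE (subsetP (pHall_sub sylQ)).
by apply: coprime_dvdr (order_dvdG Qv) _; rewrite oQ.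
Qed.

Let card_norm_Sylow5 (Q : {group gT}) : 5.-Sylow(G) Q -> #|'N_G(Q)| = 10.
Proof.
move=> sylQ; have n3N := norm_Sylow5_3 sylQ.
have := card_Syl_mod G (isT : prime 5); rewrite (card_Syl sylQ).
have := Lagrange (subsetIl G 'N(Q)); rewrite oG => L m5.
have d5 : 5 %| #|'N_G(Q)|.
  rewrite -(Sylow5_card sylQ) cardSg // subsetI (pHall_sub sylQ).
  exact: normG.
have dN : #|'N_G(Q)| %| 60 by rewrite -L dvdn_mulr.
have DN : #|G : 'N_G(Q)| = 60 %/ #|'N_G(Q)| by rewrite -L mulKn ?cardG_gt0.
have := @all_divisors (fun m => [&& 5 %| m, ~~ (3 %| m) & 60 %/ m %% 5 == 1%N] ==> (m == 10))
  _ 60 isT dN isT.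
by rewrite d5 n3N -DN m5 => /eqP.
Qed.

(** The centraliser of [v] has order 4 or 20, as elements of order 3 are
    self-centralising; if 20, its Sylow 5-subgroup would be normal in it, with a
    normaliser of order at least 20 instead of 10. *)
Let cent_Sylow2 (V : {group gT}) v : 2.-Sylow(G) V -> v \in V^# -> 'C_G[v] = V.
Proof.
move=> sylV /setD1P[vn1 Vv]; have oV := Sylow2_card sylV.
have VG := pHall_sub sylV; have Gv := subsetP VG v Vv.
have VD : V \subset 'C_G[v].
  rewrite subsetI VG sub_cent1 (subsetP _ v Vv) //.
  by apply: (card_p2group_abelian (isT : prime 2)).
have ov4 : #[v] %| 4 by rewrite -oV order_dvdG.
have n3D : ~~ (3 %| #|'C_G[v]|).
  apply/negP=> /(Cauchy (isT : prime 3))[u /setIP[Gu /cent1P cuv] ou].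
  case/eqP: vn1; apply: (coprime_cent3 Gu ou).
    by rewrite inE Gv; apply/cent1P/commute_sym.
  exact: coprime_dvdr ov4 _.
have d4 : 4 %| #|'C_G[v]| by rewrite -oV cardSg.
have d60 : #|'C_G[v]| %| 60 by rewrite -oG cardSg // subsetIl.
have n5D : ~~ (5 %| #|'C_G[v]|).
  apply/negP=> d5; have [w Dw ow] := Cauchy (isT : prime 5) d5.
  have Gw : w \in G by case/setIP: Dw.
  have oD : #|'C_G[v]| = 20.
    have := @all_divisors (fun m => [&& ~~ (3 %| m), 4 %| m & 5 %| m] ==> (m == 20))
      _ 60 isT d60 isT.
    by rewrite n3D d4 d5 => /eqP.
  have sylw : 5.-Sylow(G) <[w]>.
    by rewrite pHallE cycle_subG Gw -orderE ow oG p_part.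
  have sylwD : 5.-Sylow('C_G[v]) <[w]>.
    by rewrite pHallE cycle_subG Dw -orderE ow oD p_part.
  have := card_Syl_mod 'C_G[v]%G (isT : prime 5); rewrite (card_Syl sylwD).
  have L := Lagrange (subsetIl 'C_G[v] 'N(<[w]>)); rewrite oD in L.
  have d10 : #|'N_('C_G[v])(<[w]>)| %| 10.
    by rewrite -(card_norm_Sylow5 sylw) cardSg // setSI // subsetIl.
  have -> : #|'C_G[v] : 'N_('C_G[v])(<[w]>)| = 20 %/ #|'N_('C_G[v])(<[w]>)|.
    by rewrite -L mulKn ?cardG_gt0.
  by have /eqP := @all_divisors (fun m => 20 %/ m %% 5 != 1%N) _ 10 isT d10 isT.
apply/eqP; rewrite eq_sym eqEcard VD oV.
have := @all_divisors (fun m => [&& ~~ (3 %| m), 4 %| m & ~~ (5 %| m)] ==> (m == 4))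
  _ 60 isT d60 isT.
by rewrite n3D d4 n5D => /eqP->.
Qed.

Let Sylow2_TI (V W : {group gT}) v :
  2.-Sylow(G) V -> 2.-Sylow(G) W -> v \in V -> v \in W -> v != 1 -> V :=: W.
Proof.
move=> sV sW Vv Wv vn1.
have v1 : v \in V^# by rewrite in_setD1 vn1.
have v2 : v \in W^# by rewrite in_setD1 vn1.
exact: etrans (esym (cent_Sylow2 sV v1)) (cent_Sylow2 sW v2).
Qed.

Let card_class3 u : u \in G -> #[u] = 3 -> #|u ^: G| = 20.
Proof. by move=> Gu ou; rewrite -index_cent1 -divgS ?subsetIl // cent3 // oG. Qed.

Let norm_Sylow2_5 (Q V : {group gT}) : 5.-Sylow(G) Q -> 2.-Sylow(G) V ->
  ~~ (Q \subset 'N(V)).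
Proof.
move=> sylQ sylV; apply/negP=> NQ; have oQ := Sylow5_card sylQ.
have oV := Sylow2_card sylV.
have [v Vv] : exists2 v, v \in V^# & v \in 'Fix_'J(Q).
  apply: (@pgroup_fix_exists _ _ _ _ 5); first exact: pHall_pgroup sylQ.
    by rewrite astabsJ normD1.
  by have := cardsD1 1 V; rewrite group1 oV add1n => -[<-].
rewrite afixJ => /centP cv.
have : Q \subset V.
  rewrite -(cent_Sylow2 sylV Vv) subsetI (pHall_sub sylQ) /=.
  by apply/subsetP=> y Qy; apply/cent1P; apply: commute_sym; apply: cv.
by move/cardSg; rewrite oQ oV.
Qed.

(** The number of Sylow 2-subgroups divides 15, and is a multiple of 5 as none of
    them is normalised by an element of order 5.  They have pairwise trivial
    intersections, so 15 of them would fill [G] with 45 elements, while 20 have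
    order 3. *)
Lemma card_Sylow2 : #|'Syl_2(G)| = 5.
Proof.
have [Q sylQ] := Sylow_exists 5 G; have [V sylV] := Sylow_exists 2 G.
have oV := Sylow2_card sylV.
have d5 : 5 %| #|'Syl_2(G)|.
  apply: contraT => nd.
  have [W] : exists2 W, W \in 'Syl_2(G) & W \in 'Fix_'JG(Q).
    apply: (@pgroup_fix_exists _ _ _ _ 5) nd; first exact: pHall_pgroup sylQ.
    by apply: subset_trans (pHall_sub sylQ) (atrans_acts (Syl_trans 2 G)).
  rewrite inE => sylW /afixP fixW; case/negP: (norm_Sylow2_5 sylQ sylW).
  apply/subsetP=> y Qy; have := fixW y Qy => /(congr1 val) /= E.
  by rewrite inE E.
have d15 : #|'Syl_2(G)| %| 15.
  rewrite (card_Syl sylV) -(@dvdn_pmul2l 4) //.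
  have := Lagrange (subsetIl G 'N(V)); rewrite oG -[(4 * 15)%N]/60 => <-.
  by rewrite dvdn_mul // -oV cardSg // subsetI (pHall_sub sylV) normG.
pose T := [set g in G^# | #[g] %| 4].
have cT : (3 * #|'Syl_2(G)| <= #|T|)%N.
  rewrite mulnC -sum_nat_const.
  apply: (@leq_trans (\sum_(W in 'Syl_2(G)) \sum_(g in T) (g \in W : nat))).
    apply: leq_sum => W; rewrite inE => sylW; have oW := Sylow2_card sylW.
    have : #|W^#| = 3 by have := cardsD1 1 W; rewrite group1 oW add1n => -[<-].
    move=> <-; rewrite -sum1_card big_mkcond [X in _ <= X]big_mkcond /=.
    apply: leq_sum => g _; rewrite !inE; case: (g =P 1) => //= gn1.
    case Wg: (g \in W); rewrite ?if_same // (subsetP (pHall_sub sylW)) //=.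
    by rewrite -oW order_dvdG.
  rewrite exchange_big /= -sum1_card; apply: leq_sum => g; rewrite !inE => /andP[/andP[gn1 Gg] og].
  have [/existsP[W /andP[sW gW]] | /existsPn none] :=
    boolP [exists W : {group gT}, (W \in 'Syl_2(G)) && (g \in W)].
    rewrite (bigD1 W) //= gW big1 // => W' /andP[sW' nW]; case gW': (g \in W') => //.
    rewrite !inE in sW sW'; case/eqP: nW; apply: val_inj.
    by rewrite /= (Sylow2_TI sW' sW gW' gW gn1).
  by rewrite big1 // => W sW; have := none W; rewrite sW /= => /negPf->.
have d3 : 3 %| #|G| by rewrite oG.
have [u Gu ou] := Cauchy (isT : prime 3) d3.
have : #|T :|: u ^: G| <= #|G|.
  rewrite subset_leq_card // subUset class_subG ?subxx // andbT.
  by apply/subsetP=> g; rewrite !inE => /andP[/andP[]].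
rewrite cardsU (card_class3 Gu ou) (_ : T :&: _ = set0) ?cards0 ?subn0; last first.
  apply/setP=> g; rewrite in_set0; apply/negP=> /setIP[/[!inE] /andP[_ og]].
  by case/imsetP=> y _ Dg; rewrite Dg orderJ ou in og.
rewrite oG => le60; have le : (3 * #|'Syl_2(G)| + 20 <= 60)%N.
  by rewrite (leq_trans _ le60) // leq_add2r.
have := @all_divisors (fun m => [&& 5 %| m & 3 * m + 20 <= 60]%N ==> (m == 5))
  _ 15 isT d15 isT.
by rewrite d5 le => /eqP.
Qed.

(** A kernel element of order 2 would lie in all Sylow 2-subgroups, which meet
    trivially; one of order 3 has too many conjugates. *)
Lemma order60_isom_Alt5 :
  exists f : {morphism G >-> {perm 'I_5}}, 'injm f /\ f @* G = 'Alt_('I_5).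
Proof.
have actG : [acts G, on 'Syl_2(G) | 'JG] := atrans_acts (Syl_trans 2 G).
have [f kerf] := perm_representation actG card_Sylow2.
have [V sylV] := Sylow_exists 2 G; have VS : V \in 'Syl_2(G) by rewrite inE.
have oV := Sylow2_card sylV.
have KG : 'ker f \subset G by apply: subsetIl.
have KN (W : {group gT}) : W \in 'Syl_2(G) -> 'ker f \subset 'N_G(W).
  move=> WS; rewrite subsetI KG kerf; apply/subsetP=> k /setIP[_ /astabP/(_ W WS)].
  by move=> /(congr1 val) /= E; rewrite inE E.
have oN : #|'N_G(V)| = 12.
  have := Lagrange (subsetIl G 'N(V)); rewrite -(card_Syl sylV) card_Sylow2 oG => L.
  by apply/eqP; rewrite -(eqn_pmul2r (isT : 0 < 5)) L.
have dK : #|'ker f| %| 12 by rewrite -oN cardSg // KN.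
have n3K : ~~ (3 %| #|'ker f|).
  apply/negP=> /(Cauchy (isT : prime 3))[u Ku ou]; have Gu := subsetP KG u Ku.
  have : u ^: G \subset 'ker f by rewrite class_sub_norm // normal_norm ?ker_normal.
  by move/subset_leq_card/leq_trans/(_ (dvdn_leq (isT : 0 < 12) dK)); rewrite (card_class3 Gu ou).
have n2K : ~~ (2 %| #|'ker f|).
  apply/negP=> /(Cauchy (isT : prime 2))[k Kk ok].
  have kn1 : k != 1 by rewrite -order_gt1 ok.
  have kW (W : {group gT}) : W \in 'Syl_2(G) -> k \in W.
    move=> WS; have sylW : 2.-Sylow(G) W by rewrite inE in WS.
    have NW : k \in 'N_G(W) by rewrite (subsetP (KN W WS)).
    have WN : W <| 'N_G(W) by rewrite normal_subnorm // (pHall_sub sylW).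
    have sylWN : 2.-Sylow('N_G(W)) W by rewrite Sylow_subnorm.
    by rewrite (mem_normal_Hall sylWN WN NW) /p_elt ok.
  have : 'Syl_2(G) \subset [set V].
    apply/subsetP=> W WS; rewrite in_set1; apply/eqP/val_inj => /=.
    by have sylW := WS; rewrite inE in sylW; apply: (Sylow2_TI sylW sylV _ _ kn1); apply: kW.
  by move/subset_leq_card; rewrite card_Sylow2 cards1.
have K1 : 'ker f = 1.
  apply/eqP; rewrite trivg_card1.
  have := @all_divisors (fun m => ~~ (3 %| m) && ~~ (2 %| m) ==> (m == 1%N))
    _ 12 isT dK isT.
  by rewrite n3K n2K.
have injf : 'injm f by rewrite K1 subxx.
exists f; split=> //; apply: (@order60_Alt5 (f @* G)%G).
by rewrite /= card_injm.
Qed.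

End Icosahedral.

Section IcosahedralCase.
Variables (F : finFieldType) (X : {set PGL F}).
Hypotheses (ch : 3 \in [pchar F]%R) (rackX : fused_rack X).
Let G : {group PGL F} := <<X>>%G.
Variable z0 : option F.
Local Notation "'to" := (pgl_to_action F).
Hypotheses (cz0 : z0 \in centers G) (s3 : #|G :&: trans z0| = 3).
Hypotheses (N10 : #|centers G| = 10) (oG : #|G| = 60).

Let unipotent_order3 (u : PGL F) : unipotent u = (#[u] == 3).
Proof.
apply/idP/eqP=> [|ou]; first exact: unipotent_order ch.
exact: order_pchar_unipotent ch ou.
Qed.

Let cent3 u : u \in G -> #[u] = 3 -> #|'C_G[u]| = 3.
Proof.
move=> Gu ou; have := unipotent_order3 u; rewrite ou eqxx => uu.
have /unipotentP[v fv] := uu; have un1 := unipotent_neq1 uu.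
have uv : u \in G :&: trans v by rewrite !inE Gu fv eqxx orbT.
have cv : v \in centers G by apply/centersP; exists u.
by rewrite (cent1_unipotent uv un1) (card_trans_const ch cz0 cv).
Qed.

(** The 20 elements of order 3 form a single class, hence are all in [X]. *)
Lemma icosahedral_rackE : X = [set g in G | #[g] == 3].
Proof.
have [/set0Pn[u Xu] clX uniX _] := rackX; have XG : X \subset G by apply: subset_gen.
have Gu := subsetP XG u Xu; have uu := uniX u Xu.
have ou : #[u] = 3 by apply/eqP; rewrite -unipotent_order3.
have c20 : #|u ^: G| = 20.
  by rewrite -index_cent1 -divgS ?subsetIl // cent3 // oG.
have uX : u ^: G \subset X by rewrite class_sub_norm // closed_normJ.
have X3 : X \subset [set g in G | #[g] == 3].
  by apply/subsetP=> v Xv; rewrite inE (subsetP XG) //= -unipotent_order3 uniX.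
apply/eqP; rewrite eqEcard X3 /=; apply: leq_trans (subset_leq_card uX); rewrite c20.
have <- : (\sum_(g in G^#) unipotent g = 20)%N by rewrite (sum_unipotent ch cz0) s3 N10.
rewrite -sum1_card big_mkcond [X in _ <= X]big_mkcond /=; apply: leq_sum => g _.
rewrite in_setD1 inE; case Gg: (g \in G); rewrite ?andbF //= andbT.
rewrite -unipotent_order3; have [-> | gn1] := eqVneq g 1.
  by case: ifP => // /unipotent_neq1; rewrite eqxx.
by case: (unipotent g).
Qed.

(** An element of order 5 has at most two fixed points, which gives [q + 1] modulo
    5; an odd power of 3 is 2 or 3 modulo 5. *)
Lemma icosahedral_power q : #|F| = q -> power_of (3 ^ 2) q.
Proof.
move=> Fq; have := card_pprimeChar ch; rewrite -[#|pPrimeCharType ch|]/(#|F|) Fq.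
set m := logn _ _ => Dq.
have m0 : 0 < m by have := finNzRing_gt1 F; rewrite Fq Dq; case: (m); rewrite ?expn0.
suff em : ~~ odd m.
  exists m./2; last by rewrite -expnM mul2n Dq -{1}(odd_double_half m) (negPf em).
  by move: m0 em; case: (m) => [|[|]].
apply/negP=> om; have d5 : 5 %| #|G| by rewrite oG.
have [g Gg og] := Cauchy (isT : prime 5) d5.
have gn1 : g != 1 by rewrite -order_gt1 og.
have p5 : 5.-group <[g]> by rewrite /pgroup -orderE og.
have := @pgroup_fix_mod _ _ _ (pgl_to_action F) 5 <[g]>%G [set: option F] p5.
rewrite setTI afix_cycle ?inE // (_ : 'Fix_'to[g] = fixes g); last first.
  by apply/setP=> w; rewrite [RHS]inE -pgl_fix; apply/afix1P/eqP.
rewrite cardsT card_option Fq Dq => /(_ _); have := card_fixes_le2 gn1.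
have oE : m = (m./2.*2).+1 by rewrite -[LHS](odd_double_half m) om.
have : (3 ^ m %% 5 = 3) \/ (3 ^ m %% 5 = 2).
  rewrite oE expnS -mul2n expnM; elim: (m./2) => [|j]; first by left.
  rewrite (expnS (3 ^ 2)); move: ((3 ^ 2) ^ j)%N => y; rewrite -[(3 ^ 2)%N]/9; lia.
move=> H le2 /(_ _) E; have {}E : (3 ^ m).+1 = #|fixes g| %[mod 5].
  by apply: E; apply/actsP=> h _ w; rewrite !inE.
rewrite -addn1 -modnDml in E.
by case: H E => ->; move: le2; case: #|_| => [|[|[|]]].
Qed.

Lemma icosahedral_case p q : p = 3 -> #|F| = q ->
  exists (gT : finGroupType) (C : {set gT}),
    listed_rack p q C /\ rack_isom (@conj_op (PGL F)) (@conj_op gT) X C.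
Proof.
move=> p3 Fq; exists {perm 'I_5}, (three_cycles 'I_5); split.
  by apply: listed_A5_3cycles => //; rewrite p3; apply: icosahedral_power.
have [f [injf fG]] := order60_isom_Alt5 oG cent3.
have XG : X \subset G by apply: subset_gen.
have <- : f @: X = three_cycles 'I_5; last exact: rack_isom_morphism.
apply/setP=> s; rewrite order3_3cycle ?card_ord //; apply/imsetP/eqP=> [[g Xg ->]|os].
  have Gg := subsetP XG g Xg; rewrite (order_injm injf) //.
  by rewrite icosahedral_rackE inE in Xg; case/andP: Xg => _ /eqP.
have : s \in 'Alt_('I_5) by have /eqP := os; rewrite -order3_3cycle ?card_ord // inE => /andP[].
rewrite -fG => /morphimP[g _ Gg Ds]; exists g => //.
by rewrite icosahedral_rackE inE Gg -(order_injm injf) // -Ds os.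
Qed.

End IcosahedralCase.

(** * The classification of subracks *)

Section AbelianRacks.
Variables (F : finFieldType) (x : F).
Hypothesis xn0 : (x != 0)%R.
Implicit Types X : {set PGL F}.

(** Move the common fixed point [z] to infinity by an element of [PSL F]. *)
Lemma common_center_subset X z : X != set0 -> X \subset unip_orbit x ->
  X \subset trans z -> unip_subset_conjugate x X.
Proof.
move=> Xn0 Xx Xz; have [g gP gz] := pgl_trans1 z.
exists (X :^ g), g^-1; split; rewrite ?groupV ?conjsgK //.
  by have /set0Pn[u Xu] := Xn0; apply/set0Pn; exists (u ^ g); rewrite memJ_conjg.
apply/subsetP=> _ /imsetP[u Xu ->]; have ux := subsetP Xx u Xu.
have : u ^ g \in trans None.
  by rewrite -(pgl_actK g None) gz -transJ memJ_conjg (subsetP Xz).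
rewrite trans_inf => /imsetP[y _ Dy].
have ugx : unip y \in unip_orbit x.
  by rewrite -Dy memJ_norm // (subsetP (class_norm _ _)).
have yn0 : (y != 0)%R.
  apply/eqP=> y0; have := unip_orbit_unipotent xn0 ugx.
  by rewrite y0 unip0 => /unipotent_neq1; rewrite eqxx.
rewrite Dy; apply/imsetP; exists (y / x)%R; first by rewrite -unip_orbitP.
by rewrite divfK.
Qed.

Lemma unip_subset_conjugateP X :
  unip_subset_conjugate x X <->
  is_subrack (@conj_op (PGL F)) X (unip_orbit x) /\ abelian_rack (@conj_op (PGL F)) X.
Proof.
split=> [[S [g [Sn0 Ssub gP ->]]] | [[Xn0 Xx _] abX]]; last first.
  have /set0Pn[u Xu] := Xn0.
  have uu := unip_orbit_unipotent xn0 (subsetP Xx u Xu).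
  have /unipotentP[z fz] := uu; apply: (common_center_subset Xn0 Xx (z := z)).
  have uz : u \in trans z by rewrite inE fz eqxx orbT.
  apply/subsetP=> v Xv; apply: cent_unipotent uz (unipotent_neq1 uu) _.
  by have := abX u v Xu Xv; rewrite /conj_op /commute => {2}<-; rewrite mulgKV.
have abS : abelian_rack (@conj_op (PGL F)) (S :^ g).
  move=> _ _ /imsetP[u Su ->] /imsetP[v Sv ->].
  rewrite /conj_op -conjVg -!conjMg; congr (_ ^ g).
  have /imsetP[b _ ->] := subsetP Ssub u Su; have /imsetP[c _ ->] := subsetP Ssub v Sv.
  by rewrite -unipD addrC unipD mulgK.
split=> //; split.
- by have /set0Pn[u Su] := Sn0; apply/set0Pn; exists (u ^ g); rewrite memJ_conjg.
- apply/subsetP=> _ /imsetP[u Su ->]; have /imsetP[b sb ->] := subsetP Ssub u Su.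
  rewrite memJ_norm ?(subsetP (class_norm _ _)) //.
  by rewrite unip_orbitP ?mulf_neq0 ?(unit_squares_neq0 sb) // mulfK.
by move=> u v Xu Xv; rewrite abS.
Qed.

Lemma unip_subset_conjugate_card X : unip_subset_conjugate x X ->
  #|X| <= (#|F| - 1) %/ gcdn 2 (#|F| - 1).
Proof.
case=> S [g [_ Ssub _ ->]]; rewrite cardJg -card_unit_squares.
exact: leq_trans (subset_leq_card Ssub) (leq_imset_card _ _).
Qed.

End AbelianRacks.

Lemma centersJ (F : finFieldType) (G : {group PGL F}) h w :
  (w \in centers (G :^ h)%G) = (pgl_act h w \in centers G).
Proof.
apply/centersP/centersP=> [[u /setIP[Gu uw] un1]|[u /setIP[Gu uw] un1]].
  exists (u ^ h^-1); last by rewrite conjg_eq1.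
  by rewrite inE -mem_conjg Gu -[h in pgl_act h]invgK -transJ memJ_conjg.
exists (u ^ h); last by rewrite conjg_eq1.
by rewrite inE memJ_conjg Gu -[w](pgl_actK h) -transJ memJ_conjg.
Qed.

(** The three cases of [order_trichotomy], for the group generated by [X]. *)
Lemma fused_rack_listed (p q : nat) (F : finFieldType) (X : {set PGL F}) :
  p \in [pchar F]%R -> #|F| = q -> fused_rack X ->
  (exists z, X \subset trans z) \/
  exists (gT : finGroupType) (C : {set gT}),
    listed_rack p q C /\ rack_isom (@conj_op (PGL F)) (@conj_op gT) X C.
Proof.
move=> ch Fq rackX; have [Xn0 clX uniX fusX] := rackX.
pose G := generated_group X; have XG : X \subset G by apply: subset_gen.
have center_of u : u \in X -> exists2 v, u \in trans v & v \in centers G.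
  move=> Xu; have /unipotentP[v fv] := uniX u Xu.
  have uv : u \in trans v by rewrite inE fv eqxx orbT.
  exists v => //; apply/centersP; exists u; first by rewrite inE (subsetP XG).
  exact: unipotent_neq1 (uniX u Xu).
have /set0Pn[u Xu] := Xn0; have [z uz cz] := center_of u Xu.
have N0 : 0 < #|centers G| by apply/card_gt0P; exists z.
have [N1 | N1] := leqP #|centers G| 1.
  left; exists z; apply/subsetP=> v Xv; have [w vw cw] := center_of v Xv.
  suff <- : w = z by [].
  have /cards1P[y Dy] : #|centers G| == 1%N by rewrite eqn_leq N1 N0.
  by move: cw cz; rewrite Dy => /set1P-> /set1P->.
right; have [[E _]|[C [CG cC C1 pC oGC]]] := order_dichotomy ch cz.
  by rewrite E in N1.
have s1 := card_trans_gt1 cz; set s := #|_| in s1 oGC.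
have sN : s %| #|centers G|.-1 := card_trans_dvd_centers cz.
have ks := index_stab_dvd G z.
have oG : #|G| = (#|centers G| * (s * #|'C_G[z | pgl_to_action F] : G :&: trans z|))%N.
  by rewrite /s (Lagrange (trans_sub_stab G z)) -(card_G_centers ch cz).
have s_prime r : s = r -> prime r -> p = r.
  move=> sr r_pr; have := pgroup_trans G ch z; rewrite /pgroup -/s sr pnatE //.
  by rewrite inE => /eqP.
have [s2 | NE | [s3 N10 oG60]] := order_trichotomy s1 N1 ks sN oG oGC.
- have p2 : p = 2 by apply: (s_prime 2 s2).
  have oN : #|centers G| = #|C|.
    have k1 : #|'C_G[z | pgl_to_action F] : G :&: trans z| = 1%N.
      by move: ks; rewrite -/s s2 dvdn1 => /eqP.
    have := oGC; rewrite oG k1 s2 mul0n muln1 mulnC => /eqP.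
    by rewrite eqn_pmul2l // => /eqP.
  rewrite p2 in ch pC.
  apply: (dihedral_case ch rackX cz s2 CG cC _ C1 _ oN p2 Fq).
    by rewrite dvdn2 negbK in pC.
  by rewrite -/G oGC s2 mul0n.
- have /card_gt2P[P [Q [R [[cP cQ cR] [PQ QR RP]]]]] : 2 < #|centers G| by rewrite NE.
  have PR : P != R by rewrite eq_sym.
  have [h [hP hQ hR]] := pgl_trans3 PQ PR QR.
  have rackXh := fused_rackJ h rackX.
  have genE : generated_group (X :^ h) = (G :^ h)%G by apply: val_inj; rewrite /= genJ.
  have [] := subfield_case (p := p) ch rackXh _ _ _ _ Fq;
    rewrite -?/(generated_group _) ?genE ?centersJ ?hP ?hQ ?hR //.
    have -> : #|centers (G :^ h)| = #|centers G|.
      rewrite -(card_imset _ (@pgl_act_inj F h)); congr #|pred_of_set _|.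
      apply/setP=> w; apply/imsetP/idP=> [[v cv ->]|cw].
        by rewrite -centersJ.
      by exists (pgl_act h^-1 w); rewrite ?centersJ ?pgl_actKV.
    rewrite NE -[None](pgl_actK h) hP -transJ -conjIg cardJg.
    by rewrite (card_trans_const ch cz cP).
  move=> gT [D [listD isoD]]; exists gT, D; split=> //.
  by apply: rack_isom_trans (rack_isomJ X h) isoD.
have p3 : p = 3 by apply: (s_prime 3 s3).
rewrite p3 in ch.
exact: (icosahedral_case ch rackX cz s3 N10 oG60 p3 Fq).
Qed.

(** * Every listed rack occurs *)

Definition occurs (F : finFieldType) (x : F) (gT : finGroupType) (C : {set gT}) : Prop :=
  exists X : {set PGL F}, is_subrack (@conj_op (PGL F)) X (unip_orbit x) /\
    rack_isom (@conj_op (PGL F)) (@conj_op gT) X C.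

Lemma occurs_isom (F : finFieldType) (x : F) (gT rT : finGroupType)
    (C : {set gT}) (D : {set rT}) :
  occurs x C -> rack_isom (@conj_op gT) (@conj_op rT) C D -> occurs x D.
Proof. by case=> X [subX isoX] isoC; exists X; split=> //; apply: rack_isom_trans isoC. Qed.

(** All the classes [unip_orbit y] are conjugate in [PGL F], so it suffices to embed
    [C] in one of them. *)
Lemma occurs_morphism (F : finFieldType) (x y : F) (gT : finGroupType) (D : {group gT})
    (f : {morphism D >-> PGL F}) (C : {set gT}) :
  (x != 0)%R -> (y != 0)%R -> 'injm f -> C \subset D -> C != set0 ->
  {in C &, forall u v, conj_op u v \in C} -> f @: C \subset unip_orbit y -> occurs x C.
Proof.
move=> xn0 yn0 injf CD Cn0 clC fC.
have yxn0 : (y / x != 0)%R by rewrite mulf_neq0 ?invr_eq0.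
pose g : PGL F := mob (y / x) 0 0 1.
have orbE : unip_orbit y :^ g = unip_orbit x.
  by rewrite (unip_orbitJ y yxn0 (erefl g)) invf_div mulrC divfK.
have isoC : rack_isom (@conj_op gT) (@conj_op (PGL F)) C (f @: C :^ g).
  by apply: rack_isom_trans (rack_isomJ _ g); apply: rack_isom_morphism.
exists (f @: C :^ g); split; last exact: rack_isom_sym clC isoC.
have /set0Pn[c Cc] := Cn0; split.
- by apply/set0Pn; exists (f c ^ g); rewrite memJ_conjg imset_f.
- by rewrite -orbE conjSg.
move=> _ _ /imsetP[_ /imsetP[u Cu ->] ->] /imsetP[_ /imsetP[v Cv ->] ->].
have [Du Dv] := (subsetP CD u Cu, subsetP CD v Cv).
rewrite /conj_op -conjVg -!conjMg memJ_conjg -morphV // -!morphM ?groupM ?groupV //.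
by rewrite imset_f // clC.
Qed.

Lemma pgl_map_PSL (F K : finFieldType) (f : {rmorphism F -> K}) g :
  g \in PSL F -> pgl_map f g \in PSL K.
Proof.
have [a [b [c [d [nz ->]]]]] := mob_surj g; rewrite mob_PSL // => /imsetP[t /[!inE] tn0 D].
rewrite pgl_map_mob // mob_PSL ?det_map // -!rmorphM -rmorphB D rmorphXn.
by rewrite unit_squares_sq ?fmorph_eq0.
Qed.

Lemma unipotent_class_orbit (F : finFieldType) (C : {set PGL F}) :
  unipotent_class (PSL F) C -> exists2 b : F, (b != 0)%R & C = unip_orbit b.
Proof.
case=> /imsetP[c _ ->] uniC.
have : unipotent c by apply/eqP/uniC/class_refl.
case/unipotent_orbit=> b bn0 cb; exists b => //.
by rewrite /unip_orbit (class_eqP cb).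
Qed.

Lemma class_closed (gT : finGroupType) (G : {group gT}) c : c \in G ->
  {in c ^: G &, forall u v, conj_op u v \in c ^: G}.
Proof.
move=> Gc; apply: norm_closed; apply: subset_trans (class_norm c G).
by rewrite class_subG // subxx.
Qed.

Lemma occurs_PSL (F F0 : finFieldType) (x : F) (C : {set PGL F0}) :
  (x != 0)%R -> power_of #|F0| #|F| -> unipotent_class (PSL F0) C -> occurs x C.
Proof.
move=> xn0 [k k0 cF] /unipotent_class_orbit[b bn0 ->].
have [f _] := finField_embed k0 cF.
apply: (@occurs_morphism _ x (f b) _ _ (pgl_map_morphism f)) => //.
- by rewrite fmorph_eq0.
- exact: pgl_map_inj.
- by rewrite subsetT.
- by apply/set0Pn; exists (unip b); apply: class_refl.
- by apply: class_closed; rewrite (subsetP (unip_orbit_sub b)) ?class_refl.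
apply/subsetP=> _ /imsetP[_ /imsetP[h hP ->] ->].
by rewrite /= pgl_mapJ pgl_map_unip memJ_class // pgl_map_PSL.
Qed.

(** Elements of a subfield of even index are squares, by Euler's criterion. *)
Lemma subfield_square (F F0 : finFieldType) (f : {rmorphism F0 -> F}) (b : F0) k :
  odd #|F| -> #|F| = ((#|F0| ^ 2) ^ k)%N -> (b != 0)%R -> f b \in unit_squares F.
Proof.
move=> oF cF bn0; rewrite euler_square ?fmorph_eq0 // -rmorphXn.
have /dvdnP[h Dh] := dvdn_pred_predX (#|F0| ^ 2) k; rewrite -cF in Dh.
have oF0 : odd #|F0|.
  move: oF; rewrite cF -expnM oddX => /orP[|//]; rewrite muln_eq0 /=.
  by case: (k) Dh cF => // _ cF; have := finNzRing_gt1 F; rewrite cF.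
have [j Dj] : exists j, #|F0| = j.*2.+1.
  by exists #|F0|./2; rewrite -{1}(odd_double_half #|F0|) oF0.
have E : (#|F|.-1)./2 = (#|F0|.-1 * (h * j.+1))%N.
  apply: double_inj; rewrite odd_half_pred // Dh Dj -!muln2 expnS expn1 /=; nia.
by rewrite E exprM expf_card1 // expr1n rmorph1.
Qed.

Lemma occurs_PGL (F F0 : finFieldType) (x : F) :
  (x != 0)%R -> odd #|F| -> power_of (#|F0| ^ 2) #|F| ->
  occurs x (unip (1 : F0)%R ^: [set: PGL F0]).
Proof.
move=> xn0 oF [k k0 cF]; have k2 : 0 < 2 * k by rewrite muln_gt0.
have [f _] : exists f : {rmorphism F0 -> F}, injective f.
  by apply: (finField_embed k2); rewrite expnM.
apply: (@occurs_morphism _ x 1%R _ _ (pgl_map_morphism f)) => //.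
- exact: oner_neq0.
- exact: pgl_map_inj.
- by rewrite subsetT.
- by apply/set0Pn; exists (unip 1%R); apply: class_refl.
- by apply: class_closed; rewrite inE.
apply/subsetP=> _ /imsetP[u + ->]; rewrite PGL_classP => /unipotent_conj[h [b [hP bn0 ->]]].
rewrite /= pgl_mapJ pgl_map_unip memJ_norm; last first.
  by apply: subsetP (class_norm _ _) _ _; apply: pgl_map_PSL.
by rewrite unip_orbitP ?oner_neq0 ?fmorph_eq0 // divr1 (subfield_square _ oF cF).
Qed.

(** The image of [F] already contains [#|F|] roots of [X ^ #|F| - X]. *)
Lemma fixed_in_image (F K : finFieldType) (f : {rmorphism F -> K}) (y : K) :
  (y ^+ #|F| = y)%R -> exists t, f t = y.
Proof.
move=> yq; have : root (map_poly f ('X^#|F| - 'X))%R y.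
  by rewrite rmorphB /= map_polyXn map_polyX rootE !hornerE yq subrr.
rewrite finField_genPoly rmorph_prod /= (eq_bigr (fun t => 'X - (f t)%:P)%R); last first.
  by move=> t _; rewrite rmorphB /= map_polyX map_polyC.
rewrite -(big_map f xpredT (fun t => 'X - t%:P)%R) root_prod_XsubC.
by case/mapP=> t _ ->; exists t.
Qed.

Section CharTwo.
Variables (F : finFieldType) (x : F).
Hypotheses (ch : 2 \in [pchar F]%R) (xn0 : (x != 0)%R).

Lemma card_char2_even : ~~ odd #|F|.
Proof.
have := card_pprimeChar ch; rewrite -[#|pPrimeCharType ch|]/(#|F|) => cF.
rewrite cF oddX /= orbF; apply/negP=> /eqP E; rewrite E expn0 in cF.
by have := finNzRing_gt1 F; rewrite cF.
Qed.

(** In characteristic 2 involutions are unipotent, and all unipotents of [PGL F] form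
    a single class of [PSL F], as every element of [F] is a square. *)
Lemma occurs_involutions (gT : finGroupType) (G : {group gT}) (D : {group PGL F}) :
  G \isog D -> 2 %| #|G| -> occurs x (involutions G).
Proof.
case/isogP=> f injf fG /(Cauchy (isT : prime 2))[t Gt ot].
have IG : involutions G \subset G by apply/subsetP=> u; rewrite inE => /andP[].
apply: (@occurs_morphism _ x x _ _ f) => //.
- by apply/set0Pn; exists t; rewrite inE Gt ot.
- apply: norm_closed; apply: subset_trans IG _; apply/subsetP=> g Gg; rewrite inE.
  by apply/subsetP=> _ /imsetP[u /[!inE] /andP[Gu ou] ->]; rewrite groupJ //= orderJ.
apply/subsetP=> _ /imsetP[u /[!inE] /andP[Gu /eqP ou] ->].
have : unipotent (f u) by apply: order_pchar_unipotent ch _; rewrite order_injm.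
case/unipotent_conj=> h [b [hP bn0 ->]].
rewrite memJ_norm; last by apply: subsetP (class_norm _ _) _ _.
by rewrite unip_orbitP // even_unit_squares ?card_char2_even // mulf_neq0 ?invr_eq0.
Qed.

(** The dihedral group of order [2n] inside [PGL F]: a rotation with eigenvalues
    [z] and [z^-1], for an [n]-th root of unity [z] in the quadratic extension,
    conjugated to its inverse by exchanging the coordinates. *)
Lemma dihedral_exists n : 1 < n -> (n %| #|F| - 1) || (n %| #|F| + 1) ->
  exists D : {group PGL F}, is_dihedral n D /\ #|D| = n.*2.
Proof.
move=> n1 dn; have q1 := finNzRing_gt1 F.
have oddn : odd n.
  have oq : odd (#|F| - 1) && odd (#|F| + 1).
    by rewrite oddB ?(ltnW q1) // oddD (negPf card_char2_even).
  by case/andP: oq => o1 o2; case/orP: dn => d; apply: dvdn_odd d _.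
have [K chK cK] : exists2 K : finFieldType, 2 \in [pchar K]%R & #|K| = (#|F| ^ 2)%N.
  have := card_pprimeChar ch; rewrite -[#|pPrimeCharType ch|]/(#|F|); set e := logn _ _ => cF.
  have e0 : 0 < e * 2.
    rewrite muln_gt0 andbT lt0n; apply: contraTneq q1 => E.
    by rewrite cF E.
  by have [K chK cK] := pPrimePowerField (isT : prime 2) e0; exists K; rewrite // cF -expnM.
have [f _] := finField_embed (isT : 0 < 2) cK.
have [g [gn0 pg gP]] := finField_prim_root K.
have qq : #|K|.-1 = ((#|F| - 1) * (#|F| + 1))%N by rewrite cK; nia.
have nK : n %| #|K|.-1.
  by rewrite qq; case/orP: dn => d; [apply: dvdn_mulr | apply: dvdn_mull].
have pz := dvdn_prim_root pg nK; set z := (g ^+ _)%R in pz.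
have zn0 : (z != 0)%R by rewrite expf_neq0.
have zX i : (z ^+ i == 1)%R = (n %| i) by rewrite (prim_order_dvd pz).
have two0 : (2%:R = 0 :> K)%R by rewrite (pcharf0 chK).
have [tau Dtau] : exists tau, (f tau = z + z^-1)%R.
  apply: fixed_in_image; rewrite exprDn_pchar; last first.
    have := card_pprimeChar ch; rewrite -[#|pPrimeCharType ch|]/(#|F|) => ->.
    by rewrite pnatX pnatE // chK.
  have zq1 : (n %| #|F| - 1) -> (z ^+ #|F| = z)%R.
    by rewrite -zX => /eqP E; rewrite -[in LHS](subnK (ltnW q1)) addn1 exprS E mulr1.
  have zq2 : (n %| #|F| + 1) -> (z ^+ #|F| = z^-1)%R.
    by rewrite -zX addn1 exprS => /eqP E; apply: (mulfI zn0); rewrite E divff.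
  rewrite exprVn; case/orP: dn => [/zq1->|/zq2->] //.
  by rewrite invrK addrC.
have nzc : (0 * tau - 1 * 1 != 0 :> F)%R by rewrite mul0r sub0r mulr1 oppr_eq0 oner_neq0.
have nzt : (0 * 0 - 1 * 1 != 0 :> F)%R by rewrite mul0r sub0r mulr1 oppr_eq0 oner_neq0.
pose c : PGL F := mob 0 1 1 tau; pose t : PGL F := mob 0 1 1 0.
have oc : #[c] = n.
  have nzP : (1 * z^-1 - 1 * z != 0)%R.
    rewrite !mul1r subr_eq0 eq_sym -(inj_eq (mulfI zn0)) divff // -expr2 zX.
    by apply/negP=> /(dvdn_leq (isT : 0 < 2)); move: n1 oddn; case: (n) => [|[|[|]]].
  have nzd : (z * z^-1 - 0 * 0 != 0)%R by rewrite divff // mul0r subr0 oner_neq0.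
  have nzM : (0 * (z + z^-1) - 1 * 1 != 0)%R.
    by rewrite mul0r sub0r mulr1 oppr_eq0 oner_neq0.
  have conj : pgl_map f c * mob 1 1 z z^-1 = mob 1 1 z z^-1 * mob z 0 0 z^-1.
    rewrite pgl_map_mob // rmorph0 rmorph1 Dtau !mobM //.
    apply: mob_eq; rewrite ?mul0r ?mulr0 ?addr0 ?add0r ?mul1r ?mulr1 //.
      by rewrite mulrDl mulVf // addrC -addrA -[(1 + 1)%R]/(2%:R)%R two0 addr0.
    by rewrite mulrDl divff // addrA -[(1 + 1)%R]/(2%:R)%R two0 add0r.
  have dX i : mob (z ^+ 2) 0 0 1 ^+ i = mob (z ^+ (2 * i)) 0 0 1.
    elim: i => [|i IH]; first by rewrite expg0 muln0 expr0 mob1.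
    rewrite expgS IH mobM ?det_aff ?expf_neq0 //.
    by apply: mob_eq; rewrite ?mulnS ?exprD; ring.
  have Dd : mob z 0 0 z^-1 = mob (z ^+ 2) 0 0 1.
    rewrite -[RHS](@mobZ _ z^-1%R) ?invr_eq0 ?det_aff ?expf_neq0 //.
    by apply: mob_eq; rewrite ?mulr0 ?mulr1 // expr2 mulKf.
  have <- : #[mob (z ^+ 2) 0 0 1] = n.
    apply/eqP; rewrite eqn_dvd; apply/andP; split.
      by rewrite order_dvdn dX aff_eq1 ?expf_neq0 // eqxx andbT zX dvdn_mull.
    have := expg_order (mob (z ^+ 2) 0 0 1); rewrite dX => /eqP.
    by rewrite aff_eq1 ?expf_neq0 // eqxx andbT zX Gauss_dvdr // coprimen2.
  rewrite -(order_injm (pgl_map_inj f)) ?inE // -Dd -[RHS](orderJ _ (mob 1 1 z z^-1)^-1).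
  by rewrite conjgE invgK mulgA -conj mulgK.
have ot : #[t] = 2.
  apply: (prime_nt_dvdP (isT : prime 2)).
    rewrite order_eq1; apply/eqP=> t1; have := act_inf nzt.
    by rewrite -/t t1 pgl_act1 /pt oner_eq0.
  rewrite order_dvdn expgS expg1 mobM //; apply/eqP; rewrite -[RHS]mob1.
  by apply: mob_eq; ring.
have tc : c ^ t = c^-1.
  have m1 : (-1 = 1 :> F)%R by rewrite (oppr_pchar2 ch).
  rewrite mobV // conjgE.
  have -> : t^-1 = t by rewrite mobV // m1.
  rewrite mobM // mobM //; last first.
    by rewrite (_ : (_ - _)%R = 1%R) ?oner_neq0 //; ring.
  by rewrite m1; apply: mob_eq; ring.
have cn1 : c != 1 by rewrite -order_gt1 oc.
have otc : #[t * c] = 2.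
  apply: (prime_nt_dvdP (isT : prime 2)).
    rewrite order_eq1 -eq_invg_mul; apply/eqP=> E.
    by have := oc; rewrite -E orderV ot => E2; rewrite -E2 in oddn.
  have tt : t * t = 1 by have := expg_order t; rewrite ot.
  rewrite order_dvdn expgS expg1.
  have -> : t * c * (t * c) = t * t * c ^ t * c.
    by rewrite mulgA -(mulgA t c t) (conjgC c t) !mulgA.
  by rewrite tc tt mul1g mulVg.
have ttc : t != t * c by rewrite -[t in X in X != _]mulg1 (inj_eq (mulgI t)) eq_sym.
have DE : generated_group [set t; t * c] = (<[c]> <*> <[t]>)%G.
  apply/val_inj/eqP; rewrite /= eqEsubset gen_subG subUset !sub1set join_subG !cycle_subG.
  have tJ : t \in <[c]> <*> <[t]> by rewrite mem_gen // inE cycle_id orbT.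
  have cJ : c \in <[c]> <*> <[t]> by rewrite mem_gen // inE cycle_id.
  rewrite tJ groupM //=; set H := generated_group [set t; t * c].
  have tH : t \in H by rewrite mem_gen ?set21.
  by rewrite tH andbT -(groupMl _ tH) mem_gen ?set22.
have oD : #|generated_group [set t; t * c]| = n.*2.
  rewrite DE /= norm_joinEr; last by rewrite cycle_subG inE -cycleJ tc cycleV.
  rewrite TI_cardMg -?orderE ?oc ?ot ?muln2 // coprime_TIg //.
  by rewrite -!orderE oc ot coprimen2.
exists (generated_group [set t; t * c]); split=> //.
exact: involutions_is_dihedral ot otc ttc _ oD.
Qed.

(** For [n = 1] the group has order 2, and is realised by the one generated by
    [unip x]. *)
Lemma occurs_dihedral n (gT : finGroupType) (G : {group gT}) :
  (n %| #|F| - 1) || (n %| #|F| + 1) -> is_dihedral n G -> occurs x (involutions G).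
Proof.
move=> dn dihG; have q1 := finNzRing_gt1 F.
have n0 : 0 < n.
  by case: n dn {dihG} => //; rewrite !dvd0n subn_eq0 addn1 leqNgt q1.
have homG := isoGrp_hom dihG.
have [n1 | n1] := leqP n 1; last first.
  have [D [dihD oD]] := dihedral_exists n1 dn.
  have homD := isoGrp_hom dihD.
  have iso : G \isog D by rewrite isogEhom dihD homG dihG homD.
  by apply: (occurs_involutions iso); rewrite (card_isog iso) oD -muln2 dvdn_mull.
have Dn : n = 1%N by apply/eqP; rewrite eqn_leq n1.
have u1 : #[unip x] = 2 by apply: unipotent_order; rewrite ?unipotent_unip.
have homu : <[unip x]> \homg G.
  rewrite dihG Dn; apply/existsP; exists (1, unip x); rewrite /= !xpair_eqE.
  rewrite expg1n conj1g invg1 !eqxx /= cycle1 joing1G eqxx /=.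
  by rewrite -order_dvdn u1.
have cG : #|G| <= 2.
  have /existsP[[y z] /=] := homG; rewrite Dn !xpair_eqE => /and4P[/eqP <- /eqP y1 z2 _].
  by rewrite expg1 in y1; rewrite y1 cycle1 joing1G -orderE dvdn_leq // order_dvdn.
have iso : <[unip x]> \isog G by rewrite isogEcard homu -orderE u1.
by apply: (@occurs_involutions _ G <[unip x]>%G); rewrite ?(isog_sym G) -?(card_isog iso) -?orderE ?u1.
Qed.

End CharTwo.

(** * The alternating groups on four and five letters *)

Section SmallFields.
Variable F0 : finFieldType.

(** The action on the projective line is faithful. *)
Lemma pgl_perm_rep n : #|F0| = n ->
  exists f : {morphism [set: PGL F0] >-> {perm 'I_n.+1}}, 'injm f.
Proof.
move=> cF0; have actT : [acts [set: PGL F0], on [set: option F0] | pgl_to_action F0].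
  by apply/actsP=> g _ w; rewrite !inE.
have cT : #|[set: option F0]| = n.+1 by rewrite cardsT card_option cF0.
have [f kerf] := perm_representation actT cT; exists f; rewrite kerf.
apply/subsetP=> g /setIP[_ /astabP fixg]; rewrite in_set1; apply/eqP.
by apply: fix_std; apply/eqP; rewrite -pgl_fix; apply/eqP/fixg.
Qed.

Lemma centers_PGL : centers [set: PGL F0]%G = setT.
Proof.
apply/setP=> z; rewrite in_setT; apply/centersP.
have : 1 < #|trans z| by rewrite card_trans finNzRing_gt1.
by rewrite cardG_gt1 => /trivgPn[u uz un1]; exists u; rewrite // in_setI in_setT.
Qed.

Lemma card_unipotents : #|[set u : PGL F0 | unipotent u]| = (#|F0|.+1 * #|F0|.-1)%N.
Proof.
have [p _ ch] := finPcharP F0.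
have cz : None \in centers [set: PGL F0]%G by rewrite centers_PGL in_setT.
have := sum_unipotent ch cz; rewrite centers_PGL cardsT card_option setTI card_trans => <-.
rewrite -sum1_card big_mkcond [RHS]big_mkcond /=; apply: eq_bigr => u _.
rewrite !inE andbT; have [-> | un1] := eqVneq u 1.
  by case: ifP => // /unipotent_neq1; rewrite eqxx.
by case: (unipotent u).
Qed.

Lemma card_PGL : #|[set: PGL F0]| = (#|F0|.+1 * (#|F0| * #|F0|.-1))%N.
Proof.
have [p _ ch] := finPcharP F0.
have cz : None \in centers [set: PGL F0]%G by rewrite centers_PGL in_setT.
rewrite (card_G_centers ch cz) centers_PGL cardsT card_option; congr (_ * _)%N.
pose A := setX [set a : F0 | a != 0%R] [set: F0].
have -> : 'C_([set: PGL F0])[None | pgl_to_action F0] =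
    [set mob ab.1 ab.2 0 1 | ab in A].
  apply/setP=> g; rewrite stabE in_setT /=; apply/eqP/imsetP=> [/stab_inf[a [b [an0 ->]]]|].
    by exists (a, b); rewrite // !inE an0.
  by case=> [[a b]] /setXP[/= /[!inE] an0 _] ->; rewrite act_aff_inf.
rewrite card_in_imset => [|[a b] [c d]].
  by rewrite cardsX cardsT mulnC cardsE (cardC1 (0%R : F0)).
move=> /setXP[an0 _] /setXP[cn0 _] E; rewrite !inE /= in an0 cn0 E.
have := act_aff b 0%R an0; rewrite E act_aff // !mulr0 !add0r => -[db].
have := act_aff b 1%R an0; rewrite E act_aff // !mulr1 db => -[/addIr ca].
by rewrite ca.
Qed.

Lemma pgl_rep_onto n (f : {morphism [set: PGL F0] >-> {perm 'I_n.+1}}) :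
  'injm f -> #|[set: PGL F0]| = (n.+1)`! -> forall s, exists u, f u = s.
Proof.
move=> injf cG s; suff : s \in f @* [set: PGL F0] by case/morphimP=> u _ _ ->; exists u.
suff -> : f @* [set: PGL F0] = setT by rewrite in_setT.
apply/eqP; rewrite eqEcard subsetT card_injm // cG cardsT.
have := @card_Sym 'I_n.+1; rewrite card_ord => <-.
by apply: eq_leq; apply: eq_card => t; rewrite !inE.
Qed.

End SmallFields.

Section CharThree.
Variables (F0 : finFieldType).
Hypotheses (cF0 : #|F0| = 3).

Let ch0 : 3 \in [pchar F0]%R. Proof. exact: (@card_finPcharP _ 3 1). Qed.

Variable f : {morphism [set: PGL F0] >-> {perm 'I_4}}.
Hypothesis injf : 'injm f.

Let order_f u : #[f u] = #[u]. Proof. by rewrite (order_injm injf) ?in_setT. Qed.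

Let onto s : exists u, f u = s.
Proof. by apply: pgl_rep_onto; rewrite // card_PGL cF0. Qed.

Let f_cycle u : (f u \in three_cycles 'I_4) = unipotent u.
Proof.
rewrite order3_3cycle ?card_ord // order_f; apply/eqP/idP.
  exact: order_pchar_unipotent ch0.
exact: unipotent_order ch0.
Qed.

(** Both sides consist of the elements of order 3. *)
Lemma three_cycles_image : f @: (unip (1 : F0)%R ^: [set: PGL F0]) = three_cycles 'I_4.
Proof.
apply/setP=> s; have [u Du] := onto s; rewrite -Du f_cycle.
apply/imsetP/idP=> [[v]|uu]; last by exists u; rewrite // PGL_classP.
rewrite PGL_classP => uv E; suff -> : u = v by [].
by apply: (injmP injf); rewrite ?in_setT.
Qed.

(** [PSL(2,3)] is generated by its unipotents, of order 3, so acts by even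
    permutations; its order divides 12 and exceeds 8, the number of unipotents. *)
Lemma PSL3_image : f @* PSL F0 = 'Alt_('I_4).
Proof.
have sub : f @* PSL F0 \subset 'Alt_('I_4).
  apply/subsetP=> _ /morphimP[u _ uP ->].
  have /subsetP/(_ u uP) : PSL F0 \subset f @*^-1 'Alt_('I_4).
    have unipA v : unipotent v -> f v \in 'Alt_('I_4).
      by rewrite -f_cycle inE => /andP[].
    apply: PSL_generated => [b|c]; rewrite mem_morphpre ?in_setT //.
      have [-> | bn0] := eqVneq b 0%R; last by rewrite unipA ?unipotent_unip.
      by rewrite unip0 morph1 group1.
    have [-> | cn0] := eqVneq c 0%R; first by rewrite mob1 morph1 group1.
    rewrite unipA //.
    have nzw : (0 * 0 - 1 * 1 != 0 :> F0)%R.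
      by rewrite mul0r sub0r mulr1 oppr_eq0 oner_neq0.
    suff -> : mob 1 0 c 1 = unip c ^ (mob 0 1 1 0) by rewrite unipotentJ unipotent_unip.
    apply: (mulgI (mob 0 1 1 0)); rewrite -conjgC unipE !mobM ?det_unip //.
      by apply: mob_eq; ring.
    by rewrite mul0r subr0 mulr1 oner_neq0.
  by case/morphpreP.
apply/eqP; rewrite eqEcard sub /=.
have c12 : #|'Alt_('I_4)| = 12.
  have := @card_Alt 'I_4; rewrite card_ord => /(_ isT) E.
  by apply/eqP; rewrite -(eqn_pmul2l (isT : 0 < 2)) E.
have d12 : #|f @* PSL F0| %| 12 by rewrite -c12 cardSg.
have gt8 : 8 < #|f @* PSL F0|.
  rewrite card_injm ?subsetT //.
  have := card_unipotents F0; rewrite cF0 => c8.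
  have : 1 |: [set u : PGL F0 | unipotent u] \subset PSL F0.
    rewrite subUset sub1set group1 /=; apply/subsetP=> u; rewrite inE.
    case/unipotent_conj=> h [b [hP _ ->]]; rewrite groupJ //.
    by rewrite (subsetP (unip_orbit_sub b)) // unip_orbit_refl.
  have n1 : unipotent (1 : PGL F0) = false.
    by apply/negP=> /unipotent_neq1; rewrite eqxx.
  by move/subset_leq_card; rewrite cardsU1 c8 inE n1.
rewrite c12; have := @all_divisors (fun m => (8 < m) ==> (12 <= m)) _ 12 isT d12 isT.
by rewrite gt8.
Qed.

Lemma A4_class_image (C : {set {perm 'I_4}}) :
  C \in classes 'Alt_('I_4) -> C \subset three_cycles 'I_4 ->
  exists D : {set PGL F0}, unipotent_class (PSL F0) D /\ f @: D = C.
Proof.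
case/imsetP=> c Ac -> Csub; have [u Du] := onto c.
have uu : unipotent u by rewrite -f_cycle Du (subsetP Csub) ?class_refl.
have uP : u \in PSL F0.
  case/unipotent_conj: uu => h [b [hP _ ->]]; rewrite groupJ //.
  by rewrite (subsetP (unip_orbit_sub b)) // unip_orbit_refl.
exists (u ^: PSL F0); split.
  split; first by rewrite mem_classes.
  by move=> v /imsetP[h _ ->]; apply/eqP; rewrite -[_ == _]/(unipotent _) unipotentJ.
rewrite -Du -PSL3_image; apply/setP=> s; apply/imsetP/imsetP.
  case=> _ /imsetP[h hP ->] ->; exists (f h); first by rewrite mem_morphim ?in_setT.
  by rewrite morphJ ?in_setT.
case=> _ /morphimP[h _ hP ->] ->; exists (u ^ h); first exact: memJ_class.
by rewrite morphJ ?in_setT.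
Qed.

End CharThree.

Section OccursAlternating.
Variables (F : finFieldType) (x : F).
Hypothesis xn0 : (x != 0)%R.

Lemma finField3_exists : exists F0 : finFieldType, #|F0| = 3.
Proof. by exists 'F_3; rewrite card_Fp. Qed.

Lemma occurs_A4_class (C : {set {perm 'I_4}}) : power_of 3 #|F| ->
  C \in classes 'Alt_('I_4) -> C \subset three_cycles 'I_4 -> occurs x C.
Proof.
move=> powF CA C3; have [F0 cF0] := finField3_exists.
have [f injf] := pgl_perm_rep cF0.
have [D [uniD <-]] := A4_class_image cF0 injf CA C3.
apply: occurs_isom (rack_isom_morphism injf (subsetT D)).
by apply: occurs_PSL; rewrite ?cF0.
Qed.

Lemma occurs_A4_3cycles : power_of (3 ^ 2) #|F| -> occurs x (three_cycles 'I_4).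
Proof.
move=> powF; have [F0 cF0] := finField3_exists.
have [f injf] := pgl_perm_rep cF0.
rewrite -(three_cycles_image cF0 injf).
apply: occurs_isom (rack_isom_morphism injf (subsetT _)).
apply: occurs_PGL; rewrite ?cF0 //.
by have [k _ ->] := powF; rewrite oddX orbT.
Qed.

(** [PGL(2,4)] has order 60 and acts faithfully on five points. *)
Lemma occurs_A5_involutions : 2 \in [pchar F]%R -> power_of 4 #|F| ->
  occurs x (involutions 'Alt_('I_5)).
Proof.
move=> ch [k k0 cF]; have [F0 _ cF0] := pPrimePowerField (isT : prime 2) (isT : 0 < 2).
have [f injf] := pgl_perm_rep cF0.
have cG : #|f @* [set: PGL F0]| = 60 by rewrite card_injm // card_PGL cF0.
have fG : f @* [set: PGL F0] = 'Alt_('I_5) := order60_Alt5 (H := f @* [set: PGL F0]) cG.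
have [g _] : exists g : {rmorphism F0 -> F}, injective g.
  by apply: (finField_embed k0); rewrite cF0.
have iso1 : [set: PGL F0] \isog 'Alt_('I_5) by rewrite -fG sub_isog.
have iso2 : [set: PGL F0] \isog pgl_map_morphism g @* [set: PGL F0].
  by rewrite sub_isog // pgl_map_inj.
apply: (@occurs_involutions _ x ch xn0 _ 'Alt_('I_5)%G (pgl_map_morphism g @* [set: PGL F0])%G).
  by apply: isog_trans iso2; rewrite isog_sym.
by rewrite -(card_isog iso1) card_PGL cF0.
Qed.

End OccursAlternating.

(** * The 3-cycles on five letters *)

Section Transvections.
Variable F : finFieldType.
Implicit Types (a b c d x y : F).

(** The transvection with axis spanned by the vector [(a, b)]: it maps [w] to
    [w - det (v, w) v]. *)
Definition transvec a b : PGL F :=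
  mob (1 + a * b) (- a ^+ 2) (b ^+ 2) (1 - a * b).
Arguments transvec (a b)%_R.

Lemma transvec_det a b :
  ((1 + a * b) * (1 - a * b) - (- a ^+ 2) * b ^+ 2 != 0 :> F)%R.
Proof. by rewrite (_ : (_ - _)%R = 1%R) ?oner_neq0 //; ring. Qed.

Lemma transvec_eq a b a' b' : a = a' -> b = b' -> transvec a b = transvec a' b'.
Proof. by move=> -> ->. Qed.

Lemma transvecN a b : transvec (- a) (- b) = transvec a b.
Proof. by apply: mob_eq; ring. Qed.

Lemma transvec_unip : transvec 1 0 = unip (-1)%R.
Proof. by rewrite unipE; apply: mob_eq; ring. Qed.

Lemma transvecJ a b c d x y : (a * d - b * c = 1)%R ->
  conj_op (mob a b c d) (transvec x y) = transvec (a * x + b * y)%R (c * x + d * y)%R.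
Proof.
move=> D; have nz : (a * d - b * c != 0)%R by rewrite D oner_neq0.
have D' : (b * c = a * d - 1)%R by rewrite -D opprB addrC subrK.
apply: (mulIg (mob a b c d)); rewrite /conj_op mulgKV !mobM ?transvec_det //.
by apply: mob_eq; ring: D'.
Qed.

Lemma special_column a b : (a != 0)%R || (b != 0)%R ->
  exists c d, (a * d - c * b = 1)%R.
Proof.
have [-> /= bn0 | an0 _] := eqVneq a 0%R; last first.
  by exists 0%R, a^-1%R; rewrite mul0r subr0 divff.
by exists (- b^-1)%R, 0%R; rewrite mul0r sub0r mulNr opprK mulVf.
Qed.

(** [transvec 1 0] is [unip (-1)], and the matrix of determinant 1 with columns
    [(a, b)] and [(c, d)] maps [(1, 0)] to [(a, b)]. *)
Lemma transvec_conj a b c d : (a * d - c * b = 1)%R ->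
  transvec a b = unip (-1)%R ^ (mob a c b d)^-1.
Proof.
move=> D; rewrite -transvec_unip conjgE invgK mulgA -[RHS]/(conj_op _ _) transvecJ //.
by rewrite !mulr1 !mulr0 !addr0.
Qed.

Lemma transvec_orbit a b : (a != 0)%R || (b != 0)%R ->
  transvec a b \in unip_orbit (-1 : F)%R.
Proof.
case/special_column=> c [d D]; rewrite (transvec_conj D) memJ_class // groupV.
by rewrite mob_PSL D ?oner_neq0 // -(expr1n _ 2) unit_squares_sq ?oner_neq0.
Qed.

Lemma fixes_transvec a b : (a != 0)%R || (b != 0)%R -> fixes (transvec a b) = [set pt a b].
Proof.
case/special_column=> c [d D]; rewrite (transvec_conj D) fixesJ invgK.
rewrite fixes_unip ?oppr_eq0 ?oner_neq0 // imset_set1 act_inf //.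
by rewrite D oner_neq0.
Qed.

Lemma pt_det a b x y : (a != 0)%R || (b != 0)%R -> (x != 0)%R || (y != 0)%R ->
  pt a b = pt x y -> (a * y - b * x = 0)%R.
Proof.
rewrite /pt; have [-> | bn0] := eqVneq b 0%R; have [-> | yn0] := eqVneq y 0%R => //= _ _.
  by rewrite mulr0 mul0r subrr.
by case=> E; rewrite -[a](divfK bn0) E; field.
Qed.

End Transvections.

(** The field with 9 elements, as pairs [(x, y)] standing for [x + y i] and reduced
    modulo 3, so that closure of the explicit set below is checked by computation. *)
Definition gauss := (nat * nat)%type.
Definition gadd (u v : gauss) : gauss := ((u.1 + v.1) %% 3, (u.2 + v.2) %% 3).
Definition gmul (u v : gauss) : gauss :=
  ((u.1 * v.1 + 2 * (u.2 * v.2)) %% 3, (u.1 * v.2 + u.2 * v.1) %% 3)%N.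
Definition gopp (u : gauss) : gauss := ((2 * u.1) %% 3, (2 * u.2) %% 3)%N.
Definition gdet (v w : gauss * gauss) : gauss :=
  gadd (gmul v.2 w.1) (gopp (gmul v.1 w.2)).
Definition gtrans (v w : gauss * gauss) : gauss * gauss :=
  (gadd w.1 (gmul v.1 (gdet v w)), gadd w.2 (gmul v.2 (gdet v w))).

(** The transvections of a copy of [SL(2,5)] inside [SL(2,9)], each given by its
    vector, which is determined up to sign; they come in pairs on ten lines. *)
Definition icosa_vectors : seq (gauss * gauss) :=
  [:: ((0,0),(1,1)); ((0,0),(1,2)); ((0,1),(0,0)); ((0,1),(1,0)); ((0,1),(2,0));
      ((1,0),(0,0)); ((1,0),(0,1)); ((1,0),(0,2)); ((1,1),(0,1)); ((1,1),(0,2));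
      ((1,1),(1,0)); ((1,1),(1,1)); ((1,1),(2,0)); ((1,1),(2,2)); ((1,2),(0,1));
      ((1,2),(0,2)); ((1,2),(1,0)); ((1,2),(1,2)); ((1,2),(2,0)); ((1,2),(2,1))]%N.

(** Vectors on distinct lines give distinct transvections, whence a lower bound on
    the size of the rack. *)
Fixpoint line_reps (s : seq (gauss * gauss)) : seq (gauss * gauss) :=
  if s is v :: s' then
    let r := line_reps s' in
    if has (fun w => gdet v w == (0, 0)) r then r else v :: r
  else [::].

Lemma icosa_vectors_nz : all (fun v => (v.1 != (0, 0)) || (v.2 != (0, 0)))
  icosa_vectors.
Proof. by vm_compute. Qed.

Lemma icosa_vectors_reduced :
  all (fun v => all (fun k => k < 3) [:: v.1.1; v.1.2; v.2.1; v.2.2]) icosa_vectors.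
Proof. by vm_compute. Qed.

Lemma icosa_vectors_closed :
  all (fun v => all (fun w =>
     (gtrans v w \in icosa_vectors) ||
     ((gopp (gtrans v w).1, gopp (gtrans v w).2) \in icosa_vectors)) icosa_vectors)
  icosa_vectors.
Proof. by vm_compute. Qed.

Lemma size_line_reps : size (line_reps icosa_vectors) = 10.
Proof. by vm_compute. Qed.

Lemma line_reps_sub : all (fun v => v \in icosa_vectors) (line_reps icosa_vectors).
Proof. by vm_compute. Qed.

Lemma line_reps_uniq : uniq (line_reps icosa_vectors).
Proof. by vm_compute. Qed.

Lemma line_reps_det : all (fun v => all (fun w => (v != w) ==> (gdet v w != (0, 0)))
  (line_reps icosa_vectors)) (line_reps icosa_vectors).
Proof. by vm_compute. Qed.

(** As -1 is not a square modulo 3, [x + y i] with [i ^ 2 = -1] has nonzero norm. *)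
Lemma gauss_norm (u : gauss) : u.1 < 3 -> u.2 < 3 -> u != (0, 0) ->
  (u.1 * u.1 + u.2 * u.2) %% 3 != 0.
Proof. by case: u => [[|[|[|x]]] [|[|[|y]]]]. Qed.

Section Icosahedral.
Variables (F : finFieldType) (i : F).
Hypotheses (ch : 3 \in [pchar F]%R) (sqr_i : (i ^+ 2 = -1)%R).
Implicit Types (u : gauss) (v w : gauss * gauss).

Let three0 : (3%:R = 0 :> F)%R. Proof. exact: pcharf0 ch. Qed.
Let two : (2%:R = -1 :> F)%R.
Proof. by apply/eqP; rewrite -addr_eq0 -[1%R]/(1%:R)%R -natrD three0. Qed.

Let phi u : F := (u.1%:R + u.2%:R * i)%R.

Let phiD u u' : phi (gadd u u') = (phi u + phi u')%R.
Proof. by rewrite /phi /= !(GRing.natr_mod_pchar ch) !natrD; ring. Qed.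

Let phiM u u' : phi (gmul u u') = (phi u * phi u')%R.
Proof.
rewrite /phi /= !(GRing.natr_mod_pchar ch) !(natrD, natrM) two.
by ring: sqr_i.
Qed.

Let phiN u : phi (gopp u) = (- phi u)%R.
Proof. by rewrite /phi /= !(GRing.natr_mod_pchar ch) !natrM two; ring. Qed.

Let phi_eq0 u : u.1 < 3 -> u.2 < 3 -> (phi u == 0)%R = (u == (0, 0)).
Proof.
move=> u1 u2; apply/eqP/eqP=> [E|->]; last by rewrite /phi mul0r addr0.
apply/eqP; apply: contraT => /(gauss_norm u1 u2); apply: contraNT => _.
have : (phi u * (u.1%:R - u.2%:R * i) = 0)%R by rewrite E mul0r.
rewrite /phi mulrC -subr_sqr exprMn sqr_i mulrN1 opprK -!natrX -natrD => /eqP.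
by rewrite -(dvdn_pcharf ch) /dvdn !mulnn.
Qed.

Let phi_gadd_eq0 u u' : (phi (gadd u u') == 0)%R = (gadd u u' == (0, 0)).
Proof. by apply: phi_eq0; apply: ltn_pmod. Qed.

Let tv v : PGL F := transvec (phi v.1) (phi v.2).

Let phi_det v w : phi (gdet v w) = (phi v.2 * phi w.1 - phi v.1 * phi w.2)%R.
Proof. by rewrite /gdet phiD phiN !phiM. Qed.

Let tvJ v w : conj_op (tv v) (tv w) = tv (gtrans v w).
Proof.
rewrite /tv {1}/transvec transvecJ; last by ring.
by apply: transvec_eq; rewrite /gtrans /= phiD phiM phi_det; ring.
Qed.

Let tvN v : tv (gopp v.1, gopp v.2) = tv v.
Proof. by rewrite /tv !phiN transvecN. Qed.

Let nz v : v \in icosa_vectors -> (phi v.1 != 0)%R || (phi v.2 != 0)%R.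
Proof.
move=> Vv; have /= := allP icosa_vectors_reduced v Vv.
case/and5P=> v11 v12 v21 v22 _; rewrite !phi_eq0 //.
exact: (allP icosa_vectors_nz).
Qed.

Let fixes_tv v : v \in icosa_vectors -> fixes (tv v) = [set pt (phi v.1) (phi v.2)].
Proof. by move=> Vv; apply: fixes_transvec; apply: nz. Qed.

Let X : {set PGL F} := [set u in map tv icosa_vectors].

Let tvX v : v \in icosa_vectors -> tv v \in X.
Proof. by move=> Vv; rewrite inE map_f. Qed.

(** The fixed point of a transvection determines its line. *)
Let reps_inj : {in line_reps icosa_vectors &, injective tv}.
Proof.
move=> v w Lv Lw E; have Vv := allP line_reps_sub v Lv; have Vw := allP line_reps_sub w Lw.
have /set1_inj/(pt_det (nz Vv) (nz Vw))/eqP : [set pt (phi v.1) (phi v.2)] = [set pt (phi w.1) (phi w.2)].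
  by rewrite -(fixes_tv Vv) -(fixes_tv Vw) E.
rewrite -opprB oppr_eq0 -phi_det phi_gadd_eq0 => /eqP D0; apply/eqP.
have := allP (allP line_reps_det v Lv) w Lw; rewrite -[gdet v w]/(gadd _ _) D0 eqxx implybF negbK; apply.
Qed.

Let X_ge : 10 <= #|X|.
Proof.
have U : uniq (map tv (line_reps icosa_vectors)).
  by rewrite (map_inj_in_uniq reps_inj); apply: line_reps_uniq.
rewrite -size_line_reps -(size_map tv) -(card_uniqP U); apply: subset_leq_card.
apply/subsetP=> _ /mapP[v Lv ->]; exact/tvX/(allP line_reps_sub).
Qed.

Let X_le : #|X| <= 20.
Proof. by rewrite cardsE (leq_trans (card_size _)) // size_map. Qed.

Let X_orbit : X \subset unip_orbit (-1 : F)%R.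
Proof.
by apply/subsetP=> u; rewrite in_set => /mapP[v Vv ->]; apply: transvec_orbit; apply: nz.
Qed.

Lemma icosahedral_rack : exists X : {set PGL F},
  [/\ is_subrack (@conj_op (PGL F)) X (unip_orbit (-1 : F)%R),
      9 <= #|X| <= 20 & forall z, ~~ (X \subset trans z)].
Proof.
exists X; split; last 1 first.
- move=> z; apply/negP=> /subsetP Xz.
  have Lw := mem_nth ((0, 0), (0, 0)) (isT : 0 < size (line_reps icosa_vectors)).
  have Lv := mem_nth ((0, 0), (0, 0)) (isT : 1 < size (line_reps icosa_vectors)).
  set v := nth _ _ _ in Lv; set w := nth _ _ _ in Lw.
  have Vv := allP line_reps_sub v Lv; have Vw := allP line_reps_sub w Lw.
  have D : gdet v w != (0, 0) by vm_compute.
  have cen k : k \in icosa_vectors -> pt (phi k.1) (phi k.2) = z.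
    move=> Vk; apply/set1P; rewrite -(transP (Xz _ (tvX Vk))).
      by rewrite (fixes_tv Vk) set11.
    by apply: unipotent_neq1; rewrite /unipotent (fixes_tv Vk) cards1.
  have /(pt_det (nz Vv) (nz Vw))/eqP : pt (phi v.1) (phi v.2) = pt (phi w.1) (phi w.2).
    by rewrite !cen.
  by rewrite -opprB oppr_eq0 -phi_det phi_gadd_eq0 -[gadd _ _]/(gdet v w) (negPf D).
- split=> //; first by rewrite -card_gt0 (leq_trans _ X_ge).
  move=> u u'; rewrite 2!in_set => /mapP[v Vv ->] /mapP[w Vw ->]; rewrite tvJ.
  case/orP: (allP (allP icosa_vectors_closed v Vv) w Vw) => Vt; first exact: tvX.
  by rewrite -tvN; apply: tvX.
by rewrite X_le (leq_trans _ X_ge).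
Qed.

End Icosahedral.

Lemma card_three_cycles4 : #|three_cycles 'I_4| <= 8.
Proof.
have [F0 cF0] := finField3_exists; have [f injf] := pgl_perm_rep cF0.
rewrite -(three_cycles_image cF0 injf) (leq_trans (leq_imset_card _ _)) //.
have := card_unipotents F0; rewrite cF0 -[(4 * _)%N]/8 => <-; apply: subset_leq_card.
by apply/subsetP=> u; rewrite PGL_classP inE.
Qed.

(** The unipotents form at most two classes of [PSL F0], because the product of two
    nonsquares is a square, and dilations carry one class to the other. *)
Lemma unipotent_class_card (F0 : finFieldType) (C : {set PGL F0}) :
  unipotent_class (PSL F0) C ->
  #|C| <= #|F0|.+1 * #|F0|.-1 <= 2 * #|C|.
Proof.
case/unipotent_class_orbit=> b bn0 ->; rewrite -card_unipotents; apply/andP; split.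
  apply: subset_leq_card; apply/subsetP=> u ub; rewrite inE.
  exact: unip_orbit_unipotent ub.
have card_orb (d : F0) : (d != 0)%R -> #|unip_orbit d| = #|unip_orbit b|.
  move=> dn0; have bdn0 : (b / d != 0)%R by rewrite mulf_neq0 ?invr_eq0.
  rewrite -(cardJg (unip_orbit b) (mob (b / d) 0 0 1)) (unip_orbitJ b bdn0 (erefl _)).
  by rewrite invf_div mulrC divfK.
have [ub | /subsetPn[v]] := boolP ([set u : PGL F0 | unipotent u] \subset unip_orbit b).
  by rewrite (leq_trans (subset_leq_card ub)) // leq_pmull.
rewrite inE => /unipotent_orbit[c cn0 vc] vb.
rewrite mul2n -addnn -{2}(card_orb c cn0).
apply: leq_trans (leq_card_setU _ _); apply: subset_leq_card.
apply/subsetP=> u; rewrite 2!inE => /unipotent_orbit[d dn0 ud].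
have cover y : (d / y)%R \in unit_squares F0 -> (y != 0)%R -> u \in unip_orbit y.
  move=> dy yn0; have dy' : unip d \in unip_orbit y by rewrite unip_orbitP.
  by rewrite /unip_orbit -(class_eqP dy').
apply/orP; have [db | ndb] := boolP ((d / b)%R \in unit_squares F0).
  by left; apply: cover.
right; apply: cover => //; rewrite (_ : (d / c = d / b * (c / b)^-1)%R); last first.
  by field; rewrite bn0 cn0.
have cb : (c / b)%R \notin unit_squares F0.
  rewrite -unip_orbitP //; apply: contra vb => cb.
  by rewrite /unip_orbit -(class_eqP cb).
rewrite nonsquareM ?invr_eq0 ?mulf_neq0 ?invr_eq0 //.
by apply: contra cb => /unit_squaresV; rewrite invrK.
Qed.

(** In characteristic 3, the classes over a subfield have at most 8 elements if the
    subfield has order 3 and at least 40 otherwise, and there are only eight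
    3-cycles on four letters. *)
Lemma listed_icosahedral (q : nat) (gT : finGroupType) (D : {set gT}) :
  power_of (3 ^ 2) q -> listed_rack 3 q D -> 9 <= #|D| <= 20 ->
  rack_isom (@conj_op gT) (@conj_op {perm 'I_5}) D (three_cycles 'I_5).
Proof.
case=> k k0 Dq listD.
have card3 (F0 : finFieldType) m : q = (#|F0| ^ m)%N ->
    #|F0| = 3 \/ 9 <= #|F0| .
  move=> Eq; have d3 : 3 %| #|F0|.
    have := dvdn_exp k0 (dvdn_mulr 3 (dvdnn 3)); rewrite -[(3 * 3)%N]/(3 ^ 2)%N -Dq Eq.
    by rewrite (Euclid_dvdX _ _ (isT : prime 3)) => /andP[].
  have [p _ chp] := finPcharP F0; have cF0 := card_pprimeChar chp.
  rewrite -[#|pPrimeCharType chp|]/(#|F0|) in cF0; move: d3; rewrite cF0.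
  rewrite (Euclid_dvdX _ _ (isT : prime 3)) dvdn_prime2 ?(pcharf_prime chp) //.
  case: (logn _ _) => [|[|n]] /andP[/eqP <- // _]; first by left.
  by right; rewrite !expnS mulnA leq_pmulr // expn_gt0.
have small n : n <= 8 -> 9 <= n -> False by lia.
pose goal (gT : finGroupType) (D : {set gT}) := 9 <= #|D| <= 20 ->
  rack_isom (@conj_op gT) (@conj_op {perm 'I_5}) D (three_cycles 'I_5).
rewrite -/(goal gT D); case: gT D / listD; rewrite /goal.
- move=> q0 F0 C <- [m m0 /card3[F3|F9]] /unipotent_class_card/andP[le ge] /andP[l9 l20].
    by case: (small _ _ l9); rewrite F3 in le.
  suff : 80 <= #|F0|.+1 * #|F0|.-1 by move: l20 ge; lia.
  by apply: (@leq_mul 10 8) => //; case: (#|F0|) F9.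
- move=> q0 F0 <- _ [m m0]; rewrite -expnM => /card3 c3 /andP[l9 l20].
  have E : #|unip (1 : F0)%R ^: [set: PGL F0]| = (#|F0|.+1 * #|F0|.-1)%N.
    rewrite -card_unipotents; congr #|pred_of_set _|; apply/setP=> u.
    by rewrite PGL_classP inE.
  rewrite E in l9 l20; case: c3 => [F3|F9]; first by rewrite F3 in l9.
  have : 80 <= #|F0|.+1 * #|F0|.-1 by apply: (@leq_mul 10 8) => //; case: (#|F0|) F9.
  by move: l20; lia.
- by [].
- by [].
- move=> C _ _ C3 /andP[l9 _]; case: (small _ _ l9).
  exact: leq_trans (subset_leq_card C3) card_three_cycles4.
- by move=> _ _ /andP[l9 _]; case: (small _ card_three_cycles4 l9).
move=> _ _ _; by exists id; split=> //; apply: imset_id.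
Qed.

(** The rack of twenty transvections has several centers, so [fused_rack_listed]
    identifies it with a listed rack, and its cardinal tells which. *)
Lemma occurs_A5_3cycles (F : finFieldType) (x : F) : (x != 0)%R ->
  3 \in [pchar F]%R -> power_of (3 ^ 2) #|F| -> occurs x (three_cycles 'I_5).
Proof.
move=> xn0 ch powF; have [F0 cF0] := finField3_exists.
have [k k0 cF] := powF; have k2 : 0 < 2 * k by rewrite muln_gt0.
have [f _] : exists f : {rmorphism F0 -> F}, injective f.
  by apply: (finField_embed k2); rewrite cF0 expnM.
have m1n0 : (-1 != 0 :> F)%R by rewrite oppr_eq0 oner_neq0.
have /imsetP[i _ sqr_i] : (-1 : F)%R \in unit_squares F.
  have <- : f (-1)%R = (-1)%R by rewrite rmorphN rmorph1.
  apply: (@subfield_square _ _ f _ k); rewrite ?cF0 ?oppr_eq0 ?oner_neq0 //.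
  by rewrite cF oddX orbT.
have [X [subX /andP[X9 X20] Xz]] := icosahedral_rack ch (esym sqr_i).
have [Xn0 Xorb clX] := subX.
have uniX : {in X, forall u, unipotent u}.
  by move=> u /(subsetP Xorb); apply: unip_orbit_unipotent.
have rackX : fused_rack X.
  split=> // u v /(subsetP Xorb) ux /(subsetP Xorb) vx.
  exact: unip_orbit_eq ux vx.
have [[z Xsub]|[gT [D [listD isoD]]]] := fused_rack_listed ch (erefl _) rackX.
  by have := Xz z; rewrite Xsub.
have isoX : rack_isom (@conj_op (PGL F)) (@conj_op {perm 'I_5}) X (three_cycles 'I_5).
  apply: (rack_isom_trans isoD); apply: (listed_icosahedral powF listD).
  by have [g [injg <- _]] := isoD; rewrite card_in_imset // X9.
apply: occurs_isom isoX.
apply: (@occurs_morphism _ x (-1)%R _ [set: PGL F] (idm_morphism _)) => //.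
- exact: injm_idm.
- by rewrite subsetT.
by rewrite (eq_imset _ (_ : _ =1 id)) ?imset_id.
Qed.

(** * The subracks of a unipotent class *)

Theorem proposition5p13 (p q : nat) (F : finFieldType) (x : F)
    (p_prime : prime p) (q_pow : power_of p q) (F_card : #|F| = q)
    (x_neq0 : (x != 0)%R) :
  [/\ (* every subrack is of one of the types *)
      forall X : {set PGL F},
        is_subrack (@conj_op (PGL F)) X (unip_orbit x) ->
        unip_subset_conjugate x X \/
        exists (gT : finGroupType) (C : {set gT}),
          listed_rack p q C /\
          rack_isom (@conj_op (PGL F)) (@conj_op gT) X C,
      (* type (1) consists of the abelian subracks *)
      forall X : {set PGL F},
        unip_subset_conjugate x X <->
        is_subrack (@conj_op (PGL F)) X (unip_orbit x) /\
        abelian_rack (@conj_op (PGL F)) X,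
      (* and these have size at most (q - 1) / e *)
      forall X : {set PGL F},
        unip_subset_conjugate x X ->
        (#|X| <= (q - 1) %/ gcdn 2 (q - 1))%N
    & (* every other listed rack occurs *)
      forall (gT : finGroupType) (C : {set gT}),
        listed_rack p q C ->
        exists X : {set PGL F},
          is_subrack (@conj_op (PGL F)) X (unip_orbit x) /\
          rack_isom (@conj_op (PGL F)) (@conj_op gT) X C].
Proof.
have [k _ qE] := q_pow.
have ch : p \in [pchar F]%R by apply: (@card_finPcharP _ p k); rewrite ?F_card.
split.
- move=> X [Xn0 Xorb clX].
  have rackX : fused_rack X.
    split=> // [u /(subsetP Xorb)|u v /(subsetP Xorb) ux /(subsetP Xorb) vx].
      exact: unip_orbit_unipotent.
    exact: unip_orbit_eq ux vx.
  have [[z Xz]|] := fused_rack_listed ch F_card rackX; last by right.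
  by left; apply: common_center_subset Xz.
- exact: unip_subset_conjugateP.
- by move=> X; rewrite -F_card; apply: unip_subset_conjugate_card.
move=> gT C listC; rewrite -[exists X, _]/(occurs x C).
rewrite -F_card in listC q_pow.
pose goal (gT : finGroupType) (C : {set gT}) := occurs x C.
rewrite -/(goal gT C); case: gT C / listC; rewrite /goal.
- by move=> q0 F0 C <- powq uniC; apply: occurs_PSL uniC.
- by move=> q0 F0 <- oq powq; apply: occurs_PGL.
- by move=> n gT G p2 dn dihG; rewrite p2 in ch; apply: occurs_dihedral dn dihG.
- by move=> p2 powq; rewrite p2 in ch; apply: occurs_A5_involutions.
- by move=> C p3 CA C3; apply: occurs_A4_class => //; rewrite -p3.
- by move=> p3 powq; apply: occurs_A4_3cycles => //; rewrite -p3.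
by move=> p3 powq; rewrite p3 in ch powq; apply: occurs_A5_3cycles.
Qed.
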